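(* Let $c$ be a real number with $-\pi/3<c<\pi/3$ and let $$D^*(s)=\frac{1}{2\pi i}\int_{c-i\infty}^{c+i\infty}F(z)\,u(z)^{-s}\,\mathrm{d}z ,\qquad F(z)=-\frac{4\sqrt3\cos z}{1+2\cos(2z)},\quad u(z)=\frac{(\pi-3z)(2\pi-3z)}{6\pi^2}.$$ Then, as $s\to-\infty$ through real values, $$D^*(s)\sim 2\sqrt3\cdot 6^{-s}\,\zeta(2s),$$ where $\zeta$ is the Riemann zeta function; that is, there is a function $\varepsilon(s)$, defined for all sufficiently negative real $s$, with $\varepsilon(s)\to0$ as $s\to-\infty$ and $D^*(s)=(1+\varepsilon(s))\,2\sqrt3\cdot6^{-s}\,\zeta(2s)$.
   Context: The integral is along the vertical line $\operatorname{Re}(z)=c$, oriented upward. The power $u(z)^{-s}=\exp(-s\log u(z))$ is taken with the principal branch of the logarithm; its branch cuts in $z$ are the segment $[\pi/3,2\pi/3]$ and the vertical line $\operatorname{Re}(z)=\pi/2$, so $u(z)^{-s}$ is holomorphic for $\operatorname{Re}(z)<\pi/3$. The poles of $F$ are exactly the points $k\pi/3$ with $k\in\mathbb{Z}$, $3\nmid k$. *)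

(* Defs.v *)
From Stdlib Require Export Reals.
From Coquelicot Require Export Coquelicot.

Open Scope R_scope.

Definition Cexp (z : C) : C :=
  (exp (Re z) * cos (Im z), exp (Re z) * sin (Im z)).

Definition Ccos (z : C) : C := ((Cexp (Ci * z) + Cexp (- (Ci * z))) / 2)%C.

(* Principal argument, with values in (-PI, PI]; meaningful for z <> 0 only. *)
Definition Carg (z : C) : R :=
  if Rle_dec 0 (Im z) then acos (Re z / Cmod z) else - acos (Re z / Cmod z).

(* Principal branch of the logarithm; meaningful for z <> 0 only. *)
Definition Clog (z : C) : C := (ln (Cmod z), Carg z).

(* Principal value of w^s; meaningful for w <> 0 only. *)
Definition Cpower (w s : C) : C := Cexp (s * Clog w)%C.

Definition F (z : C) : C :=
  (- (4 * RtoC (sqrt 3) * Ccos z) / (1 + 2 * Ccos (2 * z)))%C.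

Definition u (z : C) : C :=
  ((RtoC PI - 3 * z) * (2 * RtoC PI - 3 * z) / (6 * RtoC PI ^ 2))%C.

(* Integrals along Re z = c, oriented upward, with z = c + i y and dz = i dy.
   The improper integral converges when both ends tend to infinity
   independently of each other.  [vertical_integral] is meaningful only
   when [ex_vertical_integral] holds. *)
Definition vertical_integrand (c : R) (f : C -> C) (y : R) : C :=
  (f (c, y) * Ci)%C.

Definition ex_vertical_integral (c : R) (f : C -> C) : Prop :=
  ex_RInt_gen (V := C_R_NormedModule) (vertical_integrand c f)
    (Rbar_locally m_infty) (Rbar_locally p_infty).

Definition vertical_integral (c : R) (f : C -> C) : C :=
  RInt_gen (V := C_R_CompleteNormedModule) (vertical_integrand c f)
    (Rbar_locally m_infty) (Rbar_locally p_infty).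

Definition Dstar_integrand (s z : C) : C := (F z * Cpower (u z) (- s))%C.

Definition Dstar (c : R) (s : C) : C :=
  (/ (2 * RtoC PI * Ci) * vertical_integral c (Dstar_integrand s))%C.

(* zeta is holomorphic on C \ {1} and is given by the Dirichlet series
   sum_{n >= 1} n^{-s} for Re s > 1.  As C \ {1} is connected, this determines
   zeta on C \ {1}; the value at the pole 1 is left unconstrained. *)
Definition is_Riemann_zeta (zeta : C -> C) : Prop :=
  (forall s : C, s <> RtoC 1 ->
     ex_derive (K := C_AbsRing) (V := C_NormedModule) zeta s) /\
  (forall s : C, 1 < Re s ->
     is_series (K := C_AbsRing) (V := C_NormedModule)
       (fun n : nat => Cpower (RtoC (INR (S n))) (- s)) (zeta s)).

(* Main.v *)
Require Import Defs.
From Stdlib Require Import Reals Lra Lia Classical.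
From Coquelicot Require Import Coquelicot.
Open Scope R_scope.

(* Put sigma = -s. Moving the contour to the right onto the branch cut gives
   D*(s) = -(sin(pi sigma) / pi) (A + B): A comes from the two sides of the line
   Re z = pi/2 and equals the integral over y > 0 of
   4 sqrt 3 sinh y / (1 + 4 sinh(y)^2) (3 (y^2 + pi^2/36) / (2 pi^2))^sigma, and B
   comes from [pi/3, pi/2] and is negligible.
   On the zeta side, eta(s) = 1/2 int (1/2 + i y)^(-s) / cosh(pi y) dy is entire. The
   residues of z^(-s) / sin(pi z) at the positive integers identify it with the
   alternating Dirichlet series for Re s > 1, so the identity theorem gives
   (1 - 2^(1-s)) zeta(s) = eta(s) off s = 1. Moving that line to the imaginary axis
   yields eta(-2 sigma) = sin(pi sigma) int_0^oo y^(2 sigma) / sinh(pi y) dy.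
   Both integrals concentrate near y of order sigma, where
   4 sinh y / (1 + 4 sinh(y)^2) ~ 1 / sinh y and (y^2 + pi^2/36)^sigma ~ y^(2 sigma);
   the sine, which may vanish, is a common factor. *)

(** The constants match because [3 / (2 pi^2) * pi^2 * 4 = 6]: the first factor is the coefficient
    of [y^2 + pi^2/36] in [- u] on the cut, the second comes from rescaling [y] by [pi] in the eta
    integral, and [4^sigma] is what [1 - 2^(1-s)] leaves at [s = -2 sigma]. The pole of [F] at
    [pi/3] is crossed without a residue because [|u|^sigma] is of order [|z - pi/3|^sigma] there;
    [z^(2 sigma)] removes the pole of [1 / sin (pi z)] at [0] in the same way. The branch of [log u]
    that continues the principal one up to the cut differs above and below the real axis. Hence only
    the upper half-strip is deformed: the lower half is its complex conjugate, and the integrals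
    over real segments to the left of the branch point are real, so they drop out of the real part
    that remains. The kernel [1 / cosh (pi y)] makes the eta integral converge for every [s], which
    gives the continuation to negative [s] without a functional equation. *)

Lemma Cmod_le_parts (z : C) : Cmod z <= Rabs (Re z) + Rabs (Im z).
Proof.
  unfold Cmod. rewrite <- (sqrt_Rsqr (Rabs (Re z) + Rabs (Im z))).
  2: generalize (Rabs_pos (Re z)) (Rabs_pos (Im z)); lra.
  apply sqrt_le_1_alt. unfold Rsqr, Re, Im.
  generalize (Rabs_pos (fst z)) (Rabs_pos (snd z)).
  rewrite <- (pow2_abs (fst z)), <- (pow2_abs (snd z)). nra.
Qed.

Lemma im_le_Cmod (z : C) : Rabs (Im z) <= Cmod z.
Proof. eapply Rle_trans; [apply Rmax_r | apply Rmax_Cmod]. Qed.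

Lemma C_ext (z w : C) : Re z = Re w -> Im z = Im w -> z = w.
Proof. destruct z, w; unfold Re, Im; simpl; congruence. Qed.

Lemma Cmod_sub_sym (z w : C) : Cmod (z - w) = Cmod (w - z).
Proof. rewrite <- Cmod_opp. f_equal. ring. Qed.

Lemma Cmod_sub_ge (z w : C) : Cmod z - Cmod w <= Cmod (z - w).
Proof.
  replace z with ((z - w) + w)%C at 1 by ring.
  generalize (Cmod_triangle (z - w) w). lra.
Qed.

Lemma Cmod_sub_triangle (z w : C) : Cmod (z - w) <= Cmod z + Cmod w.
Proof. generalize (Cmod_triangle z (- w)). rewrite Cmod_opp. auto. Qed.

(** * Continuity and complex derivatives *)

Definition Ccts (f : C -> C) (z : C) : Prop :=
  forall e, 0 < e -> exists d, 0 < d /\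
    forall w, Cmod (w - z) < d -> Cmod (f w - f z) < e.

Definition Cnear (z : C) (P : C -> Prop) : Prop :=
  exists d, 0 < d /\ forall w, Cmod (w - z) < d -> P w.

(* Caratheodory's form of the complex derivative. *)
Definition Cder (f : C -> C) (z l : C) : Prop :=
  exists phi : C -> C, Ccts phi z /\ phi z = l /\
    Cnear z (fun w => f w = (f z + phi w * (w - z))%C).

Lemma Cnear_refl (z : C) (P : C -> Prop) : Cnear z P -> P z.
Proof.
  intros [d [Hd H]]. apply H. replace (z - z)%C with (RtoC 0) by ring.
  rewrite Cmod_0; auto.
Qed.

Lemma Cnear_and z (P Q : C -> Prop) : Cnear z P -> Cnear z Q -> Cnear z (fun w => P w /\ Q w).
Proof.
  intros [d [Hd H]] [d' [Hd' H']]. exists (Rmin d d'). split.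
  - apply Rmin_glb_lt; auto.
  - intros w Hw. split; [apply H | apply H'].
    + eapply Rlt_le_trans; [exact Hw | apply Rmin_l].
    + eapply Rlt_le_trans; [exact Hw | apply Rmin_r].
Qed.

Lemma Cnear_imp z (P Q : C -> Prop) : (forall w, P w -> Q w) -> Cnear z P -> Cnear z Q.
Proof. intros HPQ [d [Hd H]]. exists d. split; auto. Qed.

Lemma Cnear_all z (P : C -> Prop) : (forall w, P w) -> Cnear z P.
Proof. intros H. exists 1. split; [lra | auto]. Qed.

Lemma Ccts_near (f : C -> C) z e : 0 < e -> Ccts f z -> Cnear z (fun w => Cmod (f w - f z) < e).
Proof. intros He H. exact (H e He). Qed.

Lemma Ccts_ext_near (f g : C -> C) z : Cnear z (fun w => f w = g w) -> Ccts f z -> Ccts g z.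
Proof.
  intros H Hf e He. generalize (Cnear_refl _ _ H); intros Hz.
  destruct (Cnear_and _ _ _ H (Hf e He)) as [d [Hd K]].
  exists d. split; auto. intros w Hw. destruct (K w Hw) as [K1 K2].
  rewrite <- K1, <- Hz. exact K2.
Qed.

Lemma Ccts_const (c z : C) : Ccts (fun _ => c) z.
Proof.
  intros e He. exists 1. split; [lra|]. intros. replace (c - c)%C with (RtoC 0) by ring.
  rewrite Cmod_0; auto.
Qed.

Lemma Ccts_id (z : C) : Ccts (fun w => w) z.
Proof. intros e He. exists e. auto. Qed.

Lemma Ccts_plus (f g : C -> C) z : Ccts f z -> Ccts g z -> Ccts (fun w => f w + g w)%C z.
Proof.
  intros Hf Hg e He.
  destruct (Cnear_and _ _ _ (Hf (e/2) ltac:(lra)) (Hg (e/2) ltac:(lra))) as [d [Hd H]].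
  exists d. split; auto. intros w Hw. destruct (H w Hw).
  replace (f w + g w - (f z + g z))%C with ((f w - f z) + (g w - g z))%C by ring.
  eapply Rle_lt_trans; [apply Cmod_triangle | lra].
Qed.

Lemma Ccts_mult (f g : C -> C) z : Ccts f z -> Ccts g z -> Ccts (fun w => f w * g w)%C z.
Proof.
  intros Hf Hg e He.
  set (A := Cmod (f z)). set (B := Cmod (g z)).
  assert (HA : 0 <= A) by apply Cmod_ge_0. assert (HB : 0 <= B) by apply Cmod_ge_0.
  set (e1 := Rmin 1 (e / (A + B + 2))).
  assert (He1 : 0 < e1).
  { apply Rmin_glb_lt; [lra|]. apply Rdiv_lt_0_compat; lra. }
  assert (He1' : e1 <= 1) by apply Rmin_l.
  assert (He2 : e1 * (A + B + 2) <= e).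
  { apply Rle_trans with (e / (A + B + 2) * (A + B + 2)).
    - apply Rmult_le_compat_r; [lra | apply Rmin_r].
    - right. field. lra. }
  destruct (Cnear_and _ _ _ (Hf e1 He1) (Hg e1 He1)) as [d [Hd H]].
  exists d. split; auto. intros w Hw. destruct (H w Hw) as [H1 H2].
  replace (f w * g w - f z * g z)%C
    with ((f w - f z) * (g w - g z) + (f w - f z) * g z + f z * (g w - g z))%C by ring.
  eapply Rle_lt_trans; [apply Cmod_triangle|].
  eapply Rle_lt_trans; [apply Rplus_le_compat_r, Cmod_triangle|].
  rewrite !Cmod_mult. fold A B.
  generalize (Cmod_ge_0 (f w - f z)) (Cmod_ge_0 (g w - g z)). nra.
Qed.

Lemma Ccts_opp (f : C -> C) z : Ccts f z -> Ccts (fun w => - f w)%C z.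
Proof.
  intros Hf e He. destruct (Hf e He) as [d [Hd H]]. exists d. split; auto.
  intros w Hw. replace (- f w - - f z)%C with (- (f w - f z))%C by ring.
  rewrite Cmod_opp; auto.
Qed.

Lemma Ccts_minus (f g : C -> C) z : Ccts f z -> Ccts g z -> Ccts (fun w => f w - g w)%C z.
Proof. intros Hf Hg. apply (Ccts_plus f (fun w => - g w)%C); auto. apply Ccts_opp; auto. Qed.

Lemma Ccts_comp (f g : C -> C) z : Ccts f z -> Ccts g (f z) -> Ccts (fun w => g (f w)) z.
Proof.
  intros Hf Hg e He. destruct (Hg e He) as [d [Hd H]].
  destruct (Hf d Hd) as [d' [Hd' H']]. exists d'. split; auto.
Qed.

Lemma Ccts_nz_near (f : C -> C) z : Ccts f z -> f z <> 0 -> Cnear z (fun w => f w <> 0).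
Proof.
  intros Hf Hz. assert (H0 : 0 < Cmod (f z)) by (apply Cmod_gt_0; auto).
  apply (Cnear_imp z (fun w => Cmod (f w - f z) < Cmod (f z))).
  - intros w Hw Hfw. rewrite Hfw in Hw.
    replace (0 - f z)%C with (- f z)%C in Hw by ring. rewrite Cmod_opp in Hw. lra.
  - apply (Hf _ H0).
Qed.

Lemma Ccts_inv (f : C -> C) z : Ccts f z -> f z <> 0 -> Ccts (fun w => / f w)%C z.
Proof.
  intros Hf Hz e He. set (A := Cmod (f z)).
  assert (HA : 0 < A) by (apply Cmod_gt_0; auto).
  destruct (Cnear_and _ _ _ (Hf (A / 2) ltac:(lra))
             (Hf (e * A * A / 2) ltac:(apply Rdiv_lt_0_compat; [repeat apply Rmult_lt_0_compat; lra | lra])))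
    as [d [Hd H]].
  exists d. split; auto. intros w Hw. destruct (H w Hw) as [H1 H2].
  assert (HB : A / 2 < Cmod (f w)).
  { generalize (Cmod_sub_ge (f z) (f w)). rewrite Cmod_sub_sym. fold A. lra. }
  assert (Hfw : f w <> 0).
  { intros K. rewrite K, Cmod_0 in HB. lra. }
  replace (/ f w - / f z)%C with ((f z - f w) / (f w * f z))%C by (field; auto).
  rewrite Cmod_div by (apply Cmult_neq_0; auto). rewrite Cmod_sub_sym, Cmod_mult. fold A.
  apply Rmult_lt_reg_r with (Cmod (f w) * A); [apply Rmult_lt_0_compat; lra|].
  unfold Rdiv. rewrite Rmult_assoc, Rinv_l, Rmult_1_r.
  2: apply Rgt_not_eq, Rmult_lt_0_compat; lra.
  eapply Rlt_le_trans; [exact H2|]. assert (0 < e * A) by nra. nra.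
Qed.

Lemma Ccts_div (f g : C -> C) z : Ccts f z -> Ccts g z -> g z <> 0 -> Ccts (fun w => f w / g w)%C z.
Proof. intros. apply (Ccts_mult f (fun w => / g w)%C); auto. apply Ccts_inv; auto. Qed.

Lemma Cder_cts f z l : Cder f z l -> Ccts f z.
Proof.
  intros [phi [Hp [_ H]]].
  apply (Ccts_ext_near (fun w => f z + phi w * (w - z))%C).
  - apply (Cnear_imp z _ _ (fun w E => eq_sym E) H).
  - apply (Ccts_plus (fun _ => f z) (fun w => phi w * (w - z))%C); [apply Ccts_const|].
    apply (Ccts_mult phi (fun w => w - z)%C); auto.
    apply (Ccts_minus (fun w => w) (fun _ => z)); [apply Ccts_id | apply Ccts_const].
Qed.

Lemma Cder_ext_near f g z l : Cnear z (fun w => f w = g w) -> Cder f z l -> Cder g z l.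
Proof.
  intros H [phi [Hp [Hl K]]]. exists phi. split; auto. split; auto.
  generalize (Cnear_refl _ _ H); intros Hz.
  apply (Cnear_imp z _ _) with (2 := Cnear_and _ _ _ H K).
  intros w [H1 H2]. rewrite <- H1, <- Hz. exact H2.
Qed.

Lemma Cder_val f z l l' : Cder f z l -> l = l' -> Cder f z l'.
Proof. intros H <-. exact H. Qed.

Lemma Cder_const c z : Cder (fun _ => c) z 0.
Proof.
  exists (fun _ => 0). split; [apply Ccts_const|]. split; auto.
  apply Cnear_all. intros w. ring.
Qed.

Lemma Cder_id z : Cder (fun w => w) z 1.
Proof.
  exists (fun _ => 1). split; [apply Ccts_const|]. split; auto.
  apply Cnear_all. intros w. ring.
Qed.

Lemma Cder_plus f g z a b : Cder f z a -> Cder g z b -> Cder (fun w => f w + g w)%C z (a + b)%C.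
Proof.
  intros [p [Hp [<- Kp]]] [q [Hq [<- Kq]]]. exists (fun w => p w + q w)%C.
  split; [apply Ccts_plus; auto|]. split; auto.
  apply (Cnear_imp z _ _) with (2 := Cnear_and _ _ _ Kp Kq).
  intros w [-> ->]. ring.
Qed.

Lemma Cder_mult f g z a b :
  Cder f z a -> Cder g z b -> Cder (fun w => f w * g w)%C z (a * g z + f z * b)%C.
Proof.
  intros Hf Hg. assert (Cg := Cder_cts _ _ _ Hg).
  destruct Hf as [p [Hp [<- Kp]]], Hg as [q [Hq [<- Kq]]].
  exists (fun w => p w * g w + f z * q w)%C. split; [|split; auto].
  - apply (Ccts_plus (fun w => p w * g w)%C (fun w => f z * q w)%C).
    + apply Ccts_mult; auto.
    + apply (Ccts_mult (fun _ => f z)); auto. apply Ccts_const.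
  - apply (Cnear_imp z _ _) with (2 := Cnear_and _ _ _ Kp Kq).
    intros w [-> ->]. ring.
Qed.

Lemma Cder_opp f z a : Cder f z a -> Cder (fun w => - f w)%C z (- a)%C.
Proof.
  intros H. apply (Cder_ext_near (fun w => (-1) * f w)%C).
  - apply Cnear_all. intros w. ring.
  - eapply Cder_val; [apply (Cder_mult (fun _ => (-1)%C) f); [apply Cder_const | exact H]|]. cbv beta. ring.
Qed.

Lemma Cder_minus f g z a b : Cder f z a -> Cder g z b -> Cder (fun w => f w - g w)%C z (a - b)%C.
Proof. intros Hf Hg. apply (Cder_plus f (fun w => - g w)%C); auto. apply Cder_opp; auto. Qed.

Lemma Cder_comp f g z a b : Cder f z a -> Cder g (f z) b -> Cder (fun w => g (f w)) z (b * a)%C.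
Proof.
  intros Hf Hg. assert (Cf := Cder_cts _ _ _ Hf).
  destruct Hf as [p [Hp [<- Kp]]], Hg as [q [Hq [<- Kq]]].
  exists (fun w => q (f w) * p w)%C. split; [|split; auto].
  - apply (Ccts_mult (fun w => q (f w)) p); auto. apply (Ccts_comp f q); auto.
  - destruct Kq as [d [Hd Kq]].
    apply (Cnear_imp z _ _) with (2 := Cnear_and _ _ _ Kp (Cf d Hd)).
    intros w [E Hw]. rewrite (Kq _ Hw). rewrite E at 2. ring.
Qed.

Lemma Cder_inv f z a : Cder f z a -> f z <> 0 -> Cder (fun w => / f w)%C z (- a / (f z * f z))%C.
Proof.
  intros Hf Hz. assert (Cf := Cder_cts _ _ _ Hf).
  destruct Hf as [p [Hp [<- Kp]]].
  exists (fun w => - p w / (f w * f z))%C. split; [|split; auto].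
  - apply (Ccts_div (fun w => - p w)%C (fun w => f w * f z)%C).
    + apply Ccts_opp; auto.
    + apply (Ccts_mult f); auto. apply Ccts_const.
    + apply Cmult_neq_0; auto.
  - apply (Cnear_imp z _ _) with (2 := Cnear_and _ _ _ Kp (Ccts_nz_near _ _ Cf Hz)).
    intros w [E Hw].
    assert (E' : (f z - f w = - p w * (w - z))%C) by (rewrite E; ring).
    replace (/ f w)%C with (/ f z + (f z - f w) / (f w * f z))%C by (field; auto).
    rewrite E'. field. auto.
Qed.

Lemma Cder_div f g z a b : Cder f z a -> Cder g z b -> g z <> 0 ->
  Cder (fun w => f w / g w)%C z ((a * g z - f z * b) / (g z * g z))%C.
Proof.
  intros Hf Hg Hz. eapply Cder_val.
  - apply (Cder_mult f (fun w => / g w)%C); [exact Hf | apply (Cder_inv g); eauto].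
  - simpl. field. auto.
Qed.

Lemma Cder_scal c f z a : Cder f z a -> Cder (fun w => c * f w)%C z (c * a)%C.
Proof.
  intros H. eapply Cder_val; [apply (Cder_mult (fun _ => c) f); [apply Cder_const | exact H]|].
  simpl. ring.
Qed.

(** The difference quotient, completed by [l] at [z], is the Caratheodory factor. *)
Lemma Cder_bound f z l :
  (forall e, 0 < e -> Cnear z (fun w => Cmod (f w - f z - l * (w - z)) <= e * Cmod (w - z))) ->
  Cder f z l.
Proof.
  intros H.
  assert (Hdec : exists phi : C -> C, phi z = l /\ forall w, w <> z -> phi w = ((f w - f z) / (w - z))%C).
  { exists (fun w => if Ceq_dec w z then l else ((f w - f z) / (w - z))%C).
    split; [|intros w Hw]; destruct (Ceq_dec _ _); tauto. }
  destruct Hdec as [phi [E1 E2]].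
  exists phi. split; [|split; auto].
  - intros e He. destruct (H (e/2) ltac:(lra)) as [d [Hd K]]. exists d. split; auto.
    intros w Hw. destruct (classic (w = z)) as [->|Hz].
    + replace (phi z - phi z)%C with (RtoC 0) by ring. rewrite Cmod_0; auto.
    + assert (Hwz := Cminus_eq_contra _ _ Hz).
      rewrite E1, E2 by auto.
      replace ((f w - f z) / (w - z) - l)%C with ((f w - f z - l * (w - z)) / (w - z))%C by (field; auto).
      rewrite Cmod_div by auto.
      apply Rle_lt_trans with (e / 2); [|lra].
      apply Rcomplements.Rle_div_l; [apply Cmod_gt_0; auto|]. auto.
  - apply Cnear_all. intros w. destruct (classic (w = z)) as [->|Hz]; [ring|].
    rewrite E2 by auto. field. apply Cminus_eq_contra; auto.
Qed.

Lemma Cder_eps f z l e : 0 < e -> Cder f z l ->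
  Cnear z (fun w => Cmod (f w - f z - l * (w - z)) <= e * Cmod (w - z)).
Proof.
  intros He [p [Hp [<- K]]].
  apply (Cnear_imp z _ _) with (2 := Cnear_and _ _ _ K (Hp e He)).
  intros w [-> Hw].
  replace (f z + p w * (w - z) - f z - p z * (w - z))%C with ((p w - p z) * (w - z))%C by ring.
  rewrite Cmod_mult. apply Rmult_le_compat_r; [apply Cmod_ge_0 | lra].
Qed.

Lemma Cder_of_is_derive (f : C -> C) (z l : C) :
  is_derive (K := C_AbsRing) (V := C_NormedModule) f z l -> Cder f z l.
Proof.
  intros [_ H]. apply Cder_bound. intros e He.
  specialize (H z (fun P HP => HP) (mkposreal e He)).
  destruct H as [d H]. exists d. split; [apply cond_pos|].
  intros w Hw. specialize (H w Hw).
  rewrite (Cmult_comm l (w - z)). exact H.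
Qed.

(** * The exponential and the principal logarithm *)

Lemma exp_le_compat x y : x <= y -> exp x <= exp y.
Proof. intros [H| ->]; [left; apply exp_increasing; auto | lra]. Qed.

Lemma Cexp_plus z w : Cexp (z + w) = (Cexp z * Cexp w)%C.
Proof.
  unfold Cexp. rewrite re_plus, im_plus, exp_plus, cos_plus, sin_plus.
  apply C_ext; simpl; ring.
Qed.

Lemma Cexp_0 : Cexp 0 = 1.
Proof. unfold Cexp; simpl. rewrite exp_0, cos_0, sin_0. apply C_ext; simpl; ring. Qed.

Lemma Cmod_Cexp (z : C) : Cmod (Cexp z) = exp (Re z).
Proof.
  unfold Cmod, Cexp, fst, snd.
  replace ((exp (Re z) * cos (Im z)) ^ 2 + (exp (Re z) * sin (Im z)) ^ 2)
    with (Rsqr (exp (Re z))).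
  - apply sqrt_Rsqr. left; apply exp_pos.
  - generalize (sin2_cos2 (Im z)). unfold Rsqr. intros E.
    replace ((exp (Re z) * cos (Im z)) ^ 2 + (exp (Re z) * sin (Im z)) ^ 2)
      with (exp (Re z) * exp (Re z) * (sin (Im z) * sin (Im z) + cos (Im z) * cos (Im z))) by ring.
    rewrite E. ring.
Qed.

Lemma Cexp_nz (z : C) : Cexp z <> 0.
Proof. apply Cmod_gt_0. rewrite Cmod_Cexp. apply exp_pos. Qed.

Lemma Cexp_opp (z : C) : Cexp (- z) = (/ Cexp z)%C.
Proof.
  assert (E : (Cexp z * Cexp (- z))%C = 1).
  { rewrite <- Cexp_plus. replace (z + - z)%C with (RtoC 0) by ring. apply Cexp_0. }
  rewrite <- (Cmult_1_r (/ Cexp z)), <- E. field. apply Cexp_nz.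
Qed.

Lemma Cexp_conj (z : C) : Cexp (Cconj z) = Cconj (Cexp z).
Proof.
  unfold Cexp. rewrite re_conj, im_conj, cos_neg, sin_neg. apply C_ext; simpl; ring.
Qed.

Lemma Cexp_RtoC x : Cexp (RtoC x) = RtoC (exp x).
Proof. unfold Cexp; simpl. rewrite cos_0, sin_0. apply C_ext; simpl; ring. Qed.

Lemma Cmod_Cexp_le (z : C) : Cmod (Cexp z) <= exp (Cmod z).
Proof.
  rewrite Cmod_Cexp. apply exp_le_compat.
  eapply Rle_trans; [apply Rle_abs | apply re_le_Cmod].
Qed.

Lemma exp_sub1_abs x : Rabs (exp x - 1) <= Rabs x * exp (Rabs x).
Proof.
  assert (H1 := exp_ineq1_le x). assert (H2 := exp_ineq1_le (- x)).
  assert (E : exp x * exp (- x) = 1) by (rewrite <- exp_plus, Rplus_opp_r; apply exp_0).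
  assert (P1 := exp_pos x). assert (P2 := exp_pos (- x)).
  unfold Rabs. destruct (Rcase_abs x), (Rcase_abs (exp x - 1)); nra.
Qed.

Lemma exp_taylor1_abs x : Rabs (exp x - 1 - x) <= x ^ 2 * exp (Rabs x).
Proof.
  assert (H1 := exp_ineq1_le x). assert (H2 := exp_ineq1_le (- x)).
  assert (E : exp x * exp (- x) = 1) by (rewrite <- exp_plus, Rplus_opp_r; apply exp_0).
  assert (P1 := exp_pos x). assert (P2 := exp_pos (- x)).
  rewrite Rabs_pos_eq by lra.
  assert (K : exp x - 1 - x <= x * (exp x - 1)) by nra.
  eapply Rle_trans; [exact K|].
  eapply Rle_trans; [apply Rle_abs|]. rewrite Rabs_mult.
  replace (x ^ 2 * exp (Rabs x)) with (Rabs x * (Rabs x * exp (Rabs x))).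
  - apply Rmult_le_compat_l; [apply Rabs_pos | apply exp_sub1_abs].
  - rewrite <- (pow2_abs x). ring.
Qed.

Lemma one_sub_cos_bounds y : 0 <= 1 - cos y <= y ^ 2 / 2.
Proof.
  assert (E : cos y = 1 - 2 * (sin (y / 2) * sin (y / 2))).
  { replace y with (2 * (y / 2)) at 1 by field. rewrite cos_2a_sin. ring. }
  assert (S : sin (y / 2) * sin (y / 2) <= (y / 2) * (y / 2)).
  { assert (A : Rabs (sin (y / 2)) <= Rabs (y / 2)).
    { destruct (Rle_dec 0 (y / 2)).
      - assert (sin (y / 2) <= y / 2).
        { destruct (Req_dec (y / 2) 0) as [->|]; [rewrite sin_0; lra|].
          left; apply sin_lt_x; lra. }
        destruct (Rle_dec (y / 2) PI).
        + rewrite !Rabs_pos_eq; auto. apply sin_ge_0; auto.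
        + generalize (SIN_bound (y / 2)) PI_4 (PI2_1). unfold Rabs.
          destruct Rcase_abs, Rcase_abs; lra.
      - assert (sin (- (y / 2)) <= - (y / 2)) by (left; apply sin_lt_x; lra).
        rewrite <- (Rabs_Ropp (sin _)), <- sin_neg, <- (Rabs_Ropp (y / 2)).
        destruct (Rle_dec (- (y / 2)) PI).
        + rewrite !Rabs_pos_eq; try lra. apply sin_ge_0; lra.
        + generalize (SIN_bound (- (y / 2))) PI2_1. unfold Rabs.
          destruct Rcase_abs, Rcase_abs; lra. }
    exact (Rsqr_le_abs_1 _ _ A). }
  generalize (Rle_0_sqr (sin (y / 2))). unfold Rsqr. split; nra.
Qed.

Lemma sin_taylor1_abs y : Rabs (sin y - y) <= y ^ 2.
Proof.
  assert (P : forall t, 0 <= t -> Rabs (sin t - t) <= t ^ 2).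
  { intros t Ht. destruct (Req_dec t 0) as [->|Hn].
    - rewrite sin_0, Rminus_0_r, Rabs_R0. lra.
    - assert (Hl := sin_lt_x t ltac:(lra)).
      (* Since [sin t < t], only [t - sin t <= t^2] is at stake; it says that [y^2 + sin y - y]
         increases from its value [0] at [0]. *)
      destruct (MVT_gen (fun y => y ^ 2 + sin y - y) 0 t (fun y => 2 * y + cos y - 1)) as [c [Hc E]].
      + intros x _. auto_derive; auto. ring.
      + intros x _. apply derivable_continuous_pt.
        apply ex_derive_Reals_0. auto_derive. auto.
      + rewrite Rmin_left, Rmax_right in Hc by lra.
        rewrite sin_0 in E. unfold Rabs. destruct Rcase_abs; [|lra].
        generalize (one_sub_cos_bounds c) (COS_bound c). intros B B'.
        assert (0 <= 2 * c + cos c - 1).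
        { destruct (Rle_dec c 1); nra. }
        nra. }
  destruct (Rle_dec 0 y); [auto|].
  generalize (P (- y) ltac:(lra)). rewrite sin_neg.
  replace (- sin y - - y) with (- (sin y - y)) by ring. rewrite Rabs_Ropp.
  intros. lra.
Qed.

(** The real and imaginary parts are regrouped into four pieces, each of second order and at most
    [|w|^2 exp |w|]; this is the origin of the [4]. *)
Lemma Cexp_taylor1 w : Cmod (Cexp w - 1 - w) <= 4 * Cmod w ^ 2 * exp (Cmod w).
Proof.
  destruct w as [x y]. set (m := Cmod (x, y)).
  assert (Hx : Rabs x <= m) by apply (re_le_Cmod (x, y)).
  assert (Hy : Rabs y <= m) by apply (im_le_Cmod (x, y)).
  assert (Px := Rabs_pos x). assert (Py := Rabs_pos y).
  set (E := exp m). assert (HE : exp (Rabs x) <= E) by (apply exp_le_compat; auto).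
  assert (Pe := exp_pos (Rabs x)).
  assert (HE1 : 1 + m <= E) by apply exp_ineq1_le.
  assert (Em : Cmod (x, y) ^ 2 = x ^ 2 + y ^ 2) by (rewrite Cmod2_alt; reflexivity).
  fold m in Em.
  assert (A1 := exp_taylor1_abs x). assert (A2 := exp_sub1_abs x).
  assert (A3 := one_sub_cos_bounds y). assert (A4 := sin_taylor1_abs y).
  assert (A5 := COS_bound y).
  eapply Rle_trans; [apply Cmod_le_parts|].
  replace (Re (Cexp (x, y) - 1 - (x, y)))
    with ((exp x - 1 - x) * cos y - (1 + x) * (1 - cos y)) by (unfold Re, Im; simpl; ring).
  replace (Im (Cexp (x, y) - 1 - (x, y)))
    with ((exp x - 1) * sin y + (sin y - y)) by (unfold Re, Im; simpl; ring).
  assert (B1 : Rabs ((exp x - 1 - x) * cos y) <= x ^ 2 * E).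
  { rewrite Rabs_mult. assert (Rabs (cos y) <= 1) by (apply Rabs_le; lra).
    assert (0 <= x ^ 2) by nra.
    assert (Hq : x ^ 2 * exp (Rabs x) <= x ^ 2 * E) by (apply Rmult_le_compat_l; auto).
    generalize (Rabs_pos (exp x - 1 - x)) (Rabs_pos (cos y)). nra. }
  assert (B2 : Rabs ((1 + x) * (1 - cos y)) <= E * (y ^ 2)).
  { rewrite Rabs_mult. apply Rmult_le_compat; try apply Rabs_pos.
    - eapply Rle_trans; [apply Rabs_triang|]. rewrite Rabs_R1. lra.
    - rewrite Rabs_pos_eq; lra. }
  assert (B3 : Rabs ((exp x - 1) * sin y) <= m ^ 2 * E).
  { assert (Hs : Rabs (sin y) <= Rabs y).
    { assert (Hs2 : forall t, 0 <= t -> sin t <= t).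
      { intros t Ht. destruct (Req_dec t 0) as [->|]; [rewrite sin_0; lra|].
        left; apply sin_lt_x; lra. }
      assert (Hs3 : forall t, 0 <= t -> - t <= sin t).
      { intros t Ht. destruct (Rle_dec t PI).
        - generalize (sin_ge_0 t Ht r). lra.
        - generalize (SIN_bound t) PI2_1. lra. }
      destruct (Rle_dec 0 y).
      - rewrite (Rabs_pos_eq y) by auto. apply Rabs_le. split; auto.
      - generalize (Hs2 (- y) ltac:(lra)) (Hs3 (- y) ltac:(lra)). rewrite sin_neg.
        intros. rewrite (Rabs_left y) by lra. apply Rabs_le. lra. }
    rewrite Rabs_mult.
    replace (m ^ 2 * E) with ((m * E) * m) by ring.
    apply Rmult_le_compat; try apply Rabs_pos; [|lra].
    eapply Rle_trans; [exact A2|]. apply Rmult_le_compat; lra. }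
  assert (B4 := Rabs_triang ((exp x - 1) * sin y) (sin y - y)).
  assert (B5 := Rabs_triang ((exp x - 1 - x) * cos y) (- ((1 + x) * (1 - cos y)))).
  rewrite Rabs_Ropp in B5.
  unfold Rminus at 1 in B5. fold (Rminus ((exp x - 1 - x) * cos y) ((1 + x) * (1 - cos y))) in B5.
  assert (1 <= E) by lra. assert (0 <= y ^ 2) by nra. assert (0 <= x ^ 2) by nra.
  unfold Rminus in *. nra.
Qed.

Lemma Cder_Cexp (z : C) : Cder Cexp z (Cexp z).
Proof.
  apply Cder_bound. intros e He.
  set (K := 4 * Cmod (Cexp z) * exp 1).
  assert (HK : 0 < K).
  { unfold K. rewrite Cmod_Cexp. generalize (exp_pos (Re z)) (exp_pos 1). nra. }
  exists (Rmin 1 (e / K)). split.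
  { apply Rmin_glb_lt; [lra | apply Rdiv_lt_0_compat; lra]. }
  intros w Hw.
  assert (H1 : Cmod (w - z) < 1) by (eapply Rlt_le_trans; [exact Hw | apply Rmin_l]).
  assert (H2 : Cmod (w - z) < e / K) by (eapply Rlt_le_trans; [exact Hw | apply Rmin_r]).
  replace (Cexp w) with (Cexp z * Cexp (w - z))%C.
  2: { rewrite <- Cexp_plus. f_equal. ring. }
  replace (Cexp z * Cexp (w - z) - Cexp z - Cexp z * (w - z))%C
    with (Cexp z * (Cexp (w - z) - 1 - (w - z)))%C by ring.
  rewrite Cmod_mult.
  assert (T := Cexp_taylor1 (w - z)). set (m := Cmod (w - z)) in *.
  assert (Hm : 0 <= m) by apply Cmod_ge_0.
  assert (HE : exp m <= exp 1) by (apply exp_le_compat; lra).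
  assert (HC := Cmod_ge_0 (Cexp z)).
  eapply Rle_trans; [apply Rmult_le_compat_l; [auto | exact T]|].
  apply Rle_trans with (K * m * m).
  - unfold K. assert (0 <= Cmod (Cexp z) * m ^ 2) by (apply Rmult_le_pos; nra).
    apply Rle_trans with (4 * (Cmod (Cexp z) * m ^ 2) * exp m); [right; ring|].
    apply Rle_trans with (4 * (Cmod (Cexp z) * m ^ 2) * exp 1); [|right; ring].
    apply Rmult_le_compat_l; [lra | auto].
  - apply Rmult_le_compat_r; auto.
    apply Rle_trans with (K * (e / K)); [apply Rmult_le_compat_l; lra|].
    right. field. lra.
Qed.

Lemma Carg_bound (z : C) : - PI <= Carg z <= PI.
Proof.
  unfold Carg. destruct Rle_dec; generalize (acos_bound (Re z / Cmod z)); lra.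
Qed.

Lemma Carg_polar (z : C) : z <> 0 ->
  Cmod z * cos (Carg z) = Re z /\ Cmod z * sin (Carg z) = Im z.
Proof.
  intros Hz. assert (Hm : 0 < Cmod z) by (apply Cmod_gt_0; auto).
  assert (Hb : -1 <= Re z / Cmod z <= 1).
  { assert (H := re_le_Cmod z). apply Rcomplements.Rabs_le_between in H.
    split; [apply Rcomplements.Rle_div_r | apply Rcomplements.Rle_div_l]; lra. }
  assert (Em := Cmod2_alt z).
  assert (Es : Cmod z * sqrt (1 - (Re z / Cmod z)²) = Rabs (Im z)).
  { rewrite <- (sqrt_Rsqr (Cmod z)) at 1 by lra.
    rewrite <- sqrt_mult_alt by apply Rle_0_sqr.
    rewrite <- sqrt_Rsqr_abs. f_equal. unfold Rsqr.
    replace (Cmod z * Cmod z * (1 - Re z / Cmod z * (Re z / Cmod z)))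
      with (Cmod z ^ 2 - Re z ^ 2) by (field; lra).
    rewrite Em. ring. }
  unfold Carg. destruct Rle_dec.
  - rewrite cos_acos by auto. rewrite sin_acos by auto. rewrite Es.
    split; [field; lra | apply Rabs_pos_eq; auto].
  - rewrite cos_neg, sin_neg, cos_acos by auto. rewrite sin_acos by auto.
    split; [field; lra|].
    rewrite Ropp_mult_distr_r_reverse, Es, Rabs_left by lra. ring.
Qed.

Lemma Cexp_Clog (z : C) : z <> 0 -> Cexp (Clog z) = z.
Proof.
  intros Hz. destruct (Carg_polar z Hz) as [H1 H2].
  unfold Cexp, Clog; simpl. rewrite exp_ln by (apply Cmod_gt_0; auto).
  apply C_ext; auto.
Qed.

Lemma Carg_gt (z : C) : z <> 0 -> - PI < Carg z.
Proof.
  intros Hz. destruct (Carg_bound z) as [[H|H] _]; auto. exfalso.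
  destruct (Carg_polar z Hz) as [H1 H2]. rewrite <- H in H1, H2.
  rewrite sin_neg, sin_PI in H2. rewrite cos_neg, cos_PI in H1.
  assert (Hi : Im z = 0) by lra.
  unfold Carg in H. destruct Rle_dec; [|lra].
  generalize (acos_bound (Re z / Cmod z)) PI_RGT_0. lra.
Qed.

Lemma cos_sin_inj a b : - PI < a <= PI -> - PI < b <= PI -> cos a = cos b -> sin a = sin b -> a = b.
Proof.
  intros Ha Hb Hc Hs.
  assert (S : sin (a - b) = 0) by (rewrite sin_minus, Hc, Hs; ring).
  assert (K : cos (a - b) = 1).
  { rewrite cos_minus, Hc, Hs. generalize (sin2_cos2 b). unfold Rsqr. lra. }
  destruct (Rtotal_order (a - b) 0) as [H|[H|H]]; [|lra|].
  - destruct (Rle_dec (a - b) (- PI)) as [L|L].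
    + destruct L as [L|L].
      * assert (0 < sin (a - b + 2 * PI)) by (apply sin_gt_0; lra).
        rewrite sin_plus, sin_2PI, cos_2PI in H0. lra.
      * rewrite L, cos_neg, cos_PI in K. lra.
    + assert (0 < sin (- (a - b))) by (apply sin_gt_0; lra). rewrite sin_neg in H0. lra.
  - destruct (Rle_dec PI (a - b)) as [L|L].
    + destruct L as [L|L].
      * assert (0 < sin (2 * PI - (a - b))) by (apply sin_gt_0; lra).
        rewrite sin_minus, sin_2PI, cos_2PI in H0. lra.
      * rewrite <- L, cos_PI in K. lra.
    + assert (0 < sin (a - b)) by (apply sin_gt_0; lra). lra.
Qed.

Lemma Clog_Cexp (z : C) : - PI < Im z <= PI -> Clog (Cexp z) = z.
Proof.
  intros Hz. assert (Hn := Cexp_nz z).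
  assert (Hm : Cmod (Cexp z) = exp (Re z)) by apply Cmod_Cexp.
  destruct (Carg_polar _ Hn) as [H1 H2]. rewrite Hm in H1, H2.
  assert (P := exp_pos (Re z)).
  apply C_ext; unfold Clog; simpl.
  - rewrite Hm. apply ln_exp.
  - apply cos_sin_inj; auto.
    + split; [apply Carg_gt; auto | apply Carg_bound].
    + apply Rmult_eq_reg_l with (exp (Re z)); [rewrite H1; reflexivity | lra].
    + apply Rmult_eq_reg_l with (exp (Re z)); [rewrite H2; reflexivity | lra].
Qed.

Lemma Clog_unique (z w : C) : - PI < Im w <= PI -> Cexp w = z -> Clog z = w.
Proof. intros H <-. apply Clog_Cexp; auto. Qed.

Lemma Clog_RtoC x : 0 < x -> Clog (RtoC x) = RtoC (ln x).
Proof.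
  intros Hx. apply Clog_unique; [simpl; generalize PI_RGT_0; lra|].
  rewrite Cexp_RtoC, exp_ln; auto.
Qed.

Definition slit (z : C) : Prop := 0 < Re z \/ Im z <> 0.

Lemma slit_nz (z : C) : slit z -> z <> 0.
Proof. intros [H|H] ->; simpl in H; lra. Qed.

(** The two [acos] pieces of [Carg] meet on the positive real axis, where [acos] is not
    differentiable. The arctangent covers a neighbourhood of that axis by one smooth formula. *)
Lemma Carg_right (z : C) : 0 < Re z -> Carg z = atan (Im z / Re z).
Proof.
  intros Hz. assert (Hn : z <> 0) by (intros ->; simpl in Hz; lra).
  assert (B := atan_bound (Im z / Re z)).
  change (Carg z) with (Im (Clog z)).
  rewrite (Clog_unique z (ln (Cmod z), atan (Im z / Re z))).
  - reflexivity.
  - simpl. generalize PI_RGT_0. lra.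
  - assert (Hm : 0 < Cmod z) by (apply Cmod_gt_0; auto).
    unfold Cexp; simpl. rewrite exp_ln by auto. rewrite sin_atan, cos_atan.
    assert (E : sqrt (1 + (Im z / Re z)²) = Cmod z / Re z).
    { rewrite <- (sqrt_Rsqr (Cmod z / Re z)).
      2: { left. apply Rdiv_lt_0_compat; auto. }
      f_equal. unfold Rsqr.
      replace (Cmod z / Re z * (Cmod z / Re z)) with (Cmod z ^ 2 / Re z ^ 2) by (field; lra).
      rewrite Cmod2_alt. field; lra. }
    rewrite E. apply C_ext; simpl; field; split; lra.
Qed.

Lemma Carg_conj (z : C) : slit z -> Carg (Cconj z) = - Carg z.
Proof.
  intros Hz. assert (Hn := slit_nz z Hz).
  change (Im (Clog (Cconj z)) = - Carg z).
  rewrite (Clog_unique _ (Cconj (Clog z))).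
  - reflexivity.
  - rewrite im_conj. change (Im (Clog z)) with (Carg z).
    assert (B := Carg_gt z Hn). destruct (Carg_bound z) as [_ [B'|B']]; [lra|].
    exfalso. destruct (Carg_polar z Hn) as [E1 E2].
    rewrite B', cos_PI in E1. rewrite B', sin_PI in E2.
    assert (0 < Cmod z) by (apply Cmod_gt_0; auto). destruct Hz; lra.
  - rewrite Cexp_conj, Cexp_Clog; auto.
Qed.

Lemma Clog_conj (z : C) : slit z -> Clog (Cconj z) = Cconj (Clog z).
Proof.
  intros Hz. unfold Clog. rewrite Carg_conj, Cmod_conj by auto. reflexivity.
Qed.

Lemma Ccts_of_parts (f : C -> C) z :
  continuous (fun w : C => Re (f w)) z -> continuous (fun w : C => Im (f w)) z -> Ccts f z.
Proof.
  intros H1 H2 e He.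
  assert (He2 : 0 < e / 2) by lra.
  destruct (proj1 (filterlim_locally _ _) H1 (mkposreal _ He2)) as [d1 K1].
  destruct (proj1 (filterlim_locally _ _) H2 (mkposreal _ He2)) as [d2 K2].
  exists (Rmin d1 d2). split; [apply Rmin_glb_lt; apply cond_pos|].
  intros w Hw.
  assert (B : forall d : posreal, Cmod (w - z) < d -> ball z d w).
  { intros d Hd. split.
    - change (Rabs (Re w - Re z) < d).
      eapply Rle_lt_trans; [|exact Hd]. apply (re_le_Cmod (w - z)).
    - change (Rabs (Im w - Im z) < d).
      eapply Rle_lt_trans; [|exact Hd]. apply (im_le_Cmod (w - z)). }
  assert (L1 := K1 w (B d1 ltac:(eapply Rlt_le_trans; [exact Hw | apply Rmin_l]))).
  assert (L2 := K2 w (B d2 ltac:(eapply Rlt_le_trans; [exact Hw | apply Rmin_r]))).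
  change (Rabs (Re (f w) - Re (f z)) < e / 2) in L1.
  change (Rabs (Im (f w) - Im (f z)) < e / 2) in L2.
  eapply Rle_lt_trans; [apply Cmod_le_parts|].
  replace (Re (f w - f z)) with (Re (f w) - Re (f z)) by (unfold Re, Im; simpl; ring).
  replace (Im (f w - f z)) with (Im (f w) - Im (f z)) by (unfold Re, Im; simpl; ring). lra.
Qed.

Lemma continuous_Re (z : C) : continuous (fun w : C => Re w) z.
Proof. destruct z. apply (continuous_fst (U := R_UniformSpace) (V := R_UniformSpace)). Qed.

Lemma continuous_Im (z : C) : continuous (fun w : C => Im w) z.
Proof. destruct z. apply (continuous_snd (U := R_UniformSpace) (V := R_UniformSpace)). Qed.

Lemma continuous_C_comp (f : C -> R) (g : R -> R) (z : C) :
  continuous f z -> continuous g (f z) -> continuous (fun w : C => g (f w)) z.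
Proof. apply (continuous_comp f g). Qed.

Lemma continuous_C_R_div (f g : C -> R) (z : C) :
  continuous f z -> continuous g z -> g z <> 0 -> continuous (fun w : C => f w / g w) z.
Proof.
  intros Hf Hg Hz. apply (continuous_mult (K := R_AbsRing) f (fun w => / g w)); auto.
  apply (continuous_C_comp g Rinv); auto. apply continuous_Rinv; auto.
Qed.

Lemma continuous_Cmod (z : C) : continuous (fun w : C => Cmod w) z.
Proof.
  apply (continuous_C_comp (fun w => fst w ^ 2 + snd w ^ 2) sqrt).
  - apply (continuous_plus (V := R_NormedModule) (fun w : C => fst w ^ 2) (fun w => snd w ^ 2)).
    + apply (continuous_C_comp (fun w => fst w) (fun x => x ^ 2)); [apply continuous_Re|].
      apply (ex_derive_continuous (V := R_NormedModule)). auto_derive. auto.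
    + apply (continuous_C_comp (fun w => snd w) (fun x => x ^ 2)); [apply continuous_Im|].
      apply (ex_derive_continuous (V := R_NormedModule)). auto_derive. auto.
  - apply continuity_pt_filterlim, continuity_pt_sqrt. nra.
Qed.

Lemma locally_C (z : C) (P : C -> Prop) : Cnear z P -> locally z P.
Proof.
  intros [d [Hd H]].
  assert (Hd2 : 0 < d / 2) by lra.
  exists (mkposreal _ Hd2). intros w [H1 H2].
  change (Rabs (Re w - Re z) < d / 2) in H1. change (Rabs (Im w - Im z) < d / 2) in H2.
  apply H. eapply Rle_lt_trans; [apply Cmod_le_parts|].
  replace (Re (w - z)) with (Re w - Re z) by (unfold Re, Im; simpl; ring).
  replace (Im (w - z)) with (Im w - Im z) by (unfold Re, Im; simpl; ring). lra.
Qed.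

Lemma Cnear_open_Re (z : C) a : a < Re z -> Cnear z (fun w => a < Re w).
Proof.
  intros H. exists (Re z - a). split; [lra|]. intros w Hw.
  assert (K := re_le_Cmod (w - z)). replace (Re (w - z)) with (Re w - Re z) in K by (unfold Re, Im; simpl; ring).
  apply Rcomplements.Rabs_le_between in K. lra.
Qed.

Lemma Cnear_open_Im (z : C) a : a < Im z -> Cnear z (fun w => a < Im w).
Proof.
  intros H. exists (Im z - a). split; [lra|]. intros w Hw.
  assert (K := im_le_Cmod (w - z)). replace (Im (w - z)) with (Im w - Im z) in K by (unfold Re, Im; simpl; ring).
  apply Rcomplements.Rabs_le_between in K. lra.
Qed.

Lemma Cnear_open_Im_neg (z : C) a : Im z < a -> Cnear z (fun w => Im w < a).
Proof.
  intros H. exists (a - Im z). split; [lra|]. intros w Hw.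
  assert (K := im_le_Cmod (w - z)). replace (Im (w - z)) with (Im w - Im z) in K by (unfold Re, Im; simpl; ring).
  apply Rcomplements.Rabs_le_between in K. lra.
Qed.

Lemma continuous_acos_arg (z : C) : Im z <> 0 -> continuous (fun w : C => acos (Re w / Cmod w)) z.
Proof.
  intros Hz. assert (Hn : z <> 0) by (intros ->; simpl in Hz; lra).
  assert (Hm : 0 < Cmod z) by (apply Cmod_gt_0; auto).
  apply (continuous_C_comp (fun w => Re w / Cmod w) acos).
  - apply continuous_C_R_div; [apply continuous_Re | apply continuous_Cmod | lra].
  - apply continuity_pt_filterlim. apply derivable_continuous_pt, derivable_pt_acos.
    assert (E := Cmod2_alt z). assert (0 < Im z ^ 2) by nra.
    split; [apply Rcomplements.Rlt_div_r | apply Rcomplements.Rlt_div_l]; nra.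
Qed.

Lemma Ccts_Clog (z : C) : slit z -> Ccts Clog z.
Proof.
  intros Hz. assert (Hm : 0 < Cmod z) by (apply Cmod_gt_0, slit_nz; auto).
  apply Ccts_of_parts.
  - apply (continuous_C_comp Cmod ln); [apply continuous_Cmod|].
    apply (ex_derive_continuous (V := R_NormedModule)). auto_derive. auto.
  - change (continuous (fun w : C => Carg w) z).
    destruct (Rlt_dec 0 (Re z)) as [H|H]; [|destruct Hz as [Hz|Hz]; [lra|]].
    + apply continuous_ext_loc with (fun w : C => atan (Im w / Re w)).
      * apply locally_C. apply (Cnear_imp z _ _) with (2 := Cnear_open_Re z 0 H).
        intros w Hw. symmetry. apply Carg_right; auto.
      * apply (continuous_C_comp (fun w => Im w / Re w) atan).
        -- apply continuous_C_R_div; [apply continuous_Im | apply continuous_Re | lra].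
        -- apply (ex_derive_continuous (V := R_NormedModule)). auto_derive. auto.
    + destruct (Rlt_dec 0 (Im z)) as [Hi|Hi].
      * apply continuous_ext_loc with (fun w : C => acos (Re w / Cmod w)).
        -- apply locally_C. apply (Cnear_imp z _ _) with (2 := Cnear_open_Im z 0 Hi).
           intros w Hw. unfold Carg. destruct Rle_dec; [auto|lra].
        -- apply continuous_acos_arg; auto.
      * apply continuous_ext_loc with (fun w : C => - acos (Re w / Cmod w)).
        -- apply locally_C. apply (Cnear_imp z _ _) with (2 := Cnear_open_Im_neg z 0 ltac:(lra)).
           intros w Hw. unfold Carg. destruct Rle_dec; [lra|auto].
        -- apply (continuous_opp (V := R_NormedModule) (fun w : C => acos (Re w / Cmod w))).
           apply continuous_acos_arg; auto.
Qed.

(** The Caratheodory factor [p] of [Cexp] at [Clog z], composed with [Clog] and inverted, is the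
    factor of [Clog]; no division by [Clog w - Clog z] occurs. *)
Lemma Cder_Clog (z : C) : slit z -> Cder Clog z (/ z)%C.
Proof.
  intros Hz. assert (Hn := slit_nz z Hz). assert (Hc := Ccts_Clog z Hz).
  destruct (Cder_Cexp (Clog z)) as [p [Hp [Ep [d [Hd Kp]]]]].
  rewrite Cexp_Clog in Ep by auto.
  assert (Hpc : Ccts (fun w => p (Clog w)) z) by (apply (Ccts_comp Clog p); auto).
  exists (fun w => / p (Clog w))%C. split; [|split].
  - apply (Ccts_inv (fun w => p (Clog w))); auto. cbv beta. rewrite Ep; auto.
  - cbv beta. rewrite Ep; auto.
  - assert (N1 := Ccts_nz_near _ _ Hpc ltac:(cbv beta; rewrite Ep; auto)).
    assert (N2 := Ccts_nz_near _ _ (Ccts_id z) Hn).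
    apply (Cnear_imp z _ _) with (2 := Cnear_and _ _ _ (Cnear_and _ _ _ N1 N2) (Hc d Hd)).
    intros w [[W1 W2] W3]. assert (E := Kp _ W3). rewrite !Cexp_Clog in E by auto.
    assert (E' : (w - z = p (Clog w) * (Clog w - Clog z))%C) by (rewrite E at 1; ring).
    rewrite E'. field. auto.
Qed.

(** * Integrals along segments and rectangles *)

Definition CI (f : R -> C) (a b : R) : C :=
  (RInt (fun t => Re (f t)) a b, RInt (fun t => Im (f t)) a b).

Definition CIex (f : R -> C) (a b : R) : Prop :=
  ex_RInt (fun t => Re (f t)) a b /\ ex_RInt (fun t => Im (f t)) a b.

Definition Pcts (f : R -> C) (t : R) : Prop :=
  continuous (fun t => Re (f t)) t /\ continuous (fun t => Im (f t)) t.

Lemma Pcts_eps (f : R -> C) t :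
  (forall e, 0 < e -> exists d, 0 < d /\ forall s, Rabs (s - t) < d -> Cmod (f s - f t) < e) ->
  Pcts f t.
Proof.
  intros H. split; apply filterlim_locally; intros e;
  destruct (H e (cond_pos e)) as [d [Hd K]]; exists (mkposreal d Hd); intros s Hs;
  specialize (K s Hs).
  - change (Rabs (Re (f s) - Re (f t)) < e).
    eapply Rle_lt_trans; [|exact K]. apply (re_le_Cmod (f s - f t)).
  - change (Rabs (Im (f s) - Im (f t)) < e).
    eapply Rle_lt_trans; [|exact K]. apply (im_le_Cmod (f s - f t)).
Qed.

Lemma Cmod_horizontal s t y : Cmod ((s, y) - (t, y)) = Rabs (s - t).
Proof.
  replace ((s, y) - (t, y))%C with (RtoC (s - t)); [apply Cmod_R|].
  apply C_ext; simpl; ring.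
Qed.

Lemma Cmod_vertical s t x : Cmod ((x, s) - (x, t)) = Rabs (s - t).
Proof.
  replace ((x, s) - (x, t))%C with (Ci * RtoC (s - t))%C.
  - rewrite Cmod_mult, Cmod_Ci, Cmod_R. ring.
  - apply C_ext; simpl; ring.
Qed.

Lemma Pcts_h f t y : Ccts f (t, y) -> Pcts (fun s => f (s, y)) t.
Proof.
  intros H. apply Pcts_eps. intros e He. destruct (H e He) as [d [Hd K]].
  exists d. split; auto. intros s Hs. apply K. rewrite Cmod_horizontal. auto.
Qed.

Lemma Pcts_v f t x : Ccts f (x, t) -> Pcts (fun s => f (x, s)) t.
Proof.
  intros H. apply Pcts_eps. intros e He. destruct (H e He) as [d [Hd K]].
  exists d. split; auto. intros s Hs. apply K. rewrite Cmod_vertical. auto.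
Qed.

Lemma CIex_Pcts f a b : (forall t, Rmin a b <= t <= Rmax a b -> Pcts f t) -> CIex f a b.
Proof.
  intros H. split; apply (ex_RInt_continuous (V := R_CompleteNormedModule)); intros t Ht;
  apply (H t Ht).
Qed.

Lemma CIex_Pcts_le f a b : a <= b -> (forall t, a <= t <= b -> Pcts f t) -> CIex f a b.
Proof. intros Hab H. apply CIex_Pcts. rewrite Rmin_left, Rmax_right by auto. auto. Qed.

Lemma CI_plus f g a b : CIex f a b -> CIex g a b ->
  CI (fun t => f t + g t)%C a b = (CI f a b + CI g a b)%C.
Proof.
  intros [F1 F2] [G1 G2]. apply C_ext; simpl.
  - apply (RInt_plus (V := R_CompleteNormedModule) (fun t => Re (f t)) (fun t => Re (g t))); auto.
  - apply (RInt_plus (V := R_CompleteNormedModule) (fun t => Im (f t)) (fun t => Im (g t))); auto.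
Qed.

Lemma CI_opp f a b : CIex f a b -> CI (fun t => - f t)%C a b = (- CI f a b)%C.
Proof.
  intros [F1 F2]. apply C_ext; simpl.
  - apply (RInt_opp (V := R_CompleteNormedModule) (fun t => Re (f t))); auto.
  - apply (RInt_opp (V := R_CompleteNormedModule) (fun t => Im (f t))); auto.
Qed.

Lemma CIex_opp f a b : CIex f a b -> CIex (fun t => - f t)%C a b.
Proof.
  intros [F1 F2]. split; simpl.
  - apply (ex_RInt_opp (V := R_CompleteNormedModule) (fun t => Re (f t))); auto.
  - apply (ex_RInt_opp (V := R_CompleteNormedModule) (fun t => Im (f t))); auto.
Qed.

Lemma CI_minus f g a b : CIex f a b -> CIex g a b ->
  CI (fun t => f t - g t)%C a b = (CI f a b - CI g a b)%C.
Proof.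
  intros F G. unfold Cminus. rewrite (CI_plus f (fun t => - g t)%C), CI_opp; auto.
  apply CIex_opp; auto.
Qed.

Lemma CIex_scal c f a b : CIex f a b -> CIex (fun t => c * f t)%C a b.
Proof.
  intros [F1 F2]. destruct c as [x y].
  assert (S : forall (k : R) (h : R -> R), ex_RInt h a b -> ex_RInt (fun t => k * h t) a b).
  { intros k h Hh. apply (ex_RInt_scal (V := R_CompleteNormedModule) h); auto. }
  split; simpl.
  - apply (ex_RInt_minus (V := R_CompleteNormedModule) (fun t => x * Re (f t)) (fun t => y * Im (f t))); auto.
  - apply (ex_RInt_plus (V := R_CompleteNormedModule) (fun t => x * Im (f t)) (fun t => y * Re (f t))); auto.
Qed.

Lemma CI_scal c f a b : CIex f a b -> CI (fun t => c * f t)%C a b = (c * CI f a b)%C.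
Proof.
  intros [F1 F2]. destruct c as [x y].
  assert (S : forall (k : R) (h : R -> R), ex_RInt h a b -> ex_RInt (fun t => k * h t) a b).
  { intros k h Hh. apply (ex_RInt_scal (V := R_CompleteNormedModule) h); auto. }
  assert (S' : forall (k : R) (h : R -> R), ex_RInt h a b -> RInt (fun t => k * h t) a b = k * RInt h a b).
  { intros k h Hh. apply (RInt_scal (V := R_CompleteNormedModule) h); auto. }
  apply C_ext; simpl.
  - rewrite <- !S' by auto.
    apply (RInt_minus (V := R_CompleteNormedModule) (fun t => x * Re (f t)) (fun t => y * Im (f t))); auto.
  - rewrite <- !S' by auto.
    apply (RInt_plus (V := R_CompleteNormedModule) (fun t => x * Im (f t)) (fun t => y * Re (f t))); auto.
Qed.

Lemma CI_ext f g a b : (forall t, Rmin a b < t < Rmax a b -> f t = g t) -> CI f a b = CI g a b.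
Proof.
  intros H. apply C_ext; simpl; apply RInt_ext; intros t Ht; rewrite H; auto.
Qed.

Lemma CIex_ext f g a b : (forall t, Rmin a b < t < Rmax a b -> f t = g t) -> CIex f a b -> CIex g a b.
Proof.
  intros H [F1 F2]. split.
  - apply ex_RInt_ext with (fun t => Re (f t)); auto. intros t Ht; rewrite H; auto.
  - apply ex_RInt_ext with (fun t => Im (f t)); auto. intros t Ht; rewrite H; auto.
Qed.

Lemma CI_Chasles f a b c : CIex f a b -> CIex f b c -> (CI f a b + CI f b c)%C = CI f a c.
Proof.
  intros [F1 F2] [G1 G2]. apply C_ext; simpl;
  apply (RInt_Chasles (V := R_CompleteNormedModule)); auto.
Qed.

Lemma CI_point f a : CI f a a = 0.
Proof. apply C_ext; simpl; apply (RInt_point (V := R_CompleteNormedModule)). Qed.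

(* The factor 2 comes from bounding both components separately. *)
Lemma CI_bound f a b M : a <= b -> CIex f a b ->
  (forall t, a <= t <= b -> Cmod (f t) <= M) -> Cmod (CI f a b) <= 2 * (b - a) * M.
Proof.
  intros Hab [F1 F2] H.
  eapply Rle_trans; [apply Cmod_le_parts|].
  assert (B1 : Rabs (RInt (fun t => Re (f t)) a b) <= (b - a) * M).
  { apply abs_RInt_le_const; auto. intros t Ht.
    eapply Rle_trans; [apply re_le_Cmod | auto]. }
  assert (B2 : Rabs (RInt (fun t => Im (f t)) a b) <= (b - a) * M).
  { apply abs_RInt_le_const; auto. intros t Ht.
    eapply Rle_trans; [apply im_le_Cmod | auto]. }
  simpl in *. lra.
Qed.

Lemma CI_bound_fun f (g : R -> R) a b : a <= b -> CIex f a b -> ex_RInt g a b ->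
  (forall t, a <= t <= b -> Cmod (f t) <= g t) -> Cmod (CI f a b) <= 2 * RInt g a b.
Proof.
  intros Hab [F1 F2] Hg H.
  eapply Rle_trans; [apply Cmod_le_parts|].
  assert (B : forall h : R -> R, ex_RInt h a b -> (forall t, a <= t <= b -> Rabs (h t) <= g t) ->
    Rabs (RInt h a b) <= RInt g a b).
  { intros h Hh K. eapply Rle_trans; [apply abs_RInt_le; auto|].
    apply RInt_le; auto.
    - apply ex_RInt_norm in Hh. exact Hh.
    - intros t Ht. apply K; lra. }
  assert (B1 := B _ F1 (fun t Ht => Rle_trans _ _ _ (re_le_Cmod (f t)) (H t Ht))).
  assert (B2 := B _ F2 (fun t Ht => Rle_trans _ _ _ (im_le_Cmod (f t)) (H t Ht))).
  simpl in *. lra.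
Qed.

Lemma CI_const c a b : CI (fun _ => c) a b = ((b - a)%R * c)%C.
Proof.
  apply C_ext; simpl; rewrite (RInt_const (V := R_CompleteNormedModule)).
  - change (scal (b - a) (Re c)) with ((b - a) * Re c). unfold Re; ring.
  - change (scal (b - a) (Im c)) with ((b - a) * Im c). unfold Im; ring.
Qed.

Lemma CI_Im f a b : Im (CI f a b) = RInt (fun t => Im (f t)) a b.
Proof. reflexivity. Qed.

(** The contour integral over the boundary of the rectangle, counterclockwise; [Ci] is [dz / dt] on
    the vertical sides. *)
Definition rect (f : C -> C) (a b c d : R) : C :=
  (CI (fun t => f (t, c)) a b + Ci * CI (fun t => f (b, t)) c d
   - CI (fun t => f (t, d)) a b - Ci * CI (fun t => f (a, t)) c d)%C.

Definition in_rect (a b c d : R) (z : C) : Prop := a <= Re z <= b /\ c <= Im z <= d.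

Definition RCts (f : C -> C) (a b c d : R) : Prop := forall z, in_rect a b c d z -> Ccts f z.

Lemma RCts_h f a b c d y : RCts f a b c d -> a <= b -> c <= y <= d -> CIex (fun t => f (t, y)) a b.
Proof.
  intros H Hab Hy. apply CIex_Pcts_le; auto. intros t Ht. apply Pcts_h, H. split; auto.
Qed.

Lemma RCts_v f a b c d x : RCts f a b c d -> c <= d -> a <= x <= b -> CIex (fun t => f (x, t)) c d.
Proof.
  intros H Hab Hy. apply CIex_Pcts_le; auto. intros t Ht. apply Pcts_v, H. split; auto.
Qed.

Lemma RCts_sub f a b c d a' b' c' d' : RCts f a b c d ->
  a <= a' -> b' <= b -> c <= c' -> d' <= d -> RCts f a' b' c' d'.
Proof. intros H ? ? ? ? z [? ?]. apply H. split; lra. Qed.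

Lemma rect_split_h f a m b c d : a <= m <= b -> c <= d -> RCts f a b c d ->
  rect f a b c d = (rect f a m c d + rect f m b c d)%C.
Proof.
  intros Hm Hcd H. unfold rect.
  rewrite <- (CI_Chasles (fun t => f (t, c)) a m b), <- (CI_Chasles (fun t => f (t, d)) a m b).
  - ring.
  - apply (RCts_h f a m c d); [apply (RCts_sub f a b c d)|..]; auto; lra.
  - apply (RCts_h f m b c d); [apply (RCts_sub f a b c d)|..]; auto; lra.
  - apply (RCts_h f a m c d); [apply (RCts_sub f a b c d)|..]; auto; lra.
  - apply (RCts_h f m b c d); [apply (RCts_sub f a b c d)|..]; auto; lra.
Qed.

Lemma rect_split_v f a b c m d : a <= b -> c <= m <= d -> RCts f a b c d ->
  rect f a b c d = (rect f a b c m + rect f a b m d)%C.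
Proof.
  intros Hm Hcd H. unfold rect.
  rewrite <- (CI_Chasles (fun t => f (b, t)) c m d), <- (CI_Chasles (fun t => f (a, t)) c m d).
  - ring.
  - apply (RCts_v f a b c m); [apply (RCts_sub f a b c d)|..]; auto; lra.
  - apply (RCts_v f a b m d); [apply (RCts_sub f a b c d)|..]; auto; lra.
  - apply (RCts_v f a b c m); [apply (RCts_sub f a b c d)|..]; auto; lra.
  - apply (RCts_v f a b m d); [apply (RCts_sub f a b c d)|..]; auto; lra.
Qed.

Definition bdry (a b c d : R) (z : C) : Prop :=
  in_rect a b c d z /\ (Re z = a \/ Re z = b \/ Im z = c \/ Im z = d).

(* [rect f] only sees [f] on the boundary, so continuity is only required there. *)
Definition BCts (f : C -> C) (a b c d : R) : Prop := forall z, bdry a b c d z -> Ccts f z.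

Lemma BCts_RCts f a b c d : RCts f a b c d -> BCts f a b c d.
Proof. intros H z [Hz _]. apply H; auto. Qed.

Lemma BCts_sides f a b c d : a <= b -> c <= d -> BCts f a b c d ->
  CIex (fun t => f (t, c)) a b /\ CIex (fun t => f (b, t)) c d /\
  CIex (fun t => f (t, d)) a b /\ CIex (fun t => f (a, t)) c d.
Proof.
  intros Hab Hcd H.
  split; [|split; [|split]]; apply CIex_Pcts_le; auto; intros t Ht; try apply Pcts_h; try apply Pcts_v;
  apply H; unfold bdry, in_rect; simpl; lra.
Qed.

Lemma rect_bound f a b c d M : a <= b -> c <= d -> BCts f a b c d ->
  (forall z, bdry a b c d z -> Cmod (f z) <= M) ->
  Cmod (rect f a b c d) <= 4 * ((b - a) + (d - c)) * M.
Proof.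
  intros Hab Hcd H HM.
  destruct (BCts_sides f a b c d Hab Hcd H) as [E1 [E2 [E3 E4]]].
  assert (B1 : Cmod (CI (fun t => f (t, c)) a b) <= 2 * (b - a) * M).
  { apply CI_bound; auto. intros t Ht. apply HM. unfold bdry, in_rect; simpl; lra. }
  assert (B2 : Cmod (CI (fun t => f (b, t)) c d) <= 2 * (d - c) * M).
  { apply CI_bound; auto. intros t Ht. apply HM. unfold bdry, in_rect; simpl; lra. }
  assert (B3 : Cmod (CI (fun t => f (t, d)) a b) <= 2 * (b - a) * M).
  { apply CI_bound; auto. intros t Ht. apply HM. unfold bdry, in_rect; simpl; lra. }
  assert (B4 : Cmod (CI (fun t => f (a, t)) c d) <= 2 * (d - c) * M).
  { apply CI_bound; auto. intros t Ht. apply HM. unfold bdry, in_rect; simpl; lra. }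
  unfold rect.
  eapply Rle_trans; [apply Cmod_sub_triangle|].
  eapply Rle_trans; [apply Rplus_le_compat_r, Cmod_sub_triangle|].
  eapply Rle_trans; [apply Rplus_le_compat_r, Rplus_le_compat_r, Cmod_triangle|].
  rewrite !Cmod_mult, Cmod_Ci. lra.
Qed.

Lemma rect_minus f g a b c d : a <= b -> c <= d -> BCts f a b c d -> BCts g a b c d ->
  rect (fun z => f z - g z)%C a b c d = (rect f a b c d - rect g a b c d)%C.
Proof.
  intros Hab Hcd Hf Hg. unfold rect.
  destruct (BCts_sides f a b c d Hab Hcd Hf) as [E1 [E2 [E3 E4]]].
  destruct (BCts_sides g a b c d Hab Hcd Hg) as [G1 [G2 [G3 G4]]].
  rewrite (CI_minus (fun t => f (t, c)) (fun t => g (t, c))) by auto.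
  rewrite (CI_minus (fun t => f (t, d)) (fun t => g (t, d))) by auto.
  rewrite (CI_minus (fun t => f (a, t)) (fun t => g (a, t))) by auto.
  rewrite (CI_minus (fun t => f (b, t)) (fun t => g (b, t))) by auto.
  ring.
Qed.

Lemma rect_scal k f a b c d : a <= b -> c <= d -> BCts f a b c d ->
  rect (fun z => k * f z)%C a b c d = (k * rect f a b c d)%C.
Proof.
  intros Hab Hcd Hf. unfold rect.
  destruct (BCts_sides f a b c d Hab Hcd Hf) as [E1 [E2 [E3 E4]]].
  rewrite (CI_scal k (fun t => f (t, c))) by auto.
  rewrite (CI_scal k (fun t => f (t, d))) by auto.
  rewrite (CI_scal k (fun t => f (a, t))) by auto.
  rewrite (CI_scal k (fun t => f (b, t))) by auto.
  ring.
Qed.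

Lemma rect_ext f g a b c d : a <= b -> c <= d ->
  (forall z, bdry a b c d z -> f z = g z) -> rect f a b c d = rect g a b c d.
Proof.
  intros Hab Hcd H. unfold rect.
  rewrite (CI_ext (fun t => f (t, c)) (fun t => g (t, c))).
  rewrite (CI_ext (fun t => f (t, d)) (fun t => g (t, d))).
  rewrite (CI_ext (fun t => f (a, t)) (fun t => g (a, t))).
  rewrite (CI_ext (fun t => f (b, t)) (fun t => g (b, t))); auto.
  all: rewrite Rmin_left, Rmax_right by auto; intros t Ht; apply H; unfold bdry, in_rect; simpl; lra.
Qed.

(** By explicit integration over the four sides. In [Goursat] it allows the affine approximation at
    the limit point to be subtracted from [f] at no cost. *)
Lemma rect_affine k l a b c d : rect (fun z => k + l * z)%C a b c d = 0.
Proof.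
  assert (S : forall x y : R, RInt (fun t => t) x y = (y ^ 2 - x ^ 2) / 2).
  { intros x y. apply is_RInt_unique.
    replace ((y ^ 2 - x ^ 2) / 2) with (minus (y ^ 2 / 2) (x ^ 2 / 2)) by (unfold minus, plus, opp; simpl; field).
    apply (is_RInt_derive (V := R_CompleteNormedModule) (fun t => t ^ 2 / 2)).
    - intros t _. auto_derive; auto. field.
    - intros t _. apply continuous_id. }
  assert (Hid : forall x y : R, ex_RInt (fun t : R => t) x y).
  { intros x y. apply (ex_RInt_continuous (V := R_CompleteNormedModule)). intros; apply continuous_id. }
  assert (Sc : forall x y m : R, RInt (fun _ => m) x y = (y - x) * m).
  { intros. apply (RInt_const (V := R_CompleteNormedModule)). }
  assert (Ah : forall x y m, CI (fun t => k + l * (t, m))%C x y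
     = ((y - x)%R * k + l * ((y ^ 2 - x ^ 2) / 2, (y - x) * m)%R)%C).
  { intros x y m.
    assert (E : CIex (fun t => (t, m)) x y).
    { split; simpl; [apply Hid | apply ex_RInt_const]. }
    rewrite (CI_plus (fun _ => k) (fun t => l * (t, m))%C).
    - rewrite CI_const, (CI_scal l (fun t => (t, m))) by auto.
      unfold CI at 1; simpl. rewrite S, Sc. reflexivity.
    - split; apply ex_RInt_const.
    - apply CIex_scal; auto. }
  assert (Av : forall x y m, CI (fun t => k + l * (m, t))%C x y
     = ((y - x)%R * k + l * ((y - x) * m, (y ^ 2 - x ^ 2) / 2)%R)%C).
  { intros x y m.
    assert (E : CIex (fun t => (m, t)) x y).
    { split; simpl; [apply ex_RInt_const | apply Hid]. }
    rewrite (CI_plus (fun _ => k) (fun t => l * (m, t))%C).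
    - rewrite CI_const, (CI_scal l (fun t => (m, t))) by auto.
      unfold CI at 1; simpl. rewrite S, Sc. reflexivity.
    - split; apply ex_RInt_const.
    - apply CIex_scal; auto. }
  unfold rect. rewrite !Ah, !Av.
  destruct k, l. apply C_ext; simpl; field.
Qed.

Lemma nested_point (a b : nat -> R) :
  (forall n, a n <= a (S n)) -> (forall n, b (S n) <= b n) -> (forall n, a n <= b n) ->
  exists x, forall n, a n <= x <= b n.
Proof.
  intros Ha Hb Hab.
  assert (Ma : forall n k, a n <= a (n + k)%nat).
  { intros n k. induction k; [rewrite Nat.add_0_r; lra|]. rewrite Nat.add_succ_r. generalize (Ha (n + k)%nat). lra. }
  assert (Mb : forall n k, b (n + k)%nat <= b n).
  { intros n k. induction k; [rewrite Nat.add_0_r; lra|]. rewrite Nat.add_succ_r. generalize (Hb (n + k)%nat). lra. }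
  assert (Mab : forall n k, a n <= b k).
  { intros n k. generalize (Ma n k) (Mb k n) (Hab (n + k)%nat). rewrite (Nat.add_comm k n). lra. }
  destruct (completeness (fun x => exists n, x = a n)) as [x [U L]].
  - exists (b 0%nat). intros y [n ->]. apply Mab.
  - exists (a 0%nat), 0%nat. auto.
  - exists x. intros n. split; [apply U; eauto|]. apply L. intros y [k ->]. apply Mab.
Qed.

(** * Cauchy's theorem on rectangles by bisection *)

Section Goursat.
Variable f : C -> C.

Let quad := (R * R * (R * R))%type.
Let qrect (q : quad) := rect f (fst (fst q)) (snd (fst q)) (fst (snd q)) (snd (snd q)).

(** Halving the width and then the height replaces the usual quartering: each step keeps at least
    half of the modulus of the integral, so the pair keeps a quarter. *)
Let hhalf (q : quad) : quad :=
  let a := fst (fst q) in let b := snd (fst q) in let m := (a + b) / 2 in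
  if Rle_dec (Cmod (qrect q) / 2) (Cmod (qrect ((a, m), snd q)))
  then ((a, m), snd q) else ((m, b), snd q).

Let vhalf (q : quad) : quad :=
  let c := fst (snd q) in let d := snd (snd q) in let m := (c + d) / 2 in
  if Rle_dec (Cmod (qrect q) / 2) (Cmod (qrect (fst q, (c, m))))
  then (fst q, (c, m)) else (fst q, (m, d)).

Let good (q : quad) := fst (fst q) <= snd (fst q) /\ fst (snd q) <= snd (snd q) /\
  RCts f (fst (fst q)) (snd (fst q)) (fst (snd q)) (snd (snd q)).

Lemma hhalf_spec q : good q ->
  good (hhalf q) /\ Cmod (qrect q) / 2 <= Cmod (qrect (hhalf q)) /\
  snd (hhalf q) = snd q /\
  fst (fst q) <= fst (fst (hhalf q)) /\ snd (fst (hhalf q)) <= snd (fst q) /\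
  snd (fst (hhalf q)) - fst (fst (hhalf q)) = (snd (fst q) - fst (fst q)) / 2.
Proof.
  destruct q as [[a b] [c d]]. unfold good, hhalf, qrect; simpl. intros [Hab [Hcd H]].
  set (m := (a + b) / 2). assert (Hm : a <= m <= b) by (unfold m; lra).
  assert (E := rect_split_h f a m b c d Hm Hcd H).
  destruct Rle_dec as [L|L]; simpl.
  - repeat split; try lra; [|unfold m; lra]. apply (RCts_sub f a b c d); auto; lra.
  - repeat split; try lra; [|rewrite E in L |- *|unfold m; lra].
    + apply (RCts_sub f a b c d); auto; lra.
    + generalize (Cmod_triangle (rect f a m c d) (rect f m b c d)). lra.
Qed.

Lemma vhalf_spec q : good q ->
  good (vhalf q) /\ Cmod (qrect q) / 2 <= Cmod (qrect (vhalf q)) /\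
  fst (vhalf q) = fst q /\
  fst (snd q) <= fst (snd (vhalf q)) /\ snd (snd (vhalf q)) <= snd (snd q) /\
  snd (snd (vhalf q)) - fst (snd (vhalf q)) = (snd (snd q) - fst (snd q)) / 2.
Proof.
  destruct q as [[a b] [c d]]. unfold good, vhalf, qrect; simpl. intros [Hab [Hcd H]].
  set (m := (c + d) / 2). assert (Hm : c <= m <= d) by (unfold m; lra).
  assert (E := rect_split_v f a b c m d Hab Hm H).
  destruct Rle_dec as [L|L]; simpl.
  - repeat split; try lra; [|unfold m; lra]. apply (RCts_sub f a b c d); auto; lra.
  - repeat split; try lra; [|rewrite E in L |- *|unfold m; lra].
    + apply (RCts_sub f a b c d); auto; lra.
    + generalize (Cmod_triangle (rect f a b c m) (rect f a b m d)). lra.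
Qed.

Theorem Goursat a b c d : a <= b -> c <= d ->
  (forall z, in_rect a b c d z -> exists l, Cder f z l) -> rect f a b c d = 0.
Proof.
  intros Hab Hcd H.
  assert (HC : RCts f a b c d).
  { intros z Hz. destruct (H z Hz) as [l Hl]. eapply Cder_cts; eauto. }
  set (Q := fix Q (n : nat) : quad := match n with O => ((a, b), (c, d)) | S n => vhalf (hhalf (Q n)) end).
  assert (HG : forall n, good (Q n)).
  { induction n; simpl.
    - unfold good; simpl. auto.
    - apply vhalf_spec, hhalf_spec, IHn. }
  assert (HQ : forall n, Cmod (qrect (Q n)) / 4 <= Cmod (qrect (Q (S n))) /\
    fst (fst (Q n)) <= fst (fst (Q (S n))) /\ snd (fst (Q (S n))) <= snd (fst (Q n)) /\
    fst (snd (Q n)) <= fst (snd (Q (S n))) /\ snd (snd (Q (S n))) <= snd (snd (Q n)) /\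
    snd (fst (Q (S n))) - fst (fst (Q (S n))) = (snd (fst (Q n)) - fst (fst (Q n))) / 2 /\
    snd (snd (Q (S n))) - fst (snd (Q (S n))) = (snd (snd (Q n)) - fst (snd (Q n))) / 2).
  { intros n. simpl.
    destruct (hhalf_spec _ (HG n)) as [G1 [G2 [G3 [G4 [G5 G6]]]]].
    destruct (vhalf_spec _ G1) as [K1 [K2 [K3 [K4 [K5 K6]]]]].
    rewrite K3, <- G3. repeat split; lra. }
  destruct (nested_point (fun n => fst (fst (Q n))) (fun n => snd (fst (Q n)))) as [x Hx];
    [apply HQ | apply HQ | intros n; apply (HG n) |].
  destruct (nested_point (fun n => fst (snd (Q n))) (fun n => snd (snd (Q n)))) as [y Hy];
    [apply HQ | apply HQ | intros n; apply (HG n) |].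
  assert (HW : forall n, snd (fst (Q n)) - fst (fst (Q n)) = (b - a) / 2 ^ n
     /\ snd (snd (Q n)) - fst (snd (Q n)) = (d - c) / 2 ^ n
     /\ Cmod (rect f a b c d) / 4 ^ n <= Cmod (qrect (Q n))).
  { induction n.
    - unfold qrect; simpl. repeat split; lra.
    - destruct (HQ n) as [E1 [_ [_ [_ [_ [E2 E3]]]]]]. destruct IHn as [I1 [I2 I3]].
      rewrite E2, E3, I1, I2. assert (2 ^ n <> 0) by (apply pow_nonzero; lra).
      assert (4 ^ n <> 0) by (apply pow_nonzero; lra).
      simpl pow. repeat split; try (field; auto).
      eapply Rle_trans; [|exact E1].
      replace (Cmod (rect f a b c d) / (4 * 4 ^ n)) with (Cmod (rect f a b c d) / 4 ^ n / 4) by (field; auto).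
      lra. }
  destruct (H (x, y)) as [l Hl].
  { split; simpl; [apply (Hx 0%nat) | apply (Hy 0%nat)]. }
  set (P := (b - a) + (d - c)). assert (HP : 0 <= P) by (unfold P; lra).
  (* On the [n]-th rectangle [f] differs from its affine approximation by at most [e P / 2^n], and
     the width plus the height is [P / 2^n]. The integral is therefore at most [4 P^2 e / 4^n],
     while it is at least [1 / 4^n] of the original one: the powers cancel. *)
  assert (HB : forall e, 0 < e -> Cmod (rect f a b c d) <= 4 * P * P * e).
  { intros e He. destruct (Cder_eps f _ l e He Hl) as [r [Hr K]].
    assert (Hn : exists n, P / 2 ^ n < r).
    { destruct (Pow_x_infinity 2 ltac:(rewrite Rabs_pos_eq; lra) (P / r + 1)) as [n Hn].
      exists n. specialize (Hn n (le_n n)). assert (P2 : 0 < 2 ^ n) by (apply pow_lt; lra).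
      rewrite Rabs_pos_eq in Hn by lra.
      apply Rcomplements.Rlt_div_l; auto.
      assert (P / r < 2 ^ n) by lra. apply Rcomplements.Rlt_div_l in H0; auto. lra. }
    destruct Hn as [n Hn]. destruct (HW n) as [W1 [W2 W3]].
    destruct (HG n) as [G1 [G2 G3]]. specialize (Hx n). specialize (Hy n). simpl in Hx, Hy.
    unfold qrect in W3.
    set (a' := fst (fst (Q n))) in *. set (b' := snd (fst (Q n))) in *.
    set (c' := fst (snd (Q n))) in *. set (d' := snd (snd (Q n))) in *.
    assert (P2 : 0 < 2 ^ n) by (apply pow_lt; lra).
    assert (EP : (b' - a') + (d' - c') = P / 2 ^ n) by (rewrite W1, W2; unfold P; field; lra).
    set (g := fun z : C => ((f (x, y) - l * (x, y)) + l * z)%C).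
    assert (HgC : BCts g a' b' c' d').
    { intros z _. apply (Ccts_plus (fun _ => (f (x, y) - l * (x, y))%C) (fun z => l * z)%C).
      - apply Ccts_const.
      - apply (Ccts_mult (fun _ => l) (fun z => z)); [apply Ccts_const | apply Ccts_id]. }
    assert (HfC : BCts f a' b' c' d') by (apply BCts_RCts; auto).
    assert (E : rect f a' b' c' d' = rect (fun z => f z - g z)%C a' b' c' d').
    { rewrite rect_minus by auto. unfold g at 1. rewrite rect_affine. ring. }
    assert (B : Cmod (rect f a' b' c' d') <= 4 * ((b' - a') + (d' - c')) * (e * (P / 2 ^ n))).
    { rewrite E. apply rect_bound; auto.
      - intros z Hz. apply Ccts_minus; auto.
      - intros z [[Z1 Z2] _].
        assert (Hzd : Cmod (z - (x, y)) <= P / 2 ^ n).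
        { eapply Rle_trans; [apply Cmod_le_parts|]. rewrite <- EP. simpl.
          apply Rplus_le_compat; apply Rabs_le; unfold Re, Im in *; lra. }
        replace (f z - g z)%C with (f z - f (x, y) - l * (z - (x, y)))%C by (unfold g; ring).
        eapply Rle_trans; [apply K; lra|]. apply Rmult_le_compat_l; lra. }
    rewrite EP in B.
    assert (P4 : 0 < 4 ^ n) by (apply pow_lt; lra).
    assert (E4 : 4 ^ n = 2 ^ n * 2 ^ n).
    { rewrite <- Rpow_mult_distr. f_equal; lra. }
    assert (T : Cmod (rect f a b c d) / 4 ^ n <= 4 * (P / 2 ^ n) * (e * (P / 2 ^ n))) by lra.
    apply (fun H => proj1 (Rcomplements.Rle_div_l _ _ _ H) T) in P4 as T2.
    eapply Rle_trans; [exact T2|]. right. rewrite E4. field. lra. }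
  apply Cmod_eq_0. apply Rle_antisym; [|apply Cmod_ge_0].
  apply Rnot_lt_le. intros Hpos.
  set (K := Cmod (rect f a b c d)) in *.
  (* With [e = K / (4 P^2 + 1)] the bound reads [K <= K - e]; the [1] covers the degenerate case
     [P = 0]. *)
  assert (HPP : 0 < 4 * P * P + 1) by nra.
  specialize (HB (K / (4 * P * P + 1)) ltac:(apply Rdiv_lt_0_compat; auto)).
  assert (E : 4 * P * P * (K / (4 * P * P + 1)) = K - K / (4 * P * P + 1)) by (field; lra).
  assert (0 < K / (4 * P * P + 1)) by (apply Rdiv_lt_0_compat; auto). lra.
Qed.
End Goursat.

Lemma Goursat_degenerate_h f a c d : rect f a a c d = 0.
Proof. unfold rect. rewrite !CI_point. ring. Qed.

Lemma Goursat_degenerate_v f a b c : rect f a b c c = 0.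
Proof. unfold rect. rewrite !CI_point. ring. Qed.

(* A point where only continuity is known is enclosed in a square of vanishing perimeter. *)
Theorem Goursat_punctured f w a b c d : a <= b -> c <= d -> Ccts f w ->
  (forall z, in_rect a b c d z -> z <> w -> exists l, Cder f z l) -> rect f a b c d = 0.
Proof.
  intros Hab Hcd Hw H.
  destruct (classic (in_rect a b c d w)) as [Hin|Hout].
  2: { apply Goursat; auto. intros z Hz. apply H; auto. intros ->; auto. }
  destruct Hin as [Hx Hy].
  assert (HC : RCts f a b c d).
  { intros z Hz. destruct (classic (z = w)) as [->|Hn]; auto.
    destruct (H z Hz Hn) as [l Hl]. eapply Cder_cts; eauto. }
  destruct (Hw 1 Rlt_0_1) as [d0 [Hd0 Kw]].
  set (M := Cmod (f w) + 1).
  assert (HM : 0 < M) by (unfold M; generalize (Cmod_ge_0 (f w)); lra).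
  assert (HB : forall e, 0 < e -> e < d0 / 2 -> Cmod (rect f a b c d) <= 16 * e * M).
  { intros e He He'.
    set (a' := Rmax a (Re w - e)). set (b' := Rmin b (Re w + e)).
    set (c' := Rmax c (Im w - e)). set (d' := Rmin d (Im w + e)).
    assert (Ha : a <= a' <= Re w) by (unfold a', Rmax; destruct Rle_dec; lra).
    assert (Hb : Re w <= b' <= b) by (unfold b', Rmin; destruct Rle_dec; lra).
    assert (Hc : c <= c' <= Im w) by (unfold c', Rmax; destruct Rle_dec; lra).
    assert (Hd : Im w <= d' <= d) by (unfold d', Rmin; destruct Rle_dec; lra).
    (* Each strip around the small rectangle is either degenerate or strictly away from [w]; its
       integral vanishes in both cases. *)
    assert (Ha2 : a = a' \/ a' < Re w) by (unfold a', Rmax; destruct Rle_dec; lra).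
    assert (Hb2 : b = b' \/ Re w < b') by (unfold b', Rmin; destruct Rle_dec; lra).
    assert (Hc2 : c = c' \/ c' < Im w) by (unfold c', Rmax; destruct Rle_dec; lra).
    assert (Hd2 : d = d' \/ Im w < d') by (unfold d', Rmin; destruct Rle_dec; lra).
    assert (Ha3 : Re w - e <= a') by (apply Rmax_r).
    assert (Hb3 : b' <= Re w + e) by (apply Rmin_r).
    assert (Hc3 : Im w - e <= c') by (apply Rmax_r).
    assert (Hd3 : d' <= Im w + e) by (apply Rmin_r).
    rewrite (rect_split_h f a a' b) by (auto; lra).
    rewrite (rect_split_h f a' b' b) by (try lra; apply (RCts_sub f a b c d); auto; lra).
    rewrite (rect_split_v f a' b' c c' d) by (try lra; apply (RCts_sub f a b c d); auto; lra).
    rewrite (rect_split_v f a' b' c' d' d) by (try lra; apply (RCts_sub f a b c d); auto; lra).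
    assert (Z1 : rect f a a' c d = 0).
    { destruct Ha2 as [<-|Ha2]; [apply Goursat_degenerate_h|]. apply Goursat; try lra.
      intros z [? ?]. apply H; [split; lra|]. intros ->; lra. }
    assert (Z2 : rect f b' b c d = 0).
    { destruct Hb2 as [<-|Hb2]; [apply Goursat_degenerate_h|]. apply Goursat; try lra.
      intros z [? ?]. apply H; [split; lra|]. intros ->; lra. }
    assert (Z3 : rect f a' b' c c' = 0).
    { destruct Hc2 as [<-|Hc2]; [apply Goursat_degenerate_v|]. apply Goursat; try lra.
      intros z [? ?]. apply H; [split; lra|]. intros ->; lra. }
    assert (Z4 : rect f a' b' d' d = 0).
    { destruct Hd2 as [<-|Hd2]; [apply Goursat_degenerate_v|]. apply Goursat; try lra.
      intros z [? ?]. apply H; [split; lra|]. intros ->; lra. }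
    rewrite Z1, Z2, Z3, Z4, !Cplus_0_l, !Cplus_0_r.
    apply Rle_trans with (4 * ((b' - a') + (d' - c')) * M).
    - apply rect_bound; try lra.
      + apply BCts_RCts, (RCts_sub f a b c d); auto; lra.
      + intros z [[Z5 Z6] _]. unfold M.
        assert (Hz : Cmod (f z - f w) < 1).
        { apply Kw. eapply Rle_lt_trans; [apply Cmod_le_parts|].
          replace (Re (z - w)) with (Re z - Re w) by (unfold Re, Im; simpl; ring).
          replace (Im (z - w)) with (Im z - Im w) by (unfold Re, Im; simpl; ring).
          apply Rle_lt_trans with (e + e); [|lra].
          apply Rplus_le_compat; apply Rabs_le; lra. }
        generalize (Cmod_sub_ge (f z) (f w)). lra.
    - apply Rmult_le_compat_r; lra. }
  apply Cmod_eq_0. apply Rle_antisym; [|apply Cmod_ge_0].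
  apply Rnot_lt_le. intros Hpos.
  set (K := Cmod (rect f a b c d)) in *.
  set (e := Rmin (d0 / 4) (K / (32 * M))).
  assert (He : 0 < e).
  { apply Rmin_glb_lt; [lra|]. apply Rdiv_lt_0_compat; lra. }
  assert (He1 : e <= d0 / 4) by apply Rmin_l. assert (He2 : e <= K / (32 * M)) by apply Rmin_r.
  specialize (HB e He ltac:(lra)).
  assert (16 * e * M <= 16 * (K / (32 * M)) * M) by (apply Rmult_le_compat_r; lra).
  replace (16 * (K / (32 * M)) * M) with (K / 2) in H0 by (field; lra). lra.
Qed.

Definition Cdiff (f : C -> C) (z : C) : Prop := exists l, Cder f z l.

Lemma Cdiff_cts f z : Cdiff f z -> Ccts f z.
Proof. intros [l H]. eapply Cder_cts; eauto. Qed.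

Lemma Cdiff_const c z : Cdiff (fun _ => c) z.
Proof. eexists; apply Cder_const. Qed.

Lemma Cdiff_id z : Cdiff (fun w => w) z.
Proof. eexists; apply Cder_id. Qed.

Lemma Cdiff_plus f g z : Cdiff f z -> Cdiff g z -> Cdiff (fun w => f w + g w)%C z.
Proof. intros [a Ha] [b Hb]. eexists; apply Cder_plus; eauto. Qed.

Lemma Cdiff_minus f g z : Cdiff f z -> Cdiff g z -> Cdiff (fun w => f w - g w)%C z.
Proof. intros [a Ha] [b Hb]. eexists; apply Cder_minus; eauto. Qed.

Lemma Cdiff_opp f z : Cdiff f z -> Cdiff (fun w => - f w)%C z.
Proof. intros [a Ha]. eexists; apply Cder_opp; eauto. Qed.

Lemma Cdiff_mult f g z : Cdiff f z -> Cdiff g z -> Cdiff (fun w => f w * g w)%C z.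
Proof. intros [a Ha] [b Hb]. eexists; apply Cder_mult; eauto. Qed.

Lemma Cdiff_div f g z : Cdiff f z -> Cdiff g z -> g z <> 0 -> Cdiff (fun w => f w / g w)%C z.
Proof. intros [a Ha] [b Hb] H. eexists; apply Cder_div; eauto. Qed.

Lemma Cdiff_comp f g z : Cdiff f z -> Cdiff g (f z) -> Cdiff (fun w => g (f w)) z.
Proof. intros [a Ha] [b Hb]. eexists; apply Cder_comp; eauto. Qed.

Lemma Cdiff_pow f z n : Cdiff f z -> Cdiff (fun w => f w ^ n)%C z.
Proof.
  intros H. induction n; simpl; [apply Cdiff_const|].
  apply (Cdiff_mult f (fun w => f w ^ n)%C); auto.
Qed.

Lemma Cdiff_Cexp z : Cdiff Cexp z.
Proof. eexists; apply Cder_Cexp. Qed.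

Lemma Cdiff_Clog z : slit z -> Cdiff Clog z.
Proof. intros. eexists; apply Cder_Clog; auto. Qed.

Lemma Cdiff_ext_near f g z : Cnear z (fun w => f w = g w) -> Cdiff f z -> Cdiff g z.
Proof. intros H [l Hl]. exists l. eapply Cder_ext_near; eauto. Qed.

(** * Simple poles and the identity theorem *)

Definition inner_rect (a b c d : R) (z : C) : Prop := a < Re z < b /\ c < Im z < d.

Lemma bdry_not_inner a b c d z w : bdry a b c d z -> inner_rect a b c d w -> z <> w.
Proof. intros [_ H] [H1 H2] ->. lra. Qed.

(* Subtracting a multiple of [q] from the numerator removes the pole, so
   only [f w] times the integral of [1 / q] remains. *)
Lemma rect_simple_pole f q w k a b c d :
  inner_rect a b c d w ->
  (forall z, in_rect a b c d z -> Cdiff f z) -> (forall z, in_rect a b c d z -> Cdiff q z) ->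
  Cder q w k -> k <> 0 -> q w = 0 -> (forall z, in_rect a b c d z -> z <> w -> q z <> 0) ->
  rect (fun z => f z / q z)%C a b c d = (f w * rect (fun z => / q z)%C a b c d)%C.
Proof.
  intros Hw Hf Hq Hk Hk0 Hqw Hqz.
  assert (Hin : in_rect a b c d w) by (destruct Hw; split; lra).
  assert (Hab : a <= b) by (destruct Hw; lra). assert (Hcd : c <= d) by (destruct Hw; lra).
  destruct (Hf w Hin) as [l Hl].
  (* With the multiple [l / k] the numerator vanishes faster than [q] at [w], so [g] tends to [0]
     there, which agrees with its value [0 / 0 = 0]. *)
  set (g := fun z => ((f z - f w - l / k * q z) / q z)%C).
  assert (Hg : Ccts g w).
  { destruct Hl as [p [Hp [Ep Kp]]], Hk as [s [Hs [Es Ks]]].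
    apply (Ccts_ext_near (fun z => (p z - l / k * s z) / s z)%C).
    - assert (Hs0 : s w <> 0) by (rewrite Es; auto).
      apply (Cnear_imp w _ _) with
        (2 := Cnear_and _ _ _ (Cnear_and _ _ _ Kp Ks) (Ccts_nz_near s w Hs Hs0)).
      intros z [[E1 E2] E3]. unfold g. rewrite Hqw in E2.
      destruct (classic (z = w)) as [->|Hz].
      + rewrite Hqw, Ep, Es.
        replace (f w - f w - l / k * 0)%C with (RtoC 0) by ring.
        replace (l - l / k * k)%C with (RtoC 0) by (field; auto). unfold Cdiv. ring.
      + rewrite E1, E2. assert (Hzw := Cminus_eq_contra _ _ Hz). field. repeat split; auto.
    - apply (Ccts_div (fun z => p z - l / k * s z)%C s); auto; [|rewrite Es; auto].
      apply (Ccts_minus p (fun z => l / k * s z)%C); auto.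
      apply (Ccts_mult (fun _ => l / k)%C s); auto. apply Ccts_const. }
  assert (G0 : rect g a b c d = 0).
  { apply (Goursat_punctured g w); auto. intros z Hz Hzw.
    apply (Cdiff_div (fun z => f z - f w - l / k * q z)%C q); auto.
    apply (Cdiff_minus (fun z => f z - f w)%C (fun z => l / k * q z)%C).
    - apply (Cdiff_minus f (fun _ => f w)); auto. apply Cdiff_const.
    - apply (Cdiff_mult (fun _ => l / k)%C q); auto. apply Cdiff_const. }
  assert (B1 : BCts (fun z => f z / q z)%C a b c d).
  { intros z Hz. assert (Hz' := proj1 Hz). apply Ccts_div; try apply Cdiff_cts; auto.
    apply Hqz; auto. eapply bdry_not_inner; eauto. }
  assert (B2 : BCts (fun z => / q z)%C a b c d).
  { intros z Hz. assert (Hz' := proj1 Hz). apply Ccts_inv; try apply Cdiff_cts; auto.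
    apply Hqz; auto. eapply bdry_not_inner; eauto. }
  assert (B3 : BCts (fun z => f w * / q z)%C a b c d).
  { intros z Hz. apply (Ccts_mult (fun _ => f w) (fun z => / q z)%C); [apply Ccts_const | apply B2; auto]. }
  assert (B4 : BCts (fun z => l / k + 0 * z)%C a b c d).
  { intros z Hz. apply (Ccts_plus (fun _ => l / k)%C (fun z => 0 * z)%C); [apply Ccts_const|].
    apply (Ccts_mult (fun _ => RtoC 0) (fun z => z)); [apply Ccts_const | apply Ccts_id]. }
  assert (B5 : BCts (fun z => f z / q z - f w * / q z)%C a b c d).
  { intros z Hz. apply (Ccts_minus (fun z => f z / q z)%C (fun z => f w * / q z)%C); auto. }
  rewrite (rect_ext g (fun z => f z / q z - f w * / q z - (l / k + 0 * z))%C) in G0; auto.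
  2: { intros z Hz. unfold g. field. split; auto. apply Hqz; [apply Hz | eapply bdry_not_inner; eauto]. }
  rewrite (rect_minus (fun z => f z / q z - f w * / q z)%C) in G0; auto.
  rewrite (rect_minus (fun z => f z / q z)%C) in G0; auto.
  rewrite rect_affine, (rect_scal (f w) (fun z => / q z)%C) in G0; auto.
  apply Ceq_minus. rewrite <- G0. ring.
Qed.

Ltac sumsq t x y :=
  repeat split; apply Rgt_not_eq; generalize (Rle_0_sqr (t - x)) (Rle_0_sqr (t - y));
  unfold Rsqr; nra.

Lemma Im_rect f a b c d : Im (rect f a b c d) =
  RInt (fun t => Im (f (t, c))) a b + RInt (fun t => Re (f (b, t))) c d
  - RInt (fun t => Im (f (t, d))) a b - RInt (fun t => Re (f (a, t))) c d.
Proof. unfold rect, CI, Im, Re. simpl. unfold Re, Im. ring. Qed.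

(** The imaginary part is the variation of the argument along the boundary. With the orientation
    taken into account, every side contributes the integral of a positive function
    [k / ((t - x)^2 + k^2)]. *)
Lemma rect_inv_nz w a b c d : inner_rect a b c d w -> rect (fun z => / (z - w))%C a b c d <> 0.
Proof.
  intros [Hx Hy] E. destruct w as [x y]. simpl in Hx, Hy.
  assert (P : forall p q : R, 0 < p -> 0 < p / (q ^ 2 + p ^ 2)).
  { intros p q Hp. apply Rdiv_lt_0_compat; nra. }
  assert (I : forall (g : R -> R) k u v, u < v -> 0 < k -> (forall t, g t = k / ((t - x) ^ 2 + k ^ 2)) \/
     (forall t, g t = k / ((t - y) ^ 2 + k ^ 2)) -> 0 < RInt g u v).
  { intros g k u v Huv Hk Hg. apply RInt_gt_0; auto.
    - intros t Ht. destruct Hg as [Hg|Hg]; rewrite Hg; auto.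
    - intros t Ht. destruct Hg as [Hg|Hg].
      + apply continuous_ext with (fun t => k / ((t - x) ^ 2 + k ^ 2)); auto.
        apply (ex_derive_continuous (V := R_NormedModule)). auto_derive. sumsq t x y.
      + apply continuous_ext with (fun t => k / ((t - y) ^ 2 + k ^ 2)); auto.
        apply (ex_derive_continuous (V := R_NormedModule)). auto_derive. sumsq t x y. }
  apply (f_equal Im) in E. rewrite Im_rect in E. change (Im 0) with 0 in E.
  set (A := RInt (fun t => Im (/ ((t, c) - (x, y)))) a b) in *.
  set (A' := RInt (fun t => Im (/ ((t, d) - (x, y)))) a b) in *.
  set (B := RInt (fun t => Re (/ ((b, t) - (x, y)))) c d) in *.
  set (B' := RInt (fun t => Re (/ ((a, t) - (x, y)))) c d) in *.
  assert (0 < A).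
  { apply (I _ (y - c)); [lra | lra |]. left. intros t. simpl. field. sumsq t x y. }
  assert (0 < - A').
  { unfold A'. rewrite <- (RInt_opp (V := R_CompleteNormedModule)).
    - apply (I _ (d - y)); [lra | lra |]. left. intros t. simpl. unfold opp; simpl. field. sumsq t x y.
    - apply (ex_RInt_continuous (V := R_CompleteNormedModule)). intros t _. simpl.
      apply (ex_derive_continuous (V := R_NormedModule)). auto_derive. sumsq t x y. }
  assert (0 < B).
  { apply (I _ (b - x)); [lra | lra |]. right. intros t. simpl. field. sumsq t x y. }
  assert (0 < - B').
  { unfold B'. rewrite <- (RInt_opp (V := R_CompleteNormedModule)).
    - apply (I _ (x - a)); [lra | lra |]. right. intros t. simpl. unfold opp; simpl. field. sumsq t x y.
    - apply (ex_RInt_continuous (V := R_CompleteNormedModule)). intros t _. simpl.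
      apply (ex_derive_continuous (V := R_NormedModule)). auto_derive. sumsq t x y. }
  lra.
Qed.

Lemma path_bounded (f : R -> C) a b : a <= b -> (forall t, a <= t <= b -> Pcts f t) ->
  exists M, forall t, a <= t <= b -> Cmod (f t) <= M.
Proof.
  intros Hab H.
  assert (K : forall g : R -> R, (forall t, a <= t <= b -> continuous g t) ->
     exists M, forall t, a <= t <= b -> Rabs (g t) <= M).
  { intros g Hg.
    destruct (continuity_ab_maj (fun t => Rabs (g t)) a b Hab) as [m [Hm _]].
    - intros t Ht. apply continuity_pt_filterlim.
      apply (continuous_comp g Rabs); auto. apply continuous_Rabs.
    - exists (Rabs (g m)). exact Hm. }
  destruct (K _ (fun t Ht => proj1 (H t Ht))) as [M1 K1].
  destruct (K _ (fun t Ht => proj2 (H t Ht))) as [M2 K2].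
  exists (M1 + M2). intros t Ht. eapply Rle_trans; [apply Cmod_le_parts|].
  apply Rplus_le_compat; auto.
Qed.

Lemma bdry_bounded f a b c d : a <= b -> c <= d -> BCts f a b c d ->
  exists M, forall z, bdry a b c d z -> Cmod (f z) <= M.
Proof.
  intros Hab Hcd H.
  assert (Hh : forall y, y = c \/ y = d -> exists M, forall t, a <= t <= b -> Cmod (f (t, y)) <= M).
  { intros y Hy. apply path_bounded; auto. intros t Ht. apply Pcts_h, H.
    unfold bdry, in_rect; simpl; lra. }
  assert (Hv : forall x, x = a \/ x = b -> exists M, forall t, c <= t <= d -> Cmod (f (x, t)) <= M).
  { intros y Hy. apply path_bounded; auto. intros t Ht. apply Pcts_v, H.
    unfold bdry, in_rect; simpl; lra. }
  destruct (Hh c (or_introl eq_refl)) as [M1 K1], (Hh d (or_intror eq_refl)) as [M2 K2].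
  destruct (Hv a (or_introl eq_refl)) as [M3 K3], (Hv b (or_intror eq_refl)) as [M4 K4].
  exists (Rmax (Rmax M1 M2) (Rmax M3 M4)). intros [x y] [[Hx Hy] Hz]. simpl in *.
  destruct Hz as [->|[->|[->| ->]]].
  - eapply Rle_trans; [apply K3; auto|]. eapply Rle_trans; [|apply Rmax_r]. apply Rmax_l.
  - eapply Rle_trans; [apply K4; auto|]. eapply Rle_trans; [|apply Rmax_r]. apply Rmax_r.
  - eapply Rle_trans; [apply K1; auto|]. eapply Rle_trans; [|apply Rmax_l]. apply Rmax_l.
  - eapply Rle_trans; [apply K2; auto|]. eapply Rle_trans; [|apply Rmax_l]. apply Rmax_r.
Qed.

Lemma squeeze_geometric x K q : 0 <= x -> 0 <= K -> 0 <= q < 1 -> (forall n, x <= K * q ^ n) -> x = 0.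
Proof.
  intros Hx HK Hq H. apply Rle_antisym; auto. apply Rnot_lt_le. intros Hp.
  assert (He : 0 < x / (K + 1)) by (apply Rdiv_lt_0_compat; lra).
  destruct (pow_lt_1_zero q ltac:(rewrite Rabs_pos_eq; lra) _ He) as [N HN].
  specialize (HN N (le_n N)). specialize (H N).
  assert (0 <= q ^ N) by (apply pow_le; lra). rewrite Rabs_pos_eq in HN by auto.
  apply (fun P => proj2 (Rcomplements.Rlt_div_r _ _ _ P)) in HN; nra.
Qed.

(* Cauchy's formula for [f z / (z - p) ^ n], which is holomorphic since [f]
   vanishes near [p], bounds [f w] by a multiple of [(|w - p| / r) ^ n]. *)
Lemma vanishing_on_disc f p r : 0 < r ->
  (forall z, in_rect (Re p - r) (Re p + r) (Im p - r) (Im p + r) z -> Cdiff f z) ->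
  Cnear p (fun z => f z = 0) ->
  forall w, Cmod (w - p) < r -> f w = 0.
Proof.
  intros Hr Hf H0 w Hw.
  destruct (classic (w = p)) as [->|Hwp]; [exact (Cnear_refl _ _ H0)|].
  assert (Hm : 0 < Cmod (w - p)) by (apply Cmod_gt_0, Cminus_eq_contra; auto).
  set (a := Re p - r) in *. set (b := Re p + r) in *. set (c := Im p - r) in *. set (d := Im p + r) in *.
  assert (Hin : inner_rect a b c d w).
  { assert (R1 := re_le_Cmod (w - p)). assert (R2 := im_le_Cmod (w - p)).
    replace (Re (w - p)) with (Re w - Re p) in R1 by (unfold Re, Im; simpl; ring).
    replace (Im (w - p)) with (Im w - Im p) in R2 by (unfold Re, Im; simpl; ring).
    apply Rcomplements.Rabs_le_between in R1. apply Rcomplements.Rabs_le_between in R2.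
    unfold inner_rect, a, b, c, d. lra. }
  assert (Hab : a <= b) by (unfold a, b; lra). assert (Hcd : c <= d) by (unfold c, d; lra).
  assert (Hbd : forall z, bdry a b c d z -> r <= Cmod (z - p)).
  { intros z [_ Hz].
    assert (R1 := re_le_Cmod (z - p)). assert (R2 := im_le_Cmod (z - p)).
    replace (Re (z - p)) with (Re z - Re p) in R1 by (unfold Re, Im; simpl; ring).
    replace (Im (z - p)) with (Im z - Im p) in R2 by (unfold Re, Im; simpl; ring).
    apply Rcomplements.Rabs_le_between in R1. apply Rcomplements.Rabs_le_between in R2.
    unfold a, b, c, d in Hz. lra. }
  assert (HfB : BCts f a b c d) by (intros z [Hz _]; apply Cdiff_cts; auto).
  destruct (bdry_bounded f a b c d Hab Hcd HfB) as [M HM].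
  assert (HM0 : 0 <= M).
  { eapply Rle_trans; [apply (Cmod_ge_0 (f (a, c)))|]. apply HM. unfold bdry, in_rect; simpl; lra. }
  set (delta := r - Cmod (w - p)). assert (Hdelta : 0 < delta) by (unfold delta; lra).
  set (I0 := rect (fun z => / (z - w))%C a b c d).
  assert (HI0 : 0 < Cmod I0) by (apply Cmod_gt_0, rect_inv_nz; auto).
  assert (Hlin : forall v z, Cder (fun z => z - v)%C z 1).
  { intros v z. eapply Cder_val; [apply (Cder_minus (fun z => z) (fun _ => v)); [apply Cder_id | apply Cder_const]|]. ring. }
  assert (Hbound : forall n, Cmod (f w) * Cmod I0 <= 4 * (b - a + (d - c)) * M / delta * (Cmod (w - p) / r) ^ n).
  { intros n. set (g := fun z => (f z / (z - p) ^ n)%C).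
    assert (Hg : forall z, in_rect a b c d z -> Cdiff g z).
    { intros z Hz. destruct (classic (z = p)) as [->|Hzp].
      - apply (Cdiff_ext_near (fun _ => 0)); [|apply Cdiff_const].
        apply (Cnear_imp p _ _) with (2 := H0). intros v Hv. unfold g. rewrite Hv. unfold Cdiv. ring.
      - apply (Cdiff_div f (fun z => (z - p) ^ n)%C); auto.
        + apply (Cdiff_pow (fun z => z - p)%C). eexists; apply Hlin.
        + apply Cpow_nz, Cminus_eq_contra; auto. }
    assert (Hww : (w - w)%C = 0) by ring.
    assert (E := rect_simple_pole g (fun z => z - w)%C w 1 a b c d Hin Hg
      (fun z _ => ex_intro _ _ (Hlin w z)) (Hlin w w) C1_nz Hww
      (fun z _ Hz => Cminus_eq_contra _ _ Hz)).
    fold I0 in E.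
    assert (B : Cmod (rect (fun z => g z / (z - w))%C a b c d)
       <= 4 * (b - a + (d - c)) * (M / (delta * r ^ n))).
    { apply rect_bound; auto.
      - intros z Hz. apply (Ccts_div g (fun z => z - w)%C).
        + apply Cdiff_cts, Hg, Hz.
        + eapply Cder_cts; apply Hlin.
        + apply Cminus_eq_contra. eapply bdry_not_inner; eauto.
      - intros z Hz. assert (Z1 := Hbd z Hz).
        assert (Z2 : delta <= Cmod (z - w)).
        { unfold delta. replace (z - w)%C with ((z - p) - (w - p))%C by ring.
          generalize (Cmod_sub_ge (z - p) (w - p)). lra. }
        assert (Hzp : (z - p)%C <> 0) by (apply Cmod_gt_0; lra).
        assert (Hzw : (z - w)%C <> 0) by (apply Cmod_gt_0; lra).
        unfold g. rewrite !Cmod_div; auto; [|apply Cpow_nz; auto]. rewrite Cmod_pow.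
        assert (Pr : 0 < r ^ n) by (apply pow_lt; auto).
        assert (r ^ n <= Cmod (z - p) ^ n) by (apply pow_incr; lra).
        unfold Rdiv. rewrite Rmult_assoc, <- Rinv_mult.
        apply Rmult_le_compat; auto; [apply Cmod_ge_0|left; apply Rinv_0_lt_compat; nra|].
        apply Rinv_le_contravar; nra. }
    rewrite E, Cmod_mult in B. unfold g in B.
    rewrite Cmod_div, Cmod_pow in B by (apply Cpow_nz, Cminus_eq_contra; auto).
    assert (Pw : 0 < Cmod (w - p) ^ n) by (apply pow_lt; auto).
    assert (Pr : 0 < r ^ n) by (apply pow_lt; auto).
    apply (Rmult_le_compat_r (Cmod (w - p) ^ n)) in B; [|lra].
    replace ((Cmod (w - p) / r) ^ n) with (Cmod (w - p) ^ n * / r ^ n)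
      by (unfold Rdiv; rewrite Rpow_mult_distr, pow_inv; reflexivity).
    replace (Cmod (f w) * Cmod I0)
      with (Cmod (f w) / Cmod (w - p) ^ n * Cmod I0 * Cmod (w - p) ^ n) by (field; lra).
    eapply Rle_trans; [exact B|]. right. field. lra. }
  apply Cmod_eq_0.
  assert (E : Cmod (f w) * Cmod I0 = 0).
  { apply (squeeze_geometric _ (4 * (b - a + (d - c)) * M / delta) (Cmod (w - p) / r)); auto.
    - apply Rmult_le_pos; apply Cmod_ge_0.
    - apply Rdiv_le_0_compat; auto. apply Rmult_le_pos; lra.
    - split; [apply Rdiv_le_0_compat; lra|]. apply Rcomplements.Rlt_div_l; lra. }
  apply Rmult_integral in E. destruct E; lra.
Qed.

Lemma identity_step h p r w : 0 < r ->
  (forall z : C, z <> 1 -> Cdiff h z) -> ~ in_rect (Re p - r) (Re p + r) (Im p - r) (Im p + r) 1 ->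
  Cnear p (fun z => h z = 0) -> Cmod (w - p) < r -> Cnear w (fun z => h z = 0).
Proof.
  intros Hr Hh Hp H0 Hw. exists (r - Cmod (w - p)). split; [lra|].
  intros z Hz. apply (vanishing_on_disc h p r); auto.
  - intros v Hv. apply Hh. intros ->. auto.
  - replace (z - p)%C with ((z - w) + (w - p))%C by ring.
    generalize (Cmod_triangle (z - w) (w - p)). lra.
Qed.

(** The chain of discs goes around the excluded point [1]. It runs to the left along [Im z = 2] in
    steps of [1/2], with squares of half-side [1] that stay above [Im z = 1], and then descends to
    the axis in two steps with half-side [3/2]. The last square, centred at [t + i], meets the real
    axis and avoids [1] because [t <= -1]. *)
Theorem identity_off_one h : (forall z : C, z <> 1 -> Cdiff h z) -> (forall z : C, 1 < Re z -> h z = 0) ->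
  forall t, t <= -1 -> h (RtoC t) = 0.
Proof.
  intros Hh H0 t Ht.
  assert (Hline : forall k x, 2 - INR k / 2 <= x <= 3 -> Cnear (x, 2) (fun z => h z = 0)).
  { induction k; intros x Hx.
    - simpl in Hx.
      apply (Cnear_imp _ _ _ H0). apply Cnear_open_Re. simpl. lra.
    - rewrite S_INR in Hx.
      destruct (Rle_dec (2 - INR k / 2) x) as [L|L]; [apply IHk; lra|].
      apply (identity_step h (x + 1 / 2, 2) 1); auto; try lra.
      + unfold in_rect; simpl; lra.
      + apply IHk. assert (0 <= INR k) by apply pos_INR. lra.
      + rewrite Cmod_horizontal, Rabs_left; lra. }
  assert (N1 : Cnear (t, 2) (fun z => h z = 0)).
  { destruct (nfloor_ex (2 * (2 - t)) ltac:(lra)) as [n [_ Hn]].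
    apply (Hline (S n)). rewrite S_INR. lra. }
  assert (N2 : Cnear (t, 1) (fun z => h z = 0)).
  { apply (identity_step h (t, 2) (3 / 2)); auto; try lra.
    - unfold in_rect; simpl; lra.
    - rewrite Cmod_vertical, Rabs_left; lra. }
  change (h (t, 0) = 0). apply (Cnear_refl (t, 0) (fun z => h z = 0)).
  apply (identity_step h (t, 1) (3 / 2)); auto; try lra.
  - unfold in_rect; simpl; lra.
  - rewrite Cmod_vertical, Rabs_left; lra.
Qed.

(** * Integrals over the half-line *)

Definition Clim (F : R -> C) (l : C) : Prop :=
  forall e, 0 < e -> exists Y0, forall Y, Y0 <= Y -> Cmod (F Y - l) < e.

Lemma Clim_unique F l l' : Clim F l -> Clim F l' -> l = l'.
Proof.
  intros H H'. apply Ceq_minus, Cmod_eq_0. apply Rle_antisym; [|apply Cmod_ge_0].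
  apply Rnot_lt_le. intros Hp.
  destruct (H (Cmod (l - l') / 2) ltac:(lra)) as [Y1 K1].
  destruct (H' (Cmod (l - l') / 2) ltac:(lra)) as [Y2 K2].
  specialize (K1 (Rmax Y1 Y2) (Rmax_l _ _)). specialize (K2 (Rmax Y1 Y2) (Rmax_r _ _)).
  assert (T := Cmod_triangle (F (Rmax Y1 Y2) - l') (- (F (Rmax Y1 Y2) - l))).
  rewrite Cmod_opp in T.
  replace (F (Rmax Y1 Y2) - l' + - (F (Rmax Y1 Y2) - l))%C with (l - l')%C in T by ring. lra.
Qed.

Lemma Clim_ext F G l : (exists Y0, forall Y, Y0 <= Y -> F Y = G Y) -> Clim F l -> Clim G l.
Proof.
  intros [Y1 H1] H e He. destruct (H e He) as [Y2 H2]. exists (Rmax Y1 Y2).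
  intros Y HY. rewrite <- H1; [apply H2|]; eapply Rle_trans; [apply Rmax_r| |apply Rmax_l|]; eauto.
Qed.

Lemma Clim_const c : Clim (fun _ => c) c.
Proof.
  intros e He. exists 0. intros. replace (c - c)%C with (RtoC 0) by ring. rewrite Cmod_0; auto.
Qed.

Lemma Clim_plus F G l m : Clim F l -> Clim G m -> Clim (fun Y => F Y + G Y)%C (l + m)%C.
Proof.
  intros H1 H2 e He. destruct (H1 (e / 2) ltac:(lra)) as [Y1 K1], (H2 (e / 2) ltac:(lra)) as [Y2 K2].
  exists (Rmax Y1 Y2). intros Y HY.
  specialize (K1 Y (Rle_trans _ _ _ (Rmax_l _ _) HY)).
  specialize (K2 Y (Rle_trans _ _ _ (Rmax_r _ _) HY)).
  replace (F Y + G Y - (l + m))%C with ((F Y - l) + (G Y - m))%C by ring.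
  eapply Rle_lt_trans; [apply Cmod_triangle | lra].
Qed.

Lemma Clim_scal c F l : Clim F l -> Clim (fun Y => c * F Y)%C (c * l)%C.
Proof.
  intros H e He. assert (Hc := Cmod_ge_0 c).
  destruct (H (e / (Cmod c + 1)) ltac:(apply Rdiv_lt_0_compat; lra)) as [Y0 K].
  exists Y0. intros Y HY. specialize (K Y HY).
  replace (c * F Y - c * l)%C with (c * (F Y - l))%C by ring. rewrite Cmod_mult.
  apply (fun P => proj2 (Rcomplements.Rlt_div_r _ _ _ P)) in K; [|lra].
  generalize (Cmod_ge_0 (F Y - l)). nra.
Qed.

Lemma Clim_opp F l : Clim F l -> Clim (fun Y => - F Y)%C (- l)%C.
Proof.
  intros H. replace (- l)%C with ((-1) * l)%C by ring.
  apply (Clim_ext (fun Y => (-1) * F Y)%C); [|apply Clim_scal; auto].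
  exists 0. intros. ring.
Qed.

Lemma Clim_minus F G l m : Clim F l -> Clim G m -> Clim (fun Y => F Y - G Y)%C (l - m)%C.
Proof. intros H1 H2. apply (Clim_plus F (fun Y => - G Y)%C); auto. apply Clim_opp; auto. Qed.

Lemma exp_neg_small lam e : 0 < lam -> 0 < e ->
  exists Y0, 0 <= Y0 /\ forall Y, Y0 <= Y -> exp (- (lam * Y)) < e.
Proof.
  intros Hl He. assert (0 < / e) by (apply Rinv_0_lt_compat; auto).
  exists (/ e / lam). split; [apply Rdiv_le_0_compat; lra|].
  intros Y HY. apply Rcomplements.Rle_div_l in HY; auto.
  rewrite exp_Ropp. rewrite <- (Rinv_inv e).
  apply Rinv_lt_contravar.
  - apply Rmult_lt_0_compat; [auto | apply exp_pos].
  - generalize (exp_ineq1_le (lam * Y)). lra.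
Qed.

Lemma Clim_exp_bound F lam K : 0 < lam ->
  (exists Y0, forall Y, Y0 <= Y -> Cmod (F Y) <= K * exp (- (lam * Y))) -> Clim F 0.
Proof.
  intros Hl [Y1 H] e He.
  destruct (exp_neg_small lam (e / (Rabs K + 1)) Hl) as [Y2 [_ H2]].
  { apply Rdiv_lt_0_compat; auto. generalize (Rabs_pos K); lra. }
  exists (Rmax Y1 Y2). intros Y HY.
  specialize (H Y (Rle_trans _ _ _ (Rmax_l _ _) HY)).
  specialize (H2 Y (Rle_trans _ _ _ (Rmax_r _ _) HY)).
  replace (F Y - 0)%C with (F Y) by ring.
  eapply Rle_lt_trans; [exact H|].
  assert (P := exp_pos (- (lam * Y))). assert (Q := Rabs_pos K). assert (Q' := Rle_abs K).
  apply (fun P => proj2 (Rcomplements.Rlt_div_r _ _ _ P)) in H2; [|lra]. nra.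
Qed.

Lemma Clim_Re F l : Clim F l -> is_lim (fun Y => Re (F Y)) p_infty (Re l).
Proof.
  intros H. apply is_lim_spec. intros e. destruct (H e (cond_pos e)) as [Y0 K].
  exists Y0. intros Y HY. specialize (K Y ltac:(lra)).
  eapply Rle_lt_trans; [|exact K]. apply (re_le_Cmod (F Y - l)).
Qed.

Lemma Clim_Im F l : Clim F l -> is_lim (fun Y => Im (F Y)) p_infty (Im l).
Proof.
  intros H. apply is_lim_spec. intros e. destruct (H e (cond_pos e)) as [Y0 K].
  exists Y0. intros Y HY. specialize (K Y ltac:(lra)).
  eapply Rle_lt_trans; [|exact K]. apply (im_le_Cmod (F Y - l)).
Qed.

Lemma Clim_cauchy F :
  (forall e, 0 < e -> exists Y0, forall Y Z, Y0 <= Y -> Y <= Z -> Cmod (F Z - F Y) < e) ->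
  exists l, Clim F l.
Proof.
  intros H.
  assert (K : forall g : R -> R, (forall e, 0 < e -> exists Y0, forall Y Z, Y0 <= Y -> Y <= Z ->
    Rabs (g Z - g Y) < e) -> exists l : R, forall e, 0 < e -> exists Y0, forall Y, Y0 <= Y -> Rabs (g Y - l) < e).
  { intros g Hg.
    assert (L : ex_finite_lim_seq (fun n => g (INR n))).
    { apply ex_lim_seq_cauchy_corr. intros e. destruct (Hg e (cond_pos e)) as [Y0 K].
      destruct (nfloor_ex (Rmax 0 Y0) (Rmax_l _ _)) as [N [_ HN]].
      assert (HN' : Y0 <= INR (S N)) by (rewrite S_INR; generalize (Rmax_r 0 Y0); lra).
      exists (S N). intros n m Hn Hm. apply le_INR in Hn. apply le_INR in Hm.
      destruct (Rle_dec (INR n) (INR m)).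
      - rewrite Rabs_minus_sym. apply K; lra.
      - apply K; lra. }
    destruct L as [l Hl]. exists l. intros e He.
    apply is_lim_seq_spec in Hl.
    destruct (Hg (e / 2) ltac:(lra)) as [Y0 K].
    destruct (Hl (mkposreal (e / 2) ltac:(lra))) as [N HN]. simpl in HN.
    exists (Rmax 0 Y0). intros Y HY.
    assert (HY1 := Rle_trans _ _ _ (Rmax_l _ _) HY). assert (HY2 := Rle_trans _ _ _ (Rmax_r _ _) HY).
    destruct (nfloor_ex Y HY1) as [M [HM1 HM2]].
    set (n := (N + S M)%nat).
    assert (Hn : Y <= INR n) by (unfold n; rewrite plus_INR, S_INR; generalize (pos_INR N); lra).
    specialize (HN n ltac:(unfold n; lia)). specialize (K Y (INR n) HY2 Hn).
    replace (g Y - l) with (- (g (INR n) - g Y) + (g (INR n) - l)) by ring.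
    eapply Rle_lt_trans; [apply Rabs_triang|]. rewrite Rabs_Ropp. lra. }
  destruct (K (fun Y => Re (F Y))) as [l1 K1].
  { intros e He. destruct (H e He) as [Y0 H0]. exists Y0. intros Y Z HY HZ.
    eapply Rle_lt_trans; [|apply (H0 Y Z); auto]. apply (re_le_Cmod (F Z - F Y)). }
  destruct (K (fun Y => Im (F Y))) as [l2 K2].
  { intros e He. destruct (H e He) as [Y0 H0]. exists Y0. intros Y Z HY HZ.
    eapply Rle_lt_trans; [|apply (H0 Y Z); auto]. apply (im_le_Cmod (F Z - F Y)). }
  exists (l1, l2). intros e He.
  destruct (K1 (e / 2) ltac:(lra)) as [Y1 H1], (K2 (e / 2) ltac:(lra)) as [Y2 H2].
  exists (Rmax Y1 Y2). intros Y HY.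
  specialize (H1 Y (Rle_trans _ _ _ (Rmax_l _ _) HY)).
  specialize (H2 Y (Rle_trans _ _ _ (Rmax_r _ _) HY)).
  eapply Rle_lt_trans; [apply Cmod_le_parts|].
  unfold Re, Im in *; simpl in *. unfold Rminus in *. lra.
Qed.

Definition CIlim (f : R -> C) (l : C) : Prop := Clim (fun Y => CI f 0 Y) l.

Lemma ex_RInt_exp_neg K lam a b : ex_RInt (fun t => K * exp (- (lam * t))) a b.
Proof.
  apply (ex_RInt_continuous (V := R_CompleteNormedModule)).
  intros t _. apply (ex_derive_continuous (V := R_NormedModule)). auto_derive. auto.
Qed.

Lemma RInt_exp_neg K lam a b : lam <> 0 ->
  RInt (fun t => K * exp (- (lam * t))) a b = K / lam * (exp (- (lam * a)) - exp (- (lam * b))).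
Proof.
  intros Hl.
  assert (E : K / lam * (exp (- (lam * a)) - exp (- (lam * b)))
    = - (K / lam * exp (- (lam * b))) - - (K / lam * exp (- (lam * a)))) by ring. rewrite E.
  apply is_RInt_unique.
  apply (is_RInt_derive (V := R_CompleteNormedModule) (fun t => - (K / lam * exp (- (lam * t))))).
  - intros t _. auto_derive; auto. field; auto.
  - intros t _. apply (ex_derive_continuous (V := R_NormedModule)). auto_derive. auto.
Qed.

Definition half_cts (f : R -> C) : Prop := forall t, 0 <= t -> Pcts f t.

Lemma half_cts_CIex f a b : half_cts f -> 0 <= a <= b -> CIex f a b.
Proof. intros H Hab. apply CIex_Pcts_le; [lra|]. intros t Ht. apply H; lra. Qed.

Lemma CI_tail_bound f lam K Y Z : 0 < lam -> half_cts f -> 0 <= Y <= Z -> 0 <= K ->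
  (forall t, Y <= t -> Cmod (f t) <= K * exp (- (lam * t))) ->
  Cmod (CI f Y Z) <= 2 * (K / lam) * exp (- (lam * Y)).
Proof.
  intros Hl Hf HYZ HK HB.
  apply Rle_trans with (2 * RInt (fun t => K * exp (- (lam * t))) Y Z).
  - apply CI_bound_fun; try lra.
    + apply half_cts_CIex; auto.
    + apply ex_RInt_exp_neg.
    + intros t Ht. apply HB; lra.
  - rewrite RInt_exp_neg by lra. assert (P := exp_pos (- (lam * Z))).
    assert (0 <= K / lam) by (apply Rdiv_le_0_compat; auto). nra.
Qed.

Lemma CIlim_exists f lam K T : 0 < lam -> half_cts f -> 0 <= T ->
  (forall t, T <= t -> Cmod (f t) <= K * exp (- (lam * t))) -> exists l, CIlim f l.
Proof.
  intros Hl Hf HT HB. apply Clim_cauchy. intros e He.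
  assert (HK : 0 <= K).
  { generalize (Cmod_ge_0 (f T)) (HB T (Rle_refl T)) (exp_pos (- (lam * T))). nra. }
  assert (HK2 : 0 <= K / lam) by (apply Rdiv_le_0_compat; auto).
  destruct (exp_neg_small lam (e / (2 * (K / lam) + 1)) Hl) as [Y0 [HY0 H0]].
  { apply Rdiv_lt_0_compat; lra. }
  exists (Rmax T Y0). intros Y Z HY HZ.
  assert (HY1 := Rle_trans _ _ _ (Rmax_l _ _) HY). assert (HY2 := Rle_trans _ _ _ (Rmax_r _ _) HY).
  rewrite <- (CI_Chasles f 0 Y Z) by (apply half_cts_CIex; auto; lra).
  replace (CI f 0 Y + CI f Y Z - CI f 0 Y)%C with (CI f Y Z) by ring.
  eapply Rle_lt_trans; [apply (CI_tail_bound f lam K); auto; [lra|]; intros; apply HB; lra|].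
  specialize (H0 Y HY2). assert (P := exp_pos (- (lam * Y))).
  apply (fun P => proj2 (Rcomplements.Rlt_div_r _ _ _ P)) in H0; [|lra]. nra.
Qed.

Lemma Clim_Cmod_le F l M : Clim F l -> (exists Y0, forall Y, Y0 <= Y -> Cmod (F Y) <= M) -> Cmod l <= M.
Proof.
  intros H [Y1 H1]. apply Rnot_lt_le. intros Hl.
  destruct (H (Cmod l - M) ltac:(lra)) as [Y2 H2].
  specialize (H1 (Rmax Y1 Y2) (Rmax_l _ _)). specialize (H2 (Rmax Y1 Y2) (Rmax_r _ _)).
  rewrite Cmod_sub_sym in H2. generalize (Cmod_sub_ge l (F (Rmax Y1 Y2))). lra.
Qed.

Lemma CIlim_bound f K l : half_cts f -> (forall t, 0 <= t -> Cmod (f t) <= K * exp (- t)) ->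
  CIlim f l -> Cmod l <= 2 * K.
Proof.
  intros Hf HB Hl. apply (Clim_Cmod_le _ _ _ Hl). exists 0. intros Y HY.
  assert (HK : 0 <= K).
  { generalize (Cmod_ge_0 (f 0)) (HB 0 (Rle_refl 0)) (exp_pos (- 0)). nra. }
  replace (2 * K) with (2 * (K / 1) * exp (- (1 * 0))) by (rewrite Rmult_0_r, Ropp_0, exp_0; field).
  apply CI_tail_bound; auto; try lra. intros t Ht. rewrite Rmult_1_l. auto.
Qed.

Lemma CIlim_plus f g l m : half_cts f -> half_cts g -> CIlim f l -> CIlim g m ->
  CIlim (fun t => f t + g t)%C (l + m)%C.
Proof.
  intros Hf Hg H1 H2. apply (Clim_ext (fun Y => CI f 0 Y + CI g 0 Y)%C).
  - exists 0. intros Y HY. rewrite CI_plus; auto; apply half_cts_CIex; auto; lra.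
  - apply Clim_plus; auto.
Qed.

Lemma CIlim_minus f g l m : half_cts f -> half_cts g -> CIlim f l -> CIlim g m ->
  CIlim (fun t => f t - g t)%C (l - m)%C.
Proof.
  intros Hf Hg H1 H2. apply (Clim_ext (fun Y => CI f 0 Y - CI g 0 Y)%C).
  - exists 0. intros Y HY. rewrite CI_minus; auto; apply half_cts_CIex; auto; lra.
  - apply Clim_minus; auto.
Qed.

Lemma CIlim_scal c f l : half_cts f -> CIlim f l -> CIlim (fun t => c * f t)%C (c * l)%C.
Proof.
  intros Hf H1. apply (Clim_ext (fun Y => c * CI f 0 Y)%C).
  - exists 0. intros Y HY. rewrite CI_scal; auto; apply half_cts_CIex; auto; lra.
  - apply Clim_scal; auto.
Qed.

Lemma CIlim_ext f g l : (forall t, 0 < t -> f t = g t) -> CIlim f l -> CIlim g l.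
Proof.
  intros H. apply Clim_ext. exists 0. intros Y HY. apply CI_ext.
  rewrite Rmin_left by auto. intros t Ht. apply H; lra.
Qed.

Lemma CI_conj f a b : CIex f a b -> CI (fun t => Cconj (f t)) a b = Cconj (CI f a b).
Proof.
  intros [F1 F2]. apply C_ext; simpl.
  - reflexivity.
  - apply (RInt_opp (V := R_CompleteNormedModule) (fun t => Im (f t))); auto.
Qed.

Lemma CIlim_conj f l : half_cts f -> CIlim f l -> CIlim (fun t => Cconj (f t)) (Cconj l).
Proof.
  intros Hf H e He. destruct (H e He) as [Y0 K]. exists (Rmax 0 Y0). intros Y HY.
  rewrite CI_conj.
  - rewrite <- Cminus_conj, Cmod_conj. apply K. eapply Rle_trans; [apply Rmax_r | eauto].
  - apply half_cts_CIex; auto. split; [lra|]. eapply Rle_trans; [apply Rmax_l | eauto].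
Qed.

(** Cauchy's theorem on [[a, b] x [0, Y]] as [Y] tends to infinity, where the top side decays
    exponentially. The exceptional point [w] will be a branch point on the lower side, at which only
    continuity is available. *)
Lemma half_strip_shift f w a b lam K T : 0 < lam -> a <= b -> 0 <= T -> Ccts f w ->
  (forall z, a <= Re z <= b -> 0 <= Im z -> z <> w -> Cdiff f z) ->
  (forall z, a <= Re z <= b -> T <= Im z -> Cmod (f z) <= K * exp (- (lam * Im z))) ->
  exists la lb, CIlim (fun t => f (a, t)) la /\ CIlim (fun t => f (b, t)) lb /\
    (Ci * la = CI (fun t => f (t, 0)) a b + Ci * lb)%C.
Proof.
  intros Hl Hab HT Hw Hf HB.
  assert (HC : forall z, a <= Re z <= b -> 0 <= Im z -> Ccts f z).
  { intros z H1 H2. destruct (classic (z = w)) as [->|]; auto. apply Cdiff_cts, Hf; auto. }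
  assert (Hhc : forall x, a <= x <= b -> half_cts (fun t => f (x, t))).
  { intros x Hx t Ht. apply Pcts_v, HC; auto. }
  destruct (CIlim_exists (fun t => f (a, t)) lam K T) as [la La].
  { auto. } { apply Hhc; lra. } { auto. } { intros t Ht. apply (HB (a, t)); simpl; lra. }
  destruct (CIlim_exists (fun t => f (b, t)) lam K T) as [lb Lb].
  { auto. } { apply Hhc; lra. } { auto. } { intros t Ht. apply (HB (b, t)); simpl; lra. }
  exists la, lb. split; auto. split; auto.
  assert (LT : Clim (fun Y => CI (fun t => f (t, Y)) a b) 0).
  { apply (Clim_exp_bound _ lam (2 * (b - a) * K)). auto. exists T. intros Y HY.
    rewrite Rmult_assoc. apply CI_bound; auto.
    - apply CIex_Pcts_le; auto. intros t Ht. apply Pcts_h, HC; simpl; lra. }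
  assert (L : Clim (fun Y => CI (fun t => f (t, 0%R)) a b + Ci * CI (fun t => f (b, t)) 0 Y
      - CI (fun t => f (t, Y)) a b - Ci * CI (fun t => f (a, t)) 0 Y)%C
      (CI (fun t => f (t, 0%R)) a b + Ci * lb - 0 - Ci * la)%C).
  { apply (Clim_minus (fun Y => CI (fun t => f (t, 0%R)) a b + Ci * CI (fun t => f (b, t)) 0 Y
      - CI (fun t => f (t, Y)) a b)%C); [|apply Clim_scal; exact La].
    apply (Clim_minus (fun Y => CI (fun t => f (t, 0%R)) a b + Ci * CI (fun t => f (b, t)) 0 Y)%C); auto.
    apply (Clim_plus (fun _ => CI (fun t => f (t, 0%R)) a b)); [apply Clim_const | apply Clim_scal; exact Lb]. }
  assert (L0 : Clim (fun Y => CI (fun t => f (t, 0%R)) a b + Ci * CI (fun t => f (b, t)) 0 Y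
      - CI (fun t => f (t, Y)) a b - Ci * CI (fun t => f (a, t)) 0 Y)%C 0).
  { apply (Clim_ext (fun _ => 0)); [|apply Clim_const]. exists 0. intros Y HY.
    symmetry. apply (Goursat_punctured f w a b 0 Y); auto.
    intros z [Z1 Z2]. apply Hf; lra. }
  assert (E := Clim_unique _ _ _ L L0).
  apply Ceq_minus. rewrite <- (Copp_0), <- E. ring.
Qed.

Lemma CI_reflect f Y : CIex f (- Y) 0 -> CI f (- Y) 0 = CI (fun t => f (- t)) 0 Y.
Proof.
  intros [F1 F2].
  assert (H : forall g : R -> R, ex_RInt g (- Y) 0 -> RInt g (- Y) 0 = RInt (fun t => g (- t)) 0 Y).
  { intros g Hg.
    symmetry. apply is_RInt_unique.
    assert (E := is_RInt_swap (V := R_CompleteNormedModule) _ _ _ _ (RInt_correct (V := R_CompleteNormedModule) g (- Y) 0 Hg)).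
    rewrite <- Ropp_0 in E at 1.
    assert (E2 := is_RInt_opp _ _ _ _ (is_RInt_comp_opp (V := R_CompleteNormedModule) g 0 Y _ E)).
    rewrite opp_opp in E2.
    apply (is_RInt_ext (fun t => opp (opp (g (- t))))); [|exact E2].
    intros. apply opp_opp. }
  apply C_ext; simpl; apply H; auto.
Qed.

(** * The kernel 1 / sin (pi z) *)

Definition Csin (z : C) : C := ((Cexp (Ci * z) - Cexp (- (Ci * z))) / (2 * Ci))%C.

Lemma Csin_parts x y : Csin (x, y) = (sin x * cosh y, cos x * sinh y).
Proof.
  unfold Csin, Cexp, cosh, sinh.
  replace (Re (Ci * (x, y))) with (- y) by (unfold Re; simpl; ring).
  replace (Im (Ci * (x, y))) with x by (unfold Im; simpl; ring).
  replace (Re (- (Ci * (x, y)))) with y by (unfold Re; simpl; ring).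
  replace (Im (- (Ci * (x, y)))) with (- x) by (unfold Im; simpl; ring).
  rewrite cos_neg, sin_neg. apply C_ext; simpl; field.
Qed.

Lemma Ccos_parts x y : Ccos (x, y) = (cos x * cosh y, - (sin x * sinh y)).
Proof.
  unfold Ccos, Cexp, cosh, sinh.
  replace (Re (Ci * (x, y))) with (- y) by (unfold Re; simpl; ring).
  replace (Im (Ci * (x, y))) with x by (unfold Im; simpl; ring).
  replace (Re (- (Ci * (x, y)))) with y by (unfold Re; simpl; ring).
  replace (Im (- (Ci * (x, y)))) with (- x) by (unfold Im; simpl; ring).
  rewrite cos_neg, sin_neg. apply C_ext; simpl; field.
Qed.

Lemma Cder_Csin z : Cder Csin z (Ccos z).
Proof.
  assert (H1 : Cder (fun z => Ci * z)%C z Ci).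
  { eapply Cder_val; [apply (Cder_scal Ci (fun z => z)), Cder_id | ring]. }
  assert (H2 := Cder_opp _ _ _ H1).
  assert (K1 := Cder_comp _ Cexp z _ _ H1 (Cder_Cexp _)).
  assert (K2 := Cder_comp _ Cexp z _ _ H2 (Cder_Cexp _)).
  apply (Cder_ext_near (fun z => / (2 * Ci) * (Cexp (Ci * z) - Cexp (- (Ci * z))))%C).
  - apply Cnear_all. intros w. unfold Csin, Cdiv. ring.
  - eapply Cder_val; [apply (Cder_scal (/ (2 * Ci))%C), (Cder_minus _ _ _ _ _ K1 K2)|].
    unfold Ccos. field. apply Ci_nz.
Qed.

Lemma Cdiff_Csin z : Cdiff Csin z.
Proof. eexists; apply Cder_Csin. Qed.

Lemma cosh_sq y : cosh y ^ 2 = 1 + sinh y ^ 2.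
Proof.
  unfold cosh, sinh. assert (E : exp y * exp (- y) = 1) by (rewrite <- exp_plus, Rplus_opp_r; apply exp_0).
  nra.
Qed.

Lemma cosh_ge_1 y : 1 <= cosh y.
Proof. unfold cosh. generalize (exp_ineq1_le y) (exp_ineq1_le (- y)). lra. Qed.

Lemma cosh_opp y : cosh (- y) = cosh y.
Proof. unfold cosh. rewrite Ropp_involutive. lra. Qed.

Lemma sinh_opp y : sinh (- y) = - sinh y.
Proof. unfold sinh. rewrite Ropp_involutive. lra. Qed.

Lemma sinh_ge y : 0 <= y -> y <= sinh y.
Proof.
  intros Hy. destruct (Req_dec y 0) as [->|Hn]; [rewrite sinh_0; lra|].
  destruct (MVT_gen sinh 0 y cosh) as [c [Hc E]].
  - intros x _. unfold sinh, cosh. auto_derive; auto. field.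
  - intros x _. apply derivable_continuous_pt, derivable_pt_sinh.
  - rewrite sinh_0 in E. generalize (cosh_ge_1 c). nra.
Qed.

Lemma sinh_pos y : 0 < y -> 0 < sinh y.
Proof. intros. generalize (sinh_ge y). lra. Qed.

Lemma cosh_ge_exp y : exp y / 2 <= cosh y.
Proof. unfold cosh. generalize (exp_pos (- y)). lra. Qed.

Lemma sinh_ge_exp y : 1 <= y -> exp y / 4 <= sinh y.
Proof.
  intros Hy. unfold sinh.
  assert (exp (- y) <= exp y / 2); [|lra].
  assert (E : exp y * exp (- y) = 1) by (rewrite <- exp_plus, Rplus_opp_r; apply exp_0).
  assert (2 <= exp y) by (generalize (exp_ineq1_le y); lra).
  generalize (exp_pos (- y)). nra.
Qed.

(** [|sin (x + i y)|^2 = sin^2 x + sinh^2 y]. *)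
Lemma Cmod_Csin_ge x y : Rabs (sinh y) <= Cmod (Csin (x, y)).
Proof.
  rewrite Csin_parts. unfold Cmod; simpl fst; simpl snd.
  rewrite <- sqrt_Rsqr_abs. apply sqrt_le_1_alt. unfold Rsqr.
  assert (E := cosh_sq y). assert (E2 := sin2_cos2 x). unfold Rsqr in E2.
  assert (H := Rle_0_sqr (sin x)). unfold Rsqr in H.
  replace ((sin x * cosh y) ^ 2 + (cos x * sinh y) ^ 2)
    with (sin x * sin x * cosh y ^ 2 + cos x * cos x * (sinh y * sinh y)) by ring.
  rewrite E. replace (cos x * cos x) with (1 - sin x * sin x) by lra. nra.
Qed.

Lemma PI_gt_3 : 3 < PI.
Proof. generalize PI2_3_2. lra. Qed.

(** * The sum of the two boundary integrals over the strip |Re z| <= 1/2 *)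

(** Since [sin (pi z)] equals [cosh (pi t)] at [1/2 + i t] and its opposite at [-1/2 + i t], this
    is, up to sign, the integrand [f z / sin (pi z)] on the lines [Re z = 1/2] and [Re z = -1/2],
    folded onto [t >= 0]. *)
Definition sym_kernel (f : C -> C) (x t : R) : C :=
  ((f (x, t) + f (x, (- t)%R)) / RtoC (cosh (PI * t)))%C.

Lemma cosh_nz y : RtoC (cosh y) <> 0.
Proof. intros E. apply RtoC_inj in E. generalize (cosh_ge_1 y). lra. Qed.

Lemma Pcts_plus f g t : Pcts f t -> Pcts g t -> Pcts (fun t => f t + g t)%C t.
Proof.
  intros [F1 F2] [G1 G2]. split; simpl.
  - apply (continuous_plus (V := R_NormedModule) (fun t => Re (f t)) (fun t => Re (g t))); auto.
  - apply (continuous_plus (V := R_NormedModule) (fun t => Im (f t)) (fun t => Im (g t))); auto.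
Qed.

Ltac Rring := match goal with |- ?a = ?b => change (@eq R a b) end; ring.

Lemma Pcts_scal_R f (g : R -> R) t : Pcts f t -> continuous g t -> Pcts (fun t => f t * RtoC (g t))%C t.
Proof.
  intros [F1 F2] G. split; simpl.
  - apply continuous_ext with (fun t => Re (f t) * g t); [intros; unfold Re; Rring|].
    apply (continuous_mult (K := R_AbsRing) (fun t => Re (f t)) g); auto.
  - apply continuous_ext with (fun t => Im (f t) * g t); [intros; unfold Im; Rring|].
    apply (continuous_mult (K := R_AbsRing) (fun t => Im (f t)) g); auto.
Qed.

Lemma Pcts_ext f g t : (forall t, f t = g t) -> Pcts f t -> Pcts g t.
Proof.
  intros H [F1 F2]. split.
  - apply continuous_ext with (fun t => Re (f t)); auto. intros; rewrite H; auto.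
  - apply continuous_ext with (fun t => Im (f t)); auto. intros; rewrite H; auto.
Qed.

Lemma Pcts_reflect f t : Pcts f (- t) -> Pcts (fun t => f (- t)) t.
Proof.
  intros [F1 F2].
  assert (H : forall g : R -> R, continuous g (- t) -> continuous (fun t => g (- t)) t).
  { intros g Hg. apply (continuous_comp Ropp g); auto.
    apply (continuous_opp (V := R_NormedModule) (fun t => t)), continuous_id. }
  split; apply (H (fun t => _ (f t))); auto.
Qed.

Lemma continuous_inv_cosh t : continuous (fun t => / cosh (PI * t)) t.
Proof.
  apply (ex_derive_continuous (V := R_NormedModule)). unfold cosh. auto_derive.
  generalize (exp_pos (PI * t)) (exp_pos (- (PI * t))). intros. lra.
Qed.

Lemma Pcts_sym_kernel f x t : Ccts f (x, t) -> Ccts f (x, - t) -> Pcts (sym_kernel f x) t.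
Proof.
  intros H1 H2.
  apply (Pcts_ext (fun t => (f (x, t) + f (x, - t)%R) * RtoC (/ cosh (PI * t)))%C).
  - intros s. unfold sym_kernel, Cdiv. rewrite RtoC_inv; auto. generalize (cosh_ge_1 (PI * s)). lra.
  - apply (Pcts_scal_R (fun t => f (x, t) + f (x, - t)%R)%C); [|apply continuous_inv_cosh].
    apply (Pcts_plus (fun t => f (x, t)) (fun t => f (x, - t)%R)).
    + apply Pcts_v; auto.
    + apply (Pcts_reflect (fun t => f (x, t))). apply Pcts_v; auto.
Qed.

(** As [pi >= 2], [cosh (pi t)] is at least [exp (2 t) / 2]: one factor [exp t] pays for the growth
    allowed to [f], the other remains as decay. *)
Lemma exp_over_cosh_bound t : exp t / cosh (PI * t) <= 2 * exp (- t) \/ t < 0.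
Proof.
  destruct (Rlt_dec t 0); auto. left.
  apply Rcomplements.Rle_div_l; [generalize (cosh_ge_1 (PI * t)); lra|].
  assert (H := cosh_ge_exp (PI * t)).
  assert (E : exp t * exp t <= exp (PI * t)).
  { rewrite <- exp_plus. apply exp_le_compat. generalize PI_gt_3. nra. }
  assert (E2 : exp (- t) * exp t = 1) by (rewrite <- exp_plus, Rplus_opp_l; apply exp_0).
  assert (P := exp_pos (- t)). assert (P2 := exp_pos t).
  assert (exp t * exp t * exp (- t) = exp t) by (rewrite Rmult_assoc, (Rmult_comm (exp t) (exp (- t))), E2; ring).
  nra.
Qed.

Lemma Cmod_sym_kernel f x t K : 0 <= t ->
  Cmod (f (x, t)) <= K * exp t -> Cmod (f (x, - t)) <= K * exp t ->
  Cmod (sym_kernel f x t) <= 4 * K * exp (- t).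
Proof.
  intros Ht H1 H2. unfold sym_kernel. rewrite Cmod_div by apply cosh_nz.
  assert (Pc := cosh_ge_1 (PI * t)). rewrite Cmod_R, (Rabs_pos_eq (cosh _)) by lra.
  destruct (exp_over_cosh_bound t) as [B|B]; [|lra].
  assert (HK : 0 <= K).
  { generalize (Cmod_ge_0 (f (x, t))) (exp_pos t). nra. }
  apply Rle_trans with (2 * K * (exp t / cosh (PI * t))).
  - unfold Rdiv. rewrite <- Rmult_assoc. apply Rmult_le_compat_r.
    + left. apply Rinv_0_lt_compat. lra.
    + generalize (Cmod_triangle (f (x, t)) (f (x, - t))). lra.
  - replace (4 * K * exp (- t)) with (2 * K * (2 * exp (- t))) by ring.
    apply Rmult_le_compat_l; lra.
Qed.

Lemma sym_kernel_lim f x K :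
  (forall y, Ccts f (x, y)) -> (forall y, Cmod (f (x, y)) <= K * exp (Rabs y)) ->
  exists l, CIlim (sym_kernel f x) l.
Proof.
  intros HC HB. apply (CIlim_exists _ 1 (4 * K) 0); [lra| |lra|].
  - intros t Ht. apply Pcts_sym_kernel; auto.
  - intros t Ht. rewrite Rmult_1_l. apply Cmod_sym_kernel; auto.
    + generalize (HB t). rewrite Rabs_pos_eq; auto.
    + generalize (HB (- t)). rewrite Rabs_Ropp, Rabs_pos_eq; auto.
Qed.

Lemma Csin_pi_half y : Csin (PI * ((1 / 2)%R, y)) = RtoC (cosh (PI * y)).
Proof.
  replace (RtoC PI * ((1 / 2)%R, y))%C with (PI / 2, PI * y).
  - rewrite Csin_parts, sin_PI2, cos_PI2. apply C_ext; simpl; ring.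
  - apply C_ext; simpl; field.
Qed.

Lemma Csin_pi_mhalf y : Csin (PI * ((- (1 / 2))%R, y)) = (- RtoC (cosh (PI * y)))%C.
Proof.
  replace (RtoC PI * ((- (1 / 2))%R, y))%C with (- (PI / 2), PI * y).
  - rewrite Csin_parts, sin_neg, cos_neg, sin_PI2, cos_PI2. apply C_ext; simpl; ring.
  - apply C_ext; simpl; field.
Qed.

Lemma Csin_pi_nz z : - (1 / 2) <= Re z <= 1 / 2 -> z <> 0 -> Csin (PI * z) <> 0.
Proof.
  destruct z as [x y]. simpl. intros Hx Hz E.
  replace (RtoC PI * (x, y))%C with (PI * x, PI * y) in E by (apply C_ext; simpl; ring).
  rewrite Csin_parts in E.
  assert (E1 := f_equal Re E). assert (E2 := f_equal Im E). simpl in E1, E2.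
  assert (Pi := PI_RGT_0). assert (Pc := cosh_ge_1 (PI * y)).
  assert (Es : sin (PI * x) = 0) by (apply Rmult_integral in E1; destruct E1; lra).
  assert (Hx0 : x = 0).
  { destruct (Rtotal_order x 0) as [L|[L|L]]; auto; exfalso.
    - assert (0 < sin (- (PI * x))) by (apply sin_gt_0; nra). rewrite sin_neg in H. lra.
    - assert (0 < sin (PI * x)) by (apply sin_gt_0; nra). lra. }
  subst x. rewrite Rmult_0_r, cos_0, Rmult_1_l in E2.
  assert (Hy : y <> 0) by (intros ->; auto).
  destruct (Rtotal_order y 0) as [L|[L|L]]; auto.
  - assert (0 < sinh (- (PI * y))) by (apply sinh_pos; nra). rewrite sinh_opp in H. lra.
  - assert (0 < sinh (PI * y)) by (apply sinh_pos; nra). lra.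
Qed.

Lemma rect_vertical_sym (F : C -> C) x Y : 0 <= Y -> (forall y, Ccts F (x, y)) ->
  CI (fun t => F (x, t)) (- Y) Y = CI (fun t => F (x, t) + F (x, - t)%R)%C 0 Y.
Proof.
  intros HY HC.
  assert (I : forall a b, CIex (fun t => F (x, t)) a b).
  { intros a b. apply CIex_Pcts. intros; apply Pcts_v; auto. }
  assert (I' : forall a b, CIex (fun t => F (x, - t)%R) a b).
  { intros a b. apply CIex_Pcts. intros; apply (Pcts_reflect (fun t => F (x, t))), Pcts_v; auto. }
  rewrite <- (CI_Chasles _ _ 0) by auto.
  rewrite (CI_reflect (fun t => F (x, t))) by auto.
  rewrite CI_plus by auto. ring.
Qed.

Lemma Cdiff_Csin_pi z : Cdiff (fun z => Csin (PI * z)) z.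
Proof.
  apply (Cdiff_comp (fun z => PI * z)%C Csin); [|apply Cdiff_Csin].
  apply (Cdiff_mult (fun _ => RtoC PI) (fun z => z)); [apply Cdiff_const | apply Cdiff_id].
Qed.

(** The horizontal sides vanish because [sin (pi z)] grows like [exp (pi |Im z|)], faster than [f].
    The sine has opposite signs on the two vertical sides, which turns the difference in the contour
    integral into the sum [lp + lm]. *)
Lemma strip_rect_lim f K :
  (forall z, - (1 / 2) <= Re z <= 1 / 2 -> Cdiff f z) ->
  (forall z, - (1 / 2) <= Re z <= 1 / 2 -> Cmod (f z) <= K * exp (Rabs (Im z))) ->
  exists lp lm, CIlim (sym_kernel f (1 / 2)) lp /\ CIlim (sym_kernel f (- (1 / 2))) lm /\
    Clim (fun Y => rect (fun z => f z / Csin (PI * z))%C (- (1 / 2)) (1 / 2) (- Y) Y) (Ci * (lp + lm))%C.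
Proof.
  intros Hf HB.
  assert (HC : forall z, - (1 / 2) <= Re z <= 1 / 2 -> Ccts f z) by (intros; apply Cdiff_cts; auto).
  destruct (sym_kernel_lim f (1 / 2) K) as [lp Lp].
  { intros; apply HC; simpl; lra. } { intros y; apply (HB (1 / 2, y)); simpl; lra. }
  destruct (sym_kernel_lim f (- (1 / 2)) K) as [lm Lm].
  { intros; apply HC; simpl; lra. } { intros y; apply (HB (- (1 / 2), y)); simpl; lra. }
  exists lp, lm. split; auto. split; auto.
  set (F := fun z => (f z / Csin (PI * z))%C).
  assert (HFC : forall z, - (1 / 2) <= Re z <= 1 / 2 -> z <> 0 -> Ccts F z).
  { intros z Hz Hn. apply (Ccts_div f (fun z => Csin (PI * z))); auto.
    - apply Cdiff_cts, Cdiff_Csin_pi.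
    - apply Csin_pi_nz; auto. }
  assert (HK : 0 <= K).
  { generalize (Cmod_ge_0 (f 0)) (HB 0 ltac:(simpl; lra)) (exp_pos (Rabs (Im 0))). nra. }
  assert (Hor : forall sg, sg = 1 \/ sg = -1 -> Clim (fun Y => CI (fun t => F (t, sg * Y)) (- (1 / 2)) (1 / 2)) 0).
  { intros sg Hsg. apply (Clim_exp_bound _ 1 (2 * (1 / 2 - - (1 / 2)) * (4 * K))); [lra|]. exists 1. intros Y HY. rewrite Rmult_1_l.
    rewrite (Rmult_assoc _ (4 * K)). apply CI_bound; [lra|..].
    - apply CIex_Pcts_le; [lra|]. intros t Ht. apply Pcts_h, HFC; [simpl; lra|].
      intros E. apply (f_equal Im) in E. simpl in E. destruct Hsg as [->| ->]; lra.
    - intros t Ht. unfold F.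
      replace (RtoC PI * (t, (sg * Y)%R))%C with (PI * t, sg * (PI * Y)) by (apply C_ext; simpl; ring).
      assert (S1 := Cmod_Csin_ge (PI * t) (sg * (PI * Y))).
      assert (Hpi := PI_gt_3).
      assert (S2 : Rabs (sinh (sg * (PI * Y))) = sinh (PI * Y)).
      { assert (0 < sinh (PI * Y)) by (apply sinh_pos; nra).
        destruct Hsg as [->| ->].
        - rewrite Rmult_1_l. apply Rabs_pos_eq; lra.
        - replace (-1 * (PI * Y)) with (- (PI * Y)) by ring. rewrite sinh_opp, Rabs_Ropp.
          apply Rabs_pos_eq; lra. }
      rewrite S2 in S1.
      assert (S3 := sinh_ge_exp (PI * Y) ltac:(nra)).
      assert (S4 := HB (t, sg * Y) ltac:(simpl; lra)). simpl Im in S4.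
      assert (S5 : Rabs (sg * Y) = Y).
      { rewrite Rabs_mult. destruct Hsg as [->| ->].
        - rewrite Rabs_R1, Rabs_pos_eq; lra.
        - rewrite Rabs_left, (Rabs_pos_eq Y); lra. }
      rewrite S5 in S4.
      assert (P1 := exp_pos (PI * Y)).
      rewrite Cmod_div by (apply Cmod_gt_0; lra).
      apply Rcomplements.Rle_div_l; [lra|].
      eapply Rle_trans; [exact S4|].
      apply Rle_trans with (4 * K * exp (- Y) * (exp (PI * Y) / 4)).
      + replace (4 * K * exp (- Y) * (exp (PI * Y) / 4)) with (K * (exp (- Y) * exp (PI * Y))) by field.
        rewrite <- exp_plus. apply Rmult_le_compat_l; auto. apply exp_le_compat. nra.
      + apply Rmult_le_compat_l; [|lra]. generalize (exp_pos (- Y)). nra. }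
  assert (Vert : forall sg x l, (x = 1 / 2 /\ sg = RtoC 1 \/ x = - (1 / 2) /\ sg = RtoC (-1)) ->
     CIlim (sym_kernel f x) l -> Clim (fun Y => CI (fun t => F (x, t)) (- Y) Y) (sg * l)%C).
  { intros sg x l Hx Hl.
    assert (Hxn : - (1 / 2) <= x <= 1 / 2 /\ x <> 0) by (destruct Hx as [[-> _]|[-> _]]; lra).
    apply (Clim_ext (fun Y => CI (fun t => sg * sym_kernel f x t)%C 0 Y)).
    - exists 0. intros Y HY. symmetry. rewrite rect_vertical_sym; auto.
      + apply CI_ext. intros t _. unfold F, sym_kernel.
        destruct Hx as [[-> ->]|[-> ->]].
        * rewrite !Csin_pi_half. replace (PI * - t) with (- (PI * t)) by ring. rewrite cosh_opp.
          field. apply cosh_nz.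
        * rewrite !Csin_pi_mhalf. replace (PI * - t) with (- (PI * t)) by ring. rewrite cosh_opp.
          field. apply cosh_nz.
      + intros y. apply HFC; [simpl; lra|]. intros E. apply (f_equal Re) in E. simpl in E. lra.
    - apply CIlim_scal; auto. intros t Ht. apply Pcts_sym_kernel; apply HC; simpl; lra. }
  unfold rect. fold F.
  replace (Ci * (lp + lm))%C with (0 + Ci * (1 * lp) - 0 - Ci * ((-1) * lm))%C by ring.
  apply (Clim_minus (fun Y => CI (fun t => F (t, - Y)%R) (- (1 / 2)) (1 / 2) +
      Ci * CI (fun t => F ((1 / 2)%R, t)) (- Y) Y - CI (fun t => F (t, Y)) (- (1 / 2)) (1 / 2))%C).
  - apply (Clim_minus (fun Y => CI (fun t => F (t, - Y)%R) (- (1 / 2)) (1 / 2) +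
      Ci * CI (fun t => F ((1 / 2)%R, t)) (- Y) Y)%C).
    + apply (Clim_plus (fun Y => CI (fun t => F (t, - Y)%R) (- (1 / 2)) (1 / 2))).
      * apply (Clim_ext (fun Y => CI (fun t => F (t, -1 * Y)) (- (1 / 2)) (1 / 2))); [|apply Hor; auto].
        exists 0. intros Y _. replace (-1 * Y) with (- Y) by ring. reflexivity.
      * apply Clim_scal. apply Vert; auto.
    + apply (Clim_ext (fun Y => CI (fun t => F (t, 1 * Y)) (- (1 / 2)) (1 / 2))); [|apply Hor; auto].
      exists 0. intros Y _. rewrite Rmult_1_l. reflexivity.
  - apply Clim_scal. apply Vert; auto.
Qed.

Lemma atan_lower x : 0 < x -> PI / 2 - / x <= atan x.
Proof.
  intros Hx. assert (Hi : 0 < / x) by (apply Rinv_0_lt_compat; auto).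
  assert (E := atan_inv x Hx).
  assert (H : atan (/ x) <= / x); [|lra].
  destruct (MVT_gen atan 0 (/ x) (fun t => / (1 + t ^ 2))) as [c [Hc E2]].
  - intros t _. auto_derive; auto. unfold Rsqr. field. apply Rgt_not_eq; generalize (Rle_0_sqr t); unfold Rsqr; intros; nra.
  - intros t _. apply derivable_continuous_pt, derivable_pt_atan.
  - rewrite atan_0 in E2.
    assert (/ (1 + c ^ 2) <= 1).
    { rewrite <- Rinv_1. apply Rinv_le_contravar; nra. }
    nra.
Qed.

(** [(2 / pi) atan (sinh (pi t))] is an antiderivative, and it increases from [0] to [1]. *)
Lemma sech_integral : CIlim (fun t => RtoC (2 / cosh (PI * t))) 1.
Proof.
  assert (E : forall Y, CI (fun t => RtoC (2 / cosh (PI * t))) 0 Y = RtoC (2 / PI * atan (sinh (PI * Y)))).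
  { intros Y. apply C_ext; simpl.
    - apply is_RInt_unique.
      assert (E : 2 / PI * atan (sinh (PI * Y)) = 2 / PI * atan (sinh (PI * Y)) - 2 / PI * atan (sinh (PI * 0))).
      { rewrite Rmult_0_r, sinh_0, atan_0. ring. }
      rewrite E.
      apply (is_RInt_derive (V := R_CompleteNormedModule) (fun t => 2 / PI * atan (sinh (PI * t)))).
      + intros t _. assert (Ec := cosh_sq (PI * t)). assert (P := cosh_ge_1 (PI * t)).
        auto_derive; auto.
        replace (1 + sinh (PI * t) * (sinh (PI * t) * 1)) with (cosh (PI * t) ^ 2) by (rewrite Ec; ring).
        field. generalize PI_RGT_0. split; lra.
      + intros t _. apply (continuous_mult (K := R_AbsRing) (fun _ => 2) (fun t => / cosh (PI * t))).
        * apply continuous_const.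
        * apply continuous_inv_cosh.
    - rewrite (RInt_const (V := R_CompleteNormedModule)). apply Rmult_0_r. }
  intros e He. exists (/ e). intros Y HY.
  assert (Hie : 0 < / e) by (apply Rinv_0_lt_compat; auto).
  assert (Pi := PI_gt_3).
  rewrite E. rewrite <- RtoC_minus, Cmod_R.
  assert (S : 3 * Y <= sinh (PI * Y)).
  { eapply Rle_trans; [|apply sinh_ge]; nra. }
  assert (L := atan_lower (sinh (PI * Y)) ltac:(lra)).
  assert (U := atan_bound (sinh (PI * Y))).
  assert (Ei : / sinh (PI * Y) <= e / 3).
  { replace (e / 3) with (/ (3 * / e)) by (field; lra).
    apply Rinv_le_contravar; lra. }
  set (v := atan (sinh (PI * Y))) in *.
  assert (K : 2 / PI * v - 1 = 2 / PI * (v - PI / 2)) by (field; lra).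
  rewrite K, Rabs_mult, (Rabs_pos_eq (2 / PI)) by (apply Rdiv_le_0_compat; lra).
  assert (H2 : 2 / PI <= 1) by (apply Rcomplements.Rle_div_l; lra).
  assert (H3 : Rabs (v - PI / 2) <= e / 3) by (apply Rabs_le; lra).
  assert (0 <= 2 / PI) by (apply Rdiv_le_0_compat; lra).
  generalize (Rabs_pos (v - PI / 2)). nra.
Qed.

(** The residue theorem at the pole [0], by comparison with a constant function: [rect_simple_pole]
    shows that the contour integral is [f 0] times the one for [f = 1], and there [sech_integral]
    gives [lp = lm = 1]. *)
Lemma kernel_residue f K :
  (forall z, - (1 / 2) <= Re z <= 1 / 2 -> Cdiff f z) ->
  (forall z, - (1 / 2) <= Re z <= 1 / 2 -> Cmod (f z) <= K * exp (Rabs (Im z))) ->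
  exists lp lm, CIlim (sym_kernel f (1 / 2)) lp /\ CIlim (sym_kernel f (- (1 / 2))) lm /\
    (lp + lm = 2 * f 0)%C.
Proof.
  intros Hf HB. destruct (strip_rect_lim f K Hf HB) as [lp [lm [Lp [Lm L]]]].
  exists lp, lm. split; auto. split; auto.
  set (one := fun _ : C => RtoC 1).
  destruct (strip_rect_lim one 1) as [op [om [Op [Om O]]]].
  { intros; apply Cdiff_const. }
  { intros z _. unfold one. rewrite Cmod_1. generalize (exp_ineq1_le (Rabs (Im z))) (Rabs_pos (Im z)). lra. }
  assert (Eo : forall x, CIlim (sym_kernel one x) 1).
  { intros x. apply (CIlim_ext (fun t => RtoC (2 / cosh (PI * t)))); [|apply sech_integral].
    intros t _. unfold sym_kernel, one. rewrite RtoC_div; [|generalize (cosh_ge_1 (PI * t)); lra].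
    f_equal. apply C_ext; simpl; ring. }
  rewrite (Clim_unique _ _ _ Op (Eo _)), (Clim_unique _ _ _ Om (Eo _)) in O.
  assert (E : Clim (fun Y => rect (fun z => f z / Csin (PI * z))%C (- (1 / 2)) (1 / 2) (- Y) Y)
     (f 0 * (Ci * (1 + 1)))%C).
  { apply (Clim_ext (fun Y => f 0 * rect (fun z => one z / Csin (PI * z)) (- (1 / 2)) (1 / 2) (- Y) Y)%C).
    - exists 1. intros Y HY.
      assert (D0 : Cder (fun z => Csin (PI * z)) 0 (RtoC PI)).
      { eapply Cder_val.
        - apply (Cder_comp (fun z => PI * z)%C Csin); [|apply Cder_Csin].
          apply (Cder_scal PI (fun z => z)), Cder_id.
        - rewrite Cmult_0_r. change (RtoC 0) with (0, 0) at 1. rewrite Ccos_parts.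
          rewrite cos_0, cosh_0, sin_0. apply C_ext; simpl; ring. }
      assert (D1 : RtoC PI <> 0) by (intros E; apply RtoC_inj in E; generalize PI_RGT_0; lra).
      assert (D2 : Csin (PI * 0) = 0).
      { rewrite Cmult_0_r. change (RtoC 0) with (0, 0) at 1. rewrite Csin_parts, sin_0, sinh_0.
        apply C_ext; simpl; ring. }
      assert (In : inner_rect (- (1 / 2)) (1 / 2) (- Y) Y 0) by (unfold inner_rect; simpl; lra).
      assert (Hnz : forall z, in_rect (- (1 / 2)) (1 / 2) (- Y) Y z -> z <> 0 -> Csin (PI * z) <> 0).
      { intros z [Hz _] Hn. apply Csin_pi_nz; auto. }
      rewrite (rect_simple_pole f (fun z => Csin (PI * z)) 0 PI); auto.
      + f_equal. apply rect_ext; try lra. intros z _. unfold one, Cdiv. ring.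
      + intros z [Hz _]; auto.
      + intros z _. apply Cdiff_Csin_pi.
    - apply Clim_scal; auto. }
  assert (E2 := Clim_unique _ _ _ L E).
  replace (lp + lm)%C with (- (Ci * (Ci * (lp + lm))))%C.
  2: { apply C_ext; simpl; ring. }
  rewrite E2. apply C_ext; simpl; ring.
Qed.

(** * The alternating zeta function as an integral *)

(* Meaningful only when [CIlim f l] holds for some [l]. *)
Definition HL (f : R -> C) : C :=
  (real (Lim (fun Y => Re (CI f 0 Y)) p_infty), real (Lim (fun Y => Im (CI f 0 Y)) p_infty)).

Lemma HL_correct f l : CIlim f l -> HL f = l.
Proof.
  intros H. apply C_ext.
  - unfold HL, Re at 1, fst. rewrite (is_lim_unique _ _ _ (Clim_Re _ _ H)). reflexivity.
  - unfold HL, Im at 1, snd. rewrite (is_lim_unique _ _ _ (Clim_Im _ _ H)). reflexivity.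
Qed.

(** The shift by [2] also covers [|z| < 1], where [- ln |z| = ln (1 / |z|)] is at most [ln 2]. *)
Lemma Cmod_Clog_le z : 1 / 2 <= Cmod z -> Cmod (Clog z) <= ln (Cmod z + 2) + PI.
Proof.
  intros Hz. eapply Rle_trans; [apply Cmod_le_parts|]. unfold Clog; simpl.
  apply Rplus_le_compat.
  - apply Rabs_le. split.
    + assert (ln (Cmod z + 2) >= ln (/ Cmod z)).
      { apply Rle_ge, Rcomplements.ln_le; [apply Rinv_0_lt_compat; lra|].
        apply Rle_trans with 2; [|lra].
        replace 2 with (/ (1 / 2)) by field. apply Rinv_le_contravar; lra. }
      rewrite ln_Rinv in H; lra.
    + apply Rcomplements.ln_le; lra.
  - apply Rabs_le, Carg_bound.
Qed.

(** From [ln x <= x - 1] at [x = v / N]. It lets a power with any fixed exponent be absorbed by a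
    single [exp v]. *)
Lemma ln_scaled_le N v : 0 < N -> 0 < v -> N * ln v <= v + N * ln N.
Proof.
  intros HN Hv.
  assert (H : ln (v / N) <= v / N - 1).
  { rewrite <- (exp_ln (v / N)) at 2 by (apply Rdiv_lt_0_compat; auto).
    generalize (exp_ineq1_le (ln (v / N))). lra. }
  unfold Rdiv in H. rewrite ln_mult, ln_Rinv in H; auto; [|apply Rinv_0_lt_compat; auto].
  apply (Rmult_le_compat_l N) in H; [|lra].
  replace (N * (v * / N - 1)) with (v - N) in H by (field; lra). lra.
Qed.

(** [A + 2] comes from [|z| + 2 <= A + 2 + |Im z|], [N ln N] from [ln_scaled_le], and [N pi] from
    the bound on the argument. *)
Definition power_const (N A : R) : R := exp (A + 2 + N * ln N + N * PI).

Lemma exp_Clog_bound N A z : 0 < N -> 1 / 2 <= Re z <= A ->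
  exp (N * Cmod (Clog z)) <= power_const N A * exp (Rabs (Im z)).
Proof.
  intros HN Hz.
  assert (H1 : 1 / 2 <= Cmod z).
  { generalize (re_le_Cmod z) (Rle_abs (Re z)). lra. }
  assert (H2 : Cmod z <= A + Rabs (Im z)).
  { generalize (Cmod_le_parts z). rewrite (Rabs_pos_eq (Re z)) by lra. lra. }
  assert (H3 := Cmod_Clog_le z H1).
  assert (H4 := ln_scaled_le N (Cmod z + 2) HN ltac:(lra)).
  unfold power_const. rewrite <- exp_plus. apply exp_le_compat. nra.
Qed.

Lemma Cmod_Cpower_le z s N A : Cmod s <= N -> 0 < N -> 1 / 2 <= Re z <= A ->
  Cmod (Cpower z s) <= power_const N A * exp (Rabs (Im z)).
Proof.
  intros Hs HN Hz. eapply Rle_trans; [|apply (exp_Clog_bound N A z); auto].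
  unfold Cpower. eapply Rle_trans; [apply Cmod_Cexp_le|]. apply exp_le_compat.
  rewrite Cmod_mult. apply Rmult_le_compat_r; [apply Cmod_ge_0 | auto].
Qed.

Lemma Cdiff_Cpower z s : slit z -> Cdiff (fun z => Cpower z s) z.
Proof.
  intros Hz. apply (Cdiff_comp (fun z => s * Clog z)%C Cexp); [|apply Cdiff_Cexp].
  apply (Cdiff_mult (fun _ => s) Clog); [apply Cdiff_const | apply Cdiff_Clog; auto].
Qed.

(* The integral of [z^(-s) / cosh (pi y)] over the whole line [z = a + i y]. *)
Definition Ls (a : R) (s : C) : C := HL (sym_kernel (fun z => Cpower z (- s)) a).

Lemma slit_right z : 0 < Re z -> slit z.
Proof. left; auto. Qed.

Lemma power_kernel_lim a s : 1 / 2 <= a -> CIlim (sym_kernel (fun z => Cpower z (- s)) a) (Ls a s).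
Proof.
  intros Ha.
  destruct (sym_kernel_lim (fun z => Cpower z (- s)) a (power_const (Cmod s + 1) a)) as [l Hl].
  - intros y. apply Cdiff_cts, Cdiff_Cpower, slit_right. simpl; lra.
  - intros y. apply Cmod_Cpower_le; simpl; try lra.
    + rewrite Cmod_opp. lra.
    + generalize (Cmod_ge_0 s). lra.
  - unfold Ls. rewrite (HL_correct _ _ Hl). exact Hl.
Qed.

(** [kernel_residue] for [(m + z)^(-s)], with the pole of the kernel moved to the integer [m]. The
    plus sign on the left is what makes the resulting Dirichlet series alternate. *)
Lemma Ls_step m s : 1 <= m -> (Ls (m + 1 / 2) s + Ls (m - 1 / 2) s = 2 * Cpower (RtoC m) (- s))%C.
Proof.
  intros Hm.
  destruct (kernel_residue (fun z => Cpower (m + z) (- s)) (power_const (Cmod s + 1) (m + 1 / 2)))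
    as [lp [lm [Lp [Lm E]]]].
  - intros z Hz. apply (Cdiff_comp (fun z => m + z)%C (fun z => Cpower z (- s))).
    + apply (Cdiff_plus (fun _ => RtoC m) (fun z => z)); [apply Cdiff_const | apply Cdiff_id].
    + apply Cdiff_Cpower, slit_right. simpl. unfold Re in *. lra.
  - intros z Hz.
    replace (Im z) with (Im (RtoC m + z)) by (unfold Im; simpl; ring).
    apply Cmod_Cpower_le; simpl.
    + rewrite Cmod_opp. lra.
    + generalize (Cmod_ge_0 s). lra.
    + unfold Re in *. lra.
  - rewrite Cplus_0_r in E. rewrite <- E. f_equal.
    + apply (Clim_unique _ _ _ (power_kernel_lim (m + 1 / 2) s ltac:(lra))).
      apply (CIlim_ext (sym_kernel (fun z => Cpower (m + z) (- s)) (1 / 2))); auto.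
      intros t _. unfold sym_kernel. do 2 f_equal; f_equal; apply C_ext; simpl; ring.
    + apply (Clim_unique _ _ _ (power_kernel_lim (m - 1 / 2) s ltac:(lra))).
      apply (CIlim_ext (sym_kernel (fun z => Cpower (m + z) (- s)) (- (1 / 2)))); auto.
      intros t _. unfold sym_kernel. do 2 f_equal; f_equal; apply C_ext; simpl; ring.
Qed.

(** On [Re z = a] the modulus of [z^(-s)] is [|z|^(- Re s) exp (Im s arg z)], at most
    [exp (pi |Im s|) / a]. The decay in [a] removes the remainder of the telescoped sum in
    [Asum_Ls]. *)
Lemma Ls_bound a s : 1 <= a -> 1 <= Re s -> Cmod (Ls a s) <= 8 * (exp (PI * Rabs (Im s)) / a).
Proof.
  intros Ha Hs.
  replace (8 * (exp (PI * Rabs (Im s)) / a)) with (2 * (4 * (exp (PI * Rabs (Im s)) / a))) by ring.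
  assert (HC : forall y, Ccts (fun z => Cpower z (- s)) (a, y)).
  { intros y. apply Cdiff_cts, Cdiff_Cpower, slit_right. simpl; lra. }
  assert (B : forall y, Cmod (Cpower (a, y) (- s)) <= exp (PI * Rabs (Im s)) / a).
  { intros y. unfold Cpower. rewrite Cmod_Cexp. unfold Clog.
    assert (Hm : a <= Cmod (a, y)).
    { generalize (re_le_Cmod (a, y)) (Rle_abs a). simpl. lra. }
    replace (Re (- s * (ln (Cmod (a, y)), Carg (a, y))))
      with (Im s * Carg (a, y) - Re s * ln (Cmod (a, y))) by (unfold Re, Im; simpl; ring).
    apply Rle_trans with (exp (PI * Rabs (Im s) + - ln a)).
    - apply exp_le_compat. apply Rplus_le_compat.
      + eapply Rle_trans; [apply Rle_abs|]. rewrite Rabs_mult, Rmult_comm.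
        apply Rmult_le_compat_r; [apply Rabs_pos|]. apply Rabs_le, Carg_bound.
      + apply Ropp_le_contravar.
        assert (ln a <= ln (Cmod (a, y))) by (apply Rcomplements.ln_le; lra).
        assert (0 <= ln a) by (rewrite <- ln_1; apply Rcomplements.ln_le; lra). nra.
    - rewrite exp_plus, exp_Ropp, exp_ln by lra. lra. }
  apply (CIlim_bound (sym_kernel (fun z => Cpower z (- s)) a)).
  - intros t Ht. apply Pcts_sym_kernel; auto.
  - intros t Ht. assert (E1 : 1 <= exp t) by (generalize (exp_ineq1_le t); lra).
    assert (0 <= exp (PI * Rabs (Im s)) / a).
    { apply Rdiv_le_0_compat; [left; apply exp_pos | lra]. }
    apply Cmod_sym_kernel; auto.
    + generalize (B t). nra.
    + generalize (B (- t)). nra.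
  - apply power_kernel_lim. lra.
Qed.

Definition eta (s : C) : C := (Ls (1 / 2) s / 2)%C.

(** Differentiation under the integral sign. The second-order remainder of [w -> z^(-w)] at [s] is
    at most a constant times [|w - s|^2 exp |y|], uniformly on the line, and the kernel integrates
    this; [D] is the integral with the extra factor [log z]. *)
Lemma Cder_eta s : Cdiff eta s.
Proof.
  assert (Hcts : forall k y, Ccts (fun z => Clog z * Cpower z (- k))%C (1 / 2, y)).
  { intros k y. assert (S : slit (1 / 2, y)) by (apply slit_right; simpl; lra).
    apply (Ccts_mult Clog (fun z => Cpower z (- k))).
    - apply Ccts_Clog; auto.
    - apply Cdiff_cts, Cdiff_Cpower; auto. }
  assert (Hcts' : forall k y, Ccts (fun z => Cpower z (- k)) (1 / 2, y)).
  { intros k y. apply Cdiff_cts, Cdiff_Cpower, slit_right; simpl; lra. }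
  assert (Ht : forall t, 0 <= t -> t <= exp t) by (intros t H; generalize (exp_ineq1_le t); lra).
  (* The exponent collects [|s|] from [z^(-s)], [2] from [|log z|^2], and [1] from [exp |h log z|]
     with [|h| < 1]. *)
  assert (HN : 0 < Cmod s + 3) by (generalize (Cmod_ge_0 s); lra).
  set (K := power_const (Cmod s + 3) (1 / 2)).
  assert (Hlog : forall y, Cmod (Clog (1 / 2, y) * Cpower (1 / 2, y) (- s)) <= K * exp (Rabs y)).
  { intros y. eapply Rle_trans; [|apply (exp_Clog_bound (Cmod s + 3) (1 / 2) (1 / 2, y)); simpl; lra].
    set (L := Clog (1 / 2, y)). rewrite Cmod_mult. unfold Cpower. fold L.
    assert (HL := Cmod_ge_0 L).
    replace ((Cmod s + 3) * Cmod L) with (Cmod L + (Cmod s * Cmod L + 2 * Cmod L)) by ring.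
    rewrite exp_plus. apply Rmult_le_compat; try apply Cmod_ge_0; auto.
    eapply Rle_trans; [apply Cmod_Cexp_le|]. apply exp_le_compat. rewrite Cmod_mult, Cmod_opp. lra. }
  destruct (sym_kernel_lim (fun z => Clog z * Cpower z (- s))%C (1 / 2) K (Hcts s) Hlog) as [D HD].
  exists (- (D / 2))%C. apply Cder_bound. intros e He.
  assert (HK : 0 < K) by apply exp_pos.
  (* The remainder will be at most [32 K |h|^2]: a factor [8] from [BG], [4] from [Cmod_sym_kernel],
     [2] from [CIlim_bound], and [1/2] from the definition of [eta]. *)
  exists (Rmin 1 (e / (32 * K))). split.
  { apply Rmin_glb_lt; [lra|]. apply Rdiv_lt_0_compat; lra. }
  intros w Hw.
  assert (H1 : Cmod (w - s) < 1) by (eapply Rlt_le_trans; [exact Hw | apply Rmin_l]).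
  assert (H2 : Cmod (w - s) < e / (32 * K)) by (eapply Rlt_le_trans; [exact Hw | apply Rmin_r]).
  set (h := (w - s)%C) in *.
  assert (Hmh := Cmod_ge_0 h).
  set (G := fun z => (Cpower z (- w) - Cpower z (- s) + h * (Clog z * Cpower z (- s)))%C).
  assert (EG : forall z, G z = (Cpower z (- s) * (Cexp (- h * Clog z) - 1 - - h * Clog z))%C).
  { intros z. unfold G, Cpower.
    replace (- w * Clog z)%C with (- s * Clog z + - h * Clog z)%C by (unfold h; ring).
    rewrite Cexp_plus. ring. }
  assert (BG : forall y, Cmod (G (1 / 2, y)) <= 8 * Cmod h ^ 2 * K * exp (Rabs y)).
  { intros y. rewrite EG. set (L := Clog (1 / 2, y)).
    assert (HL := Cmod_ge_0 L).
    rewrite Cmod_mult.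
    assert (T := Cexp_taylor1 (- h * L)). rewrite Cmod_mult, Cmod_opp in T.
    assert (B := exp_Clog_bound (Cmod s + 3) (1 / 2) (1 / 2, y) HN ltac:(simpl; lra)).
    simpl Im in B. fold L K in B.
    assert (B1 : Cmod (Cpower (1 / 2, y) (- s)) <= exp (Cmod s * Cmod L)).
    { unfold Cpower. fold L. eapply Rle_trans; [apply Cmod_Cexp_le|].
      rewrite Cmod_mult, Cmod_opp. lra. }
    assert (B2 : Cmod L ^ 2 <= 2 * exp (2 * Cmod L)).
    { replace (2 * Cmod L) with (Cmod L + Cmod L) by ring. rewrite exp_plus.
      generalize (Ht _ HL). nra. }
    assert (B3 : exp (Cmod h * Cmod L) <= exp (Cmod L)) by (apply exp_le_compat; nra).
    assert (B4 : 4 * (Cmod h * Cmod L) ^ 2 * exp (Cmod h * Cmod L)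
       <= 4 * (Cmod h ^ 2 * (2 * exp (2 * Cmod L))) * exp (Cmod L)).
    { apply Rmult_le_compat; auto.
      - generalize (pow2_ge_0 (Cmod h * Cmod L)). lra.
      - left; apply exp_pos.
      - rewrite Rpow_mult_distr. apply Rmult_le_compat_l; [lra|].
        apply Rmult_le_compat_l; auto. apply pow2_ge_0. }
    apply Rle_trans with (exp (Cmod s * Cmod L) * (4 * (Cmod h ^ 2 * (2 * exp (2 * Cmod L))) * exp (Cmod L))).
    - apply Rmult_le_compat; auto; try apply Cmod_ge_0. lra.
    - replace (exp (Cmod s * Cmod L) * (4 * (Cmod h ^ 2 * (2 * exp (2 * Cmod L))) * exp (Cmod L)))
        with (8 * Cmod h ^ 2 * (exp (Cmod s * Cmod L) * exp (2 * Cmod L) * exp (Cmod L))) by ring.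
      rewrite <- !exp_plus, (Rmult_assoc _ K).
      apply Rmult_le_compat_l; [generalize (pow2_ge_0 (Cmod h)); lra|].
      replace (Cmod s * Cmod L + 2 * Cmod L + Cmod L) with ((Cmod s + 3) * Cmod L) by ring.
      exact B. }
  assert (CG : forall y, Ccts G (1 / 2, y)).
  { intros y.
    apply (Ccts_plus (fun z => Cpower z (- w) - Cpower z (- s))%C (fun z => h * (Clog z * Cpower z (- s)))%C).
    - apply (Ccts_minus (fun z => Cpower z (- w)) (fun z => Cpower z (- s))); auto.
    - apply (Ccts_mult (fun _ => h) (fun z => Clog z * Cpower z (- s))%C); auto. apply Ccts_const. }
  assert (LG : CIlim (sym_kernel G (1 / 2)) (Ls (1 / 2) w - Ls (1 / 2) s + h * D)%C).
  { assert (P1 : forall k, half_cts (sym_kernel (fun z => Cpower z (- k)) (1 / 2))).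
    { intros k t _. apply Pcts_sym_kernel; auto. }
    assert (P2 : half_cts (sym_kernel (fun z => Clog z * Cpower z (- s))%C (1 / 2))).
    { intros t _. apply Pcts_sym_kernel; auto. }
    apply (CIlim_ext (fun t => sym_kernel (fun z => Cpower z (- w)) (1 / 2) t
        - sym_kernel (fun z => Cpower z (- s)) (1 / 2) t
        + h * sym_kernel (fun z => Clog z * Cpower z (- s)) (1 / 2) t)%C).
    - intros t _. unfold sym_kernel, G. field. apply cosh_nz.
    - apply (CIlim_plus (fun t => sym_kernel (fun z => Cpower z (- w)) (1 / 2) t
        - sym_kernel (fun z => Cpower z (- s)) (1 / 2) t)%C
        (fun t => h * sym_kernel (fun z => Clog z * Cpower z (- s)) (1 / 2) t)%C).
      + intros t Hp. apply (Pcts_ext (sym_kernel (fun z => Cpower z (- w) - Cpower z (- s))%C (1 / 2))).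
        * intros r. unfold sym_kernel. field. apply cosh_nz.
        * apply Pcts_sym_kernel; apply (Ccts_minus (fun z => Cpower z (- w)) (fun z => Cpower z (- s))); auto.
      + intros t Hp. apply (Pcts_ext (sym_kernel (fun z => h * (Clog z * Cpower z (- s)))%C (1 / 2))).
        * intros r. unfold sym_kernel. field. apply cosh_nz.
        * apply Pcts_sym_kernel; apply (Ccts_mult (fun _ => h) (fun z => Clog z * Cpower z (- s))%C); auto; apply Ccts_const.
      + apply CIlim_minus; auto; apply power_kernel_lim; lra.
      + apply CIlim_scal; auto. }
  assert (B := CIlim_bound (sym_kernel G (1 / 2)) (4 * (8 * Cmod h ^ 2 * K)) _
     (fun t _ => Pcts_sym_kernel _ _ _ (CG t) (CG (- t)))
     (fun t Hp => Cmod_sym_kernel G (1 / 2) t _ Hp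
        (eq_rect (Rabs t) (fun r => Cmod (G (1 / 2, t)) <= 8 * Cmod h ^ 2 * K * exp r) (BG t) t (Rabs_pos_eq t Hp))
        (eq_rect (Rabs (- t)) (fun r => Cmod (G (1 / 2, - t)) <= 8 * Cmod h ^ 2 * K * exp r) (BG (- t)) t
           (eq_trans (Rabs_Ropp t) (Rabs_pos_eq t Hp)))) LG).
  unfold eta.
  replace (Ls (1 / 2) w / 2 - Ls (1 / 2) s / 2 - - (D / 2) * h)%C
    with (/ 2 * (Ls (1 / 2) w - Ls (1 / 2) s + h * D))%C.
  2: { field. }
  rewrite Cmod_mult.
  replace (Cmod (/ 2)) with (/ 2).
  2: { rewrite <- RtoC_inv by lra. rewrite Cmod_R, Rabs_pos_eq; lra. }
  apply Rle_trans with (32 * K * Cmod h * Cmod h); [lra|].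
  apply Rmult_le_compat_r; auto.
  apply (fun P => proj2 (Rcomplements.Rlt_div_r _ _ _ P)) in H2; lra.
Qed.

(** * The alternating Dirichlet series and its relation to zeta *)

Fixpoint Psum (s : C) (n : nat) : C :=
  match n with
  | O => 0
  | S n => (Psum s n + Cpower (RtoC (INR (S n))) (- s))%C
  end.

Fixpoint Asum (s : C) (n : nat) : C :=
  match n with
  | O => 0
  | S n => (Asum s n + (-1) ^ n * Cpower (RtoC (INR (S n))) (- s))%C
  end.

Lemma Psum_sum_n s n :
  sum_n (G := C_NormedModule) (fun k => Cpower (RtoC (INR (S k))) (- s)) n = Psum s (S n).
Proof.
  induction n.
  - rewrite sum_O. cbn [Psum]. symmetry; apply Cplus_0_l.
  - rewrite sum_Sn, IHn. reflexivity.
Qed.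

(** [Ls_step], taken with alternating signs, telescopes. *)
Lemma Asum_Ls s n : (2 * Asum s n = Ls (1 / 2) s - (-1) ^ n * Ls (INR n + 1 / 2) s)%C.
Proof.
  induction n.
  - simpl. rewrite Rplus_0_l. ring.
  - cbn [Asum]. rewrite Cmult_plus_distr_l, IHn.
    assert (E := Ls_step (INR (S n)) s ltac:(rewrite S_INR; generalize (pos_INR n); lra)).
    replace (INR (S n) - 1 / 2) with (INR n + 1 / 2) in E by (rewrite S_INR; lra).
    replace (2 * ((-1) ^ n * Cpower (RtoC (INR (S n))) (- s)))%C
      with ((-1) ^ n * (2 * Cpower (RtoC (INR (S n))) (- s)))%C by ring.
    rewrite <- E. simpl Cpow. ring.
Qed.

Lemma Cpower_RtoC_mult x y s : 0 < x -> 0 < y ->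
  Cpower (RtoC (x * y)) s = (Cpower (RtoC x) s * Cpower (RtoC y) s)%C.
Proof.
  intros Hx Hy. unfold Cpower. rewrite !Clog_RtoC by nra. rewrite <- Cexp_plus. f_equal.
  rewrite ln_mult by auto. rewrite RtoC_plus. ring.
Qed.

(** Subtracting the even-indexed terms twice reverses their sign; they are [2^(-s)] times the first
    [M] terms. *)
Lemma Asum_Psum s M : (Asum s (2 * M) = Psum s (2 * M) - 2 * Cpower 2 (- s) * Psum s M)%C.
Proof.
  induction M.
  - simpl. ring.
  - replace (2 * S M)%nat with (S (S (2 * M))) by lia. cbn [Asum Psum]. rewrite IHM.
    assert (E : (((-1) ^ (2 * M))%C = 1)).
    { rewrite Cpow_mult_r. replace ((-1) ^ 2)%C with (RtoC 1) by ring. apply Cpow_1_l. }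
    replace ((-1) ^ S (2 * M))%C with (-1 * (-1) ^ (2 * M))%C by reflexivity. rewrite E.
    replace (INR (S (S (2 * M)))) with (2 * INR (S M)).
    2: { rewrite !S_INR, mult_INR. simpl. ring. }
    rewrite (Cpower_RtoC_mult 2 (INR (S M))) by (try lra; apply lt_0_INR; lia).
    ring.
Qed.

Lemma Cmod_pow_m1 n : Cmod ((-1) ^ n) = 1.
Proof.
  rewrite Cmod_pow. replace (Cmod (-1)) with 1; [apply pow1|].
  rewrite <- Cmod_m1. f_equal. apply C_ext; simpl; ring.
Qed.

Lemma Asum_eta_bound s n : 1 <= Re s -> (1 <= n)%nat ->
  Cmod (Asum s n - eta s) <= 4 * exp (PI * Rabs (Im s)) / INR n.
Proof.
  intros Hs Hn. assert (HnR : 1 <= INR n) by (apply (le_INR 1); auto).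
  unfold eta.
  replace (Asum s n - Ls (1 / 2) s / 2)%C with (- / 2 * ((-1) ^ n * Ls (INR n + 1 / 2) s))%C.
  2: { replace (Asum s n) with (/ 2 * (2 * Asum s n))%C by field. rewrite Asum_Ls. field. }
  rewrite !Cmod_mult, Cmod_pow_m1, Cmod_opp.
  rewrite <- RtoC_inv by lra. rewrite Cmod_R, Rabs_pos_eq by lra.
  assert (B := Ls_bound (INR n + 1 / 2) s ltac:(lra) Hs).
  assert (P := exp_pos (PI * Rabs (Im s))).
  assert (exp (PI * Rabs (Im s)) / (INR n + 1 / 2) <= exp (PI * Rabs (Im s)) / INR n).
  { apply Rmult_le_compat_l; [lra|]. apply Rinv_le_contravar; lra. }
  unfold Rdiv in *. lra.
Qed.

Lemma eta_zeta_right zeta s : is_Riemann_zeta zeta -> 1 < Re s ->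
  ((1 - 2 * Cpower 2 (- s)) * zeta s = eta s)%C.
Proof.
  intros [_ Hz] Hs. specialize (Hz s Hs).
  assert (HP : forall e, 0 < e -> exists N, forall n, (N <= n)%nat -> Cmod (Psum s n - zeta s) < e).
  { intros e He.
    destruct (proj1 (filterlim_locally_ball_norm (K := C_AbsRing) (U := C_NormedModule) _ _) Hz (mkposreal e He)) as [N HN].
    exists (S N). intros n Hn. destruct n; [lia|].
    specialize (HN n ltac:(lia)). rewrite Psum_sum_n in HN. exact HN. }
  apply Ceq_minus, Cmod_eq_0. apply Rle_antisym; [|apply Cmod_ge_0].
  apply Rnot_lt_le. intros Hpos.
  set (X := ((1 - 2 * Cpower 2 (- s)) * zeta s - eta s)%C) in *.
  set (q := Cmod (2 * Cpower 2 (- s))). assert (Hq : 0 <= q) by apply Cmod_ge_0.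
  set (B := 4 * exp (PI * Rabs (Im s))).
  assert (HB : 0 < B) by (unfold B; generalize (exp_pos (PI * Rabs (Im s))); lra).
  (* [X] is a combination of three errors smaller than [e] with coefficients of modulus [1], [q] and
     [1], so [|X| < (q + 2) e = |X| / 2], a contradiction. *)
  set (e := Cmod X / (2 * (q + 2))).
  assert (He : 0 < e) by (apply Rdiv_lt_0_compat; lra).
  destruct (HP e He) as [N HN].
  destruct (nfloor_ex (B / e)) as [N2 [_ HN2]]; [apply Rdiv_le_0_compat; lra|].
  set (M := (S N + S N2)%nat).
  assert (H1 := HN M ltac:(unfold M; lia)). assert (H2 := HN (2 * M)%nat ltac:(unfold M; lia)).
  assert (H3 := Asum_eta_bound s (2 * M) ltac:(lra) ltac:(unfold M; lia)). fold B in H3.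
  assert (H4 : B / INR (2 * M) < e).
  { assert (Hm : INR N2 + 1 <= INR (2 * M)).
    { rewrite <- S_INR. apply le_INR. unfold M; lia. }
    apply Rcomplements.Rlt_div_l; [generalize (pos_INR N2); lra|].
    assert (B / e < INR (2 * M)) by lra. apply Rcomplements.Rlt_div_l in H; lra. }
  assert (EX : X = (- (Psum s (2 * M) - zeta s) + 2 * Cpower 2 (- s) * (Psum s M - zeta s)
    + (Asum s (2 * M) - eta s))%C) by (unfold X; rewrite Asum_Psum; ring).
  assert (T : Cmod X <= Cmod (Psum s (2 * M) - zeta s) + q * Cmod (Psum s M - zeta s) + Cmod (Asum s (2 * M) - eta s)).
  { rewrite EX. eapply Rle_trans; [apply Cmod_triangle|]. apply Rplus_le_compat_r.
    eapply Rle_trans; [apply Cmod_triangle|]. rewrite Cmod_opp, (Cmod_mult (2 * _)). fold q. lra. }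
  assert (Ee : Cmod X = 2 * (q + 2) * e) by (unfold e; field; lra).
  nra.
Qed.

Theorem eta_zeta zeta t : is_Riemann_zeta zeta -> t <= -1 ->
  ((1 - 2 * Cpower 2 (- RtoC t)) * zeta (RtoC t) = eta (RtoC t))%C.
Proof.
  intros Hz Ht. apply Ceq_minus.
  apply (identity_off_one (fun s => (1 - 2 * Cpower 2 (- s)) * zeta s - eta s)%C); auto.
  - intros z Hn. apply (Cdiff_minus (fun s => (1 - 2 * Cpower 2 (- s)) * zeta s)%C eta); [|apply Cder_eta].
    apply (Cdiff_mult (fun s => 1 - 2 * Cpower 2 (- s))%C zeta).
    + apply (Cdiff_minus (fun _ => RtoC 1) (fun s => 2 * Cpower 2 (- s))%C); [apply Cdiff_const|].
      apply (Cdiff_mult (fun _ => RtoC 2) (fun s => Cpower 2 (- s))); [apply Cdiff_const|].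
      apply (Cdiff_comp (fun s => - s * Clog 2)%C Cexp); [|apply Cdiff_Cexp].
      apply (Cdiff_mult (fun s => - s)%C (fun _ => Clog 2)); [|apply Cdiff_const].
      apply (Cdiff_opp (fun s => s)), Cdiff_id.
    + destruct (proj1 Hz z Hn) as [l Hl]. exists l. apply Cder_of_is_derive; auto.
  - intros s Hs. apply (proj1 (Ceq_minus _ _)). apply (eta_zeta_right zeta s Hz Hs).
Qed.

(** * The alternating zeta function on the negative real axis *)

Lemma Cinv_0 : (/ 0)%C = 0.
Proof. apply C_ext; simpl; unfold Rdiv; ring. Qed.

(* At [w] the quotient is [0], since division by zero gives [0]. *)
Lemma Ccts_quadratic_over_simple g q w k K :
  Cnear w (fun z => Cmod (g z) <= K * Cmod (z - w) ^ 2) -> Cder q w k -> k <> 0 -> q w = 0 ->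
  Ccts (fun z => g z / q z)%C w.
Proof.
  intros Hg [p [Hp [Ep Hq]]] Hk Hqw e He.
  assert (Hk' : 0 < Cmod k) by (apply Cmod_gt_0; auto).
  assert (Hpn := Ccts_near p w (Cmod k / 2) ltac:(lra) Hp).
  destruct (Cnear_and _ _ _ Hg (Cnear_and _ _ _ Hq Hpn)) as [d [Hd H]].
  set (K' := Rabs K + 1). assert (HK' : 0 < K') by (unfold K'; generalize (Rabs_pos K); lra).
  exists (Rmin d (e * (Cmod k / 2) / K')). split.
  { apply Rmin_glb_lt; auto. apply Rdiv_lt_0_compat; nra. }
  intros z Hz. destruct (H z (Rlt_le_trans _ _ _ Hz (Rmin_l _ _))) as [H1 [H2 H3]].
  assert (H4 := Rlt_le_trans _ _ _ Hz (Rmin_r _ _)).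
  rewrite Hqw in H2. rewrite Hqw. unfold Cdiv at 2. rewrite Cinv_0, Cmult_0_r.
  replace (g z / q z - 0)%C with (g z / q z)%C by ring.
  destruct (classic (z = w)) as [->|Hzw].
  { rewrite Hqw. unfold Cdiv. rewrite Cinv_0, Cmult_0_r, Cmod_0; auto. }
  assert (Hm : 0 < Cmod (z - w)) by (apply Cmod_gt_0, Cminus_eq_contra; auto).
  assert (Hpz : Cmod k / 2 < Cmod (p z)).
  { rewrite Ep in H3. generalize (Cmod_sub_ge k (p z)). rewrite Cmod_sub_sym. lra. }
  assert (Hqz : q z = (p z * (z - w))%C) by (rewrite H2; ring).
  rewrite Hqz, Cmod_div, Cmod_mult.
  2: { apply Cmult_neq_0; [apply Cmod_gt_0; lra | apply Cminus_eq_contra; auto]. }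
  apply Rcomplements.Rlt_div_l; [apply Rmult_lt_0_compat; lra|].
  apply Rle_lt_trans with (K' * Cmod (z - w) ^ 2).
  - eapply Rle_trans; [exact H1|]. apply Rmult_le_compat_r; [apply pow2_ge_0|].
    unfold K'. generalize (Rle_abs K). lra.
  - apply (fun P => proj2 (Rcomplements.Rlt_div_r _ _ _ P)) in H4; auto.
    assert (H5 : Cmod (z - w) * K' < e * Cmod (p z)).
    { assert (e * (Cmod k / 2) < e * Cmod (p z)) by (apply Rmult_lt_compat_l; auto). lra. }
    apply (Rmult_lt_compat_l (Cmod (z - w))) in H5; auto. lra.
Qed.

Lemma Cmod_Cpower_R (z : C) r : z <> 0 -> Cmod (Cpower z (RtoC r)) = Rpower (Cmod z) r.
Proof.
  intros Hz. unfold Cpower, Rpower. rewrite Cmod_Cexp. f_equal. unfold Clog, Re; simpl. ring.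
Qed.

Lemma Cpower_conj z r : slit z -> Cpower (Cconj z) (RtoC r) = Cconj (Cpower z (RtoC r)).
Proof.
  intros Hz. unfold Cpower. rewrite Clog_conj, <- Cexp_conj by auto. f_equal.
  apply C_ext; simpl; ring.
Qed.

Lemma CI_RtoC (h : R -> R) a b : CI (fun t => RtoC (h t)) a b = RtoC (RInt h a b).
Proof.
  apply C_ext; simpl; [reflexivity|].
  rewrite (RInt_const (V := R_CompleteNormedModule)). apply Rmult_0_r.
Qed.

Lemma CIlim_RtoC h m : CIlim (fun t => RtoC (h t)) m ->
  m = RtoC (Re m) /\ is_lim (fun Y => RInt h 0 Y) p_infty (Re m).
Proof.
  intros H. split.
  - apply C_ext; [reflexivity|]. simpl.
    assert (L := Clim_Im _ _ H).
    assert (L0 : is_lim (fun _ => 0) p_infty (Im m)).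
    { apply (is_lim_ext (fun Y => Im (CI (fun t => RtoC (h t)) 0 Y))); auto.
      intros Y. rewrite CI_RtoC. reflexivity. }
    apply is_lim_unique in L0. rewrite Lim_const in L0. injection L0. auto.
  - apply (is_lim_ext (fun Y => Re (CI (fun t => RtoC (h t)) 0 Y))); [|apply Clim_Re; auto].
    intros Y. rewrite CI_RtoC. reflexivity.
Qed.

Lemma Clog_I t : 0 < t -> Clog (0, t) = (ln t, PI / 2).
Proof.
  intros Ht. apply Clog_unique.
  - simpl. generalize PI_RGT_0. lra.
  - unfold Cexp; simpl. rewrite exp_ln, cos_PI2, sin_PI2 by auto. apply C_ext; simpl; ring.
Qed.

Lemma Rpower_le_exp x r : 0 < x -> 0 < r -> Rpower x r <= exp (r * ln r) * exp x.
Proof.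
  intros Hx Hr. unfold Rpower. rewrite <- exp_plus. apply exp_le_compat.
  generalize (ln_scaled_le r x Hr Hx). lra.
Qed.

Lemma Rpower_le_sq x r : 0 < x <= 1 -> 2 <= r -> Rpower x r <= x ^ 2.
Proof.
  intros Hx Hr. rewrite <- Rpower_pow by lra. unfold Rpower. apply exp_le_compat.
  assert (ln x <= 0) by (rewrite <- ln_1; apply Rcomplements.ln_le; lra).
  simpl INR. nra.
Qed.

Lemma Cnear_Cpower_sq r : 2 <= r -> Cnear 0 (fun z : C => z <> 0 -> Cmod (Cpower z (RtoC r)) <= Cmod z ^ 2).
Proof.
  intros Hr. exists 1. split; [lra|]. intros z Hz Hn.
  replace (z - 0)%C with z in Hz by ring.
  rewrite (Cmod_Cpower_R z r Hn).
  apply Rpower_le_sq; auto. split; [apply Cmod_gt_0; auto | lra].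
Qed.

Section EtaNegative.
Variable r : R.
Hypothesis Hr : 2 <= r.

(** [Cpower] is meaningless at the branch point [0], so the numerator gets its limit [0] there. As
    [r >= 2], the quotient by the simple zero of the sine is then continuous at [0]. *)
Let f (z : C) : C := ((if Ceq_dec z 0 then 0 else Cpower z (RtoC r)) / Csin (PI * z))%C.

Lemma eta_integrand_nz (z : C) : z <> 0 -> f z = (Cpower z (RtoC r) / Csin (PI * z))%C.
Proof. intros Hz. unfold f. destruct Ceq_dec; tauto. Qed.

Lemma eta_integrand_cts0 : Ccts f 0.
Proof.
  apply (Ccts_quadratic_over_simple _ (fun z => Csin (PI * z)) 0 PI 1).
  - apply (Cnear_imp _ _ _) with (2 := Cnear_Cpower_sq r Hr). intros z Hz.
    replace (z - 0)%C with z by ring. rewrite Rmult_1_l.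
    destruct Ceq_dec as [->|Hn]; auto. rewrite Cmod_0. lra.
  - eapply Cder_val.
    + apply (Cder_comp (fun z => PI * z)%C Csin); [|apply Cder_Csin].
      apply (Cder_scal PI (fun z => z)), Cder_id.
    + rewrite Cmult_0_r. change (RtoC 0) with (0, 0) at 1. rewrite Ccos_parts.
      rewrite cos_0, cosh_0, sin_0. apply C_ext; simpl; ring.
  - intros E; apply RtoC_inj in E; generalize PI_RGT_0; lra.
  - rewrite Cmult_0_r. change (RtoC 0) with (0, 0) at 1. rewrite Csin_parts, sin_0, sinh_0.
    apply C_ext; simpl; ring.
Qed.

Lemma eta_integrand_diff (z : C) : 0 <= Re z <= 1 / 2 -> 0 <= Im z -> z <> 0 -> Cdiff f z.
Proof.
  intros H1 H2 Hz.
  apply (Cdiff_ext_near (fun z => Cpower z (RtoC r) / Csin (PI * z))%C).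
  - apply (Cnear_imp _ _ _) with (2 := Ccts_nz_near _ _ (Ccts_id z) Hz).
    intros w Hw. symmetry. apply eta_integrand_nz; auto.
  - apply (Cdiff_div (fun z => Cpower z (RtoC r)) (fun z => Csin (PI * z))).
    + apply Cdiff_Cpower. unfold slit. destruct (Req_dec (Im z) 0) as [E|E]; [left|right; auto].
      destruct (Req_dec (Re z) 0) as [E'|E']; [|lra].
      exfalso. apply Hz, C_ext; auto.
    + apply Cdiff_Csin_pi.
    + apply Csin_pi_nz; auto. lra.
Qed.

Lemma eta_integrand_bound z : 0 <= Re z <= 1 / 2 -> 1 <= Im z ->
  Cmod (f z) <= 4 * (exp (r * ln r) * exp (1 / 2)) * exp (- Im z).
Proof.
  intros H1 H2. assert (Hn : z <> 0) by (intros ->; simpl in H2; lra).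
  assert (Hm : 0 < Cmod z) by (apply Cmod_gt_0; auto).
  rewrite eta_integrand_nz by auto.
  destruct z as [x y]. simpl in H1, H2. simpl Im.
  assert (Pi := PI_gt_3).
  assert (S : Rabs (sinh (PI * y)) <= Cmod (Csin (PI * (x, y)))).
  { replace (RtoC PI * (x, y))%C with (PI * x, PI * y) by (apply C_ext; simpl; ring).
    apply Cmod_Csin_ge. }
  rewrite Rabs_pos_eq in S by (left; apply sinh_pos; nra).
  assert (S2 := sinh_ge_exp (PI * y) ltac:(nra)).
  assert (P := exp_pos (PI * y)).
  rewrite Cmod_div by (apply Cmod_gt_0; lra).
  apply Rcomplements.Rle_div_l; [lra|].
  rewrite Cmod_Cpower_R by auto.
  eapply Rle_trans; [apply Rpower_le_exp; lra|].
  apply Rle_trans with (4 * (exp (r * ln r) * exp (1 / 2)) * exp (- y) * (exp (PI * y) / 4)).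
  - replace (4 * (exp (r * ln r) * exp (1 / 2)) * exp (- y) * (exp (PI * y) / 4))
      with (exp (r * ln r) * (exp (1 / 2) * exp (- y) * exp (PI * y))) by field.
    apply Rmult_le_compat_l; [left; apply exp_pos|]. rewrite <- !exp_plus. apply exp_le_compat.
    generalize (Cmod_le_parts (x, y)). simpl. rewrite !Rabs_pos_eq by lra. nra.
  - apply Rmult_le_compat_l; [|lra].
    generalize (exp_pos (r * ln r)) (exp_pos (1 / 2)) (exp_pos (- y)). intros.
    repeat apply Rmult_le_pos; lra.
Qed.

(** Conjugation symmetry makes [eta] the real part of the integral over the upper half of
    [Re z = 1/2]. Moving this half-line to the imaginary axis leaves the real part unchanged,
    because the integrand is real on [[0, 1/2]]; there it is [- i exp (i pi r / 2)] times the real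
    function [t^r / sinh (pi t)]. *)
Theorem eta_neg : exists T : R,
  (forall Y, 0 <= Y -> ex_RInt (fun t => Rpower t r / sinh (PI * t)) 0 Y) /\
  is_lim (fun Y => RInt (fun t => Rpower t r / sinh (PI * t)) 0 Y) p_infty T /\
  eta (RtoC (- r)) = RtoC (sin (r * (PI / 2)) * T).
Proof.
  destruct (half_strip_shift f 0 0 (1 / 2) 1 (4 * (exp (r * ln r) * exp (1 / 2))) 1)
    as [la [lb [La [Lb E]]]]; [lra | lra | lra | apply eta_integrand_cts0 | | |].
  { intros z H1 H2 H3. apply eta_integrand_diff; auto. }
  { intros z H1 H2. rewrite Rmult_1_l. apply eta_integrand_bound; auto. }
  assert (HC : forall x, 0 <= x <= 1 / 2 -> half_cts (fun t => f (x, t))).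
  { intros x Hx t Ht. apply Pcts_v. destruct (classic ((x, t) = RtoC 0)) as [->|Hn].
    - apply eta_integrand_cts0.
    - apply Cdiff_cts, eta_integrand_diff; auto. }
  (* [c] is the inverse of the constant phase of [f] on the positive imaginary axis. *)
  set (c := (Ci * Cexp (0, (- (r * (PI / 2)))%R))%C).
  assert (Hc : forall t, 0 < t -> (c * f (0, t))%C = RtoC (Rpower t r / sinh (PI * t))).
  { intros t Ht. rewrite eta_integrand_nz.
    2: { intros E0. apply (f_equal Im) in E0. simpl in E0. lra. }
    assert (S := sinh_pos (PI * t) ltac:(generalize PI_RGT_0; nra)).
    replace (RtoC PI * (0, t))%C with (0, PI * t) by (apply C_ext; simpl; ring).
    rewrite Csin_parts, sin_0, cos_0.
    unfold Cpower. rewrite Clog_I by auto.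
    replace (0 * cosh (PI * t), 1 * sinh (PI * t)) with (Ci * RtoC (sinh (PI * t)))%C
      by (apply C_ext; simpl; ring).
    assert (Hs : RtoC (sinh (PI * t)) <> 0) by (intros E1; apply RtoC_inj in E1; lra).
    unfold c. rewrite RtoC_div by lra.
    replace (Ci * Cexp (0, (- (r * (PI / 2)))%R) * (Cexp (r * (ln t, (PI / 2)%R)) / (Ci * sinh (PI * t))))%C
      with (Cexp (0, (- (r * (PI / 2)))%R) * Cexp (r * (ln t, (PI / 2)%R)) / sinh (PI * t))%C
      by (field; split; auto; apply Ci_nz).
    rewrite <- Cexp_plus. f_equal.
    replace ((0, (- (r * (PI / 2)))%R) + r * (ln t, (PI / 2)%R))%C with (RtoC (r * ln t)) by (apply C_ext; simpl; ring).
    rewrite Cexp_RtoC. reflexivity. }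
  assert (L : CIlim (fun t => RtoC (Rpower t r / sinh (PI * t))) (c * la)%C).
  { apply (CIlim_ext (fun t => c * f (0%R, t))%C); auto.
    apply CIlim_scal; auto. apply HC; lra. }
  destruct (CIlim_RtoC _ _ L) as [Em Lm].
  exists (Re (c * la)%C). split; [|split; auto].
  - intros Y HY.
    assert (X : CIex (fun t => RtoC (Rpower t r / sinh (PI * t))) 0 Y).
    { apply (CIex_ext (fun t => c * f (0%R, t))%C).
      - rewrite Rmin_left by auto. intros t Ht. apply Hc; lra.
      - apply CIex_scal. apply half_cts_CIex; [apply HC; lra | lra]. }
    apply X.
  - assert (Ela : la = (Cexp (0, (r * (PI / 2))%R) / Ci * RtoC (Re (c * la)%C))%C).
    { rewrite <- Em. unfold c.
      replace (Cexp (0, (r * (PI / 2))%R) / Ci * (Ci * Cexp (0, (- (r * (PI / 2)))%R) * la))%C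
        with (Cexp (0, (r * (PI / 2))%R) * Cexp (0, (- (r * (PI / 2)))%R) * la)%C by (field; apply Ci_nz).
      rewrite <- Cexp_plus.
      replace ((0, (r * (PI / 2))%R) + (0, (- (r * (PI / 2)))%R))%C with (RtoC 0) by (apply C_ext; simpl; ring).
      rewrite Cexp_0. ring. }
    set (T := Re (c * la)%C) in *.
    assert (R1 : Re la = sin (r * (PI / 2)) * T).
    { rewrite Ela. unfold Cexp; simpl. rewrite exp_0. field. }
    assert (R2 : Re lb = Re la).
    { assert (Hreal : Im (CI (fun t => f (t, 0%R)) 0 (1 / 2)) = 0).
      { rewrite CI_Im. transitivity (RInt (fun _ => 0) 0 (1 / 2)).
        - apply RInt_ext. rewrite Rmin_left, Rmax_right by lra. intros t Ht.
          rewrite eta_integrand_nz.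
          2: { intros E0. apply (f_equal Re) in E0. simpl in E0. lra. }
          assert (S : 0 < sin (PI * t)) by (apply sin_gt_0; generalize PI_RGT_0; nra).
          change (t, 0) with (RtoC t).
          unfold Cpower. rewrite Clog_RtoC, <- RtoC_mult, Cexp_RtoC by lra.
          rewrite <- RtoC_mult. unfold RtoC at 2. rewrite Csin_parts, sinh_0, cosh_0.
          simpl. field. lra.
        - rewrite (RInt_const (V := R_CompleteNormedModule)). apply Rmult_0_r. }
      apply (f_equal Im) in E. rewrite im_plus, Hreal in E. simpl in E. unfold Re. lra. }
    unfold eta.
    assert (EL : Ls (1 / 2) (RtoC (- r)) = (lb + Cconj lb)%C).
    { apply (Clim_unique _ _ _ (power_kernel_lim (1 / 2) _ ltac:(lra))).
      assert (Hh := HC (1 / 2) ltac:(lra)).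
      apply (CIlim_ext (fun t => f ((1 / 2)%R, t) + Cconj (f ((1 / 2)%R, t)))%C).
      - intros t Ht. unfold sym_kernel.
        assert (Hn : ((1 / 2)%R, t) <> RtoC 0).
        { intros E0. apply (f_equal Re) in E0. simpl in E0. lra. }
        rewrite eta_integrand_nz by auto.
        replace (- RtoC (- r))%C with (RtoC r) by (rewrite RtoC_opp; ring).
        change ((1 / 2)%R, (- t)%R) with (Cconj ((1 / 2)%R, t)).
        rewrite Cpower_conj by (apply slit_right; simpl; lra).
        rewrite Csin_pi_half, Cdiv_conj by apply cosh_nz.
        replace (Cconj (RtoC (cosh (PI * t)))) with (RtoC (cosh (PI * t))) by (apply C_ext; simpl; ring).
        field. apply cosh_nz.
      - apply (CIlim_plus (fun t => f ((1 / 2)%R, t)) (fun t => Cconj (f ((1 / 2)%R, t)))); auto.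
        + intros t Ht. destruct (Hh t Ht) as [F1 F2]. split; simpl; auto.
          apply (continuous_opp (V := R_NormedModule) (fun t => Im (f ((1 / 2)%R, t)))); auto.
        + apply CIlim_conj; auto. }
    rewrite EL, <- R1, <- R2. apply C_ext; unfold Re, Im; simpl; field.
Qed.
End EtaNegative.

(** * Deforming the contour of D* onto the branch cut *)

Lemma Cder_Ccos z : Cder Ccos z (- Csin z)%C.
Proof.
  assert (H1 : Cder (fun z => Ci * z)%C z Ci).
  { eapply Cder_val; [apply (Cder_scal Ci (fun z => z)), Cder_id | ring]. }
  assert (H2 := Cder_opp _ _ _ H1).
  assert (K1 := Cder_comp _ Cexp z _ _ H1 (Cder_Cexp _)).
  assert (K2 := Cder_comp _ Cexp z _ _ H2 (Cder_Cexp _)).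
  apply (Cder_ext_near (fun z => / 2 * (Cexp (Ci * z) + Cexp (- (Ci * z))))%C).
  - apply Cnear_all. intros w. unfold Ccos, Cdiv. ring.
  - eapply Cder_val; [apply (Cder_scal (/ 2)%C), (Cder_plus _ _ _ _ _ K1 K2)|].
    unfold Csin.
    transitivity ((Ci * Ci) * ((Cexp (Ci * z) - Cexp (- (Ci * z))) / (2 * Ci)))%C.
    + field. apply Ci_nz.
    + replace (Ci * Ci)%C with (- RtoC 1)%C by (apply C_ext; simpl; ring). ring.
Qed.

Definition Fnum (z : C) : C := (- (4 * RtoC (sqrt 3) * Ccos z))%C.
Definition Fden (z : C) : C := (1 + 2 * Ccos (2 * z))%C.

Lemma F_quotient z : F z = (Fnum z / Fden z)%C.
Proof. reflexivity. Qed.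

Lemma Fden_parts x y : Fden (x, y) = (1 + 2 * (cos (2 * x) * cosh (2 * y)), - (2 * (sin (2 * x) * sinh (2 * y)))).
Proof.
  unfold Fden. replace (2 * (x, y))%C with (2 * x, 2 * y) by (apply C_ext; simpl; ring).
  rewrite Ccos_parts. apply C_ext; simpl; ring.
Qed.

Lemma Fnum_parts x y : Fnum (x, y) = (- (4 * sqrt 3 * (cos x * cosh y)), 4 * sqrt 3 * (sin x * sinh y)).
Proof. unfold Fnum. rewrite Ccos_parts. apply C_ext; simpl; ring. Qed.

Lemma Cder_Fden z : Cder Fden z (- 4 * Csin (2 * z))%C.
Proof.
  eapply Cder_val.
  - apply (Cder_plus (fun _ => RtoC 1) (fun z => 2 * Ccos (2 * z))%C); [apply Cder_const|].
    apply (Cder_scal 2 (fun z => Ccos (2 * z))).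
    apply (Cder_comp (fun z => 2 * z)%C Ccos); [|apply Cder_Ccos].
    apply (Cder_scal 2 (fun z => z)), Cder_id.
  - simpl. ring.
Qed.

Lemma Cdiff_Fnum z : Cdiff Fnum z.
Proof.
  apply (Cdiff_opp (fun z => 4 * RtoC (sqrt 3) * Ccos z)%C).
  apply (Cdiff_mult (fun _ => 4 * RtoC (sqrt 3))%C Ccos); [apply Cdiff_const|].
  eexists; apply Cder_Ccos.
Qed.

Lemma cos_2PI3 : cos (2 * (PI / 3)) = - (1 / 2).
Proof. rewrite cos_2a_cos, cos_PI3. field. Qed.

Lemma Fden_zero : Fden (RtoC (PI / 3)) = 0.
Proof.
  unfold RtoC at 1. rewrite Fden_parts, cos_2PI3, Rmult_0_r, cosh_0, sinh_0.
  apply C_ext; simpl; field.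
Qed.

(** Off the real axis the imaginary part forces [x = 0] or [x = pi/2], where the real part
    [1 + 2 cosh (2 y)] or [1 - 2 cosh (2 y)] is not zero. On the axis [cos] is injective in [|2 x|],
    which lies in [[0, pi]]. *)
Lemma Fden_nz z : - (PI / 3) < Re z <= PI / 2 -> z <> RtoC (PI / 3) -> Fden z <> 0.
Proof.
  destruct z as [x y]. simpl. intros Hx Hz E. rewrite Fden_parts in E.
  assert (E1 := f_equal Re E). assert (E2 := f_equal Im E). simpl in E1, E2.
  assert (Pi := PI_gt_3). assert (Pc := cosh_ge_1 (2 * y)).
  destruct (Req_dec y 0) as [->|Hy].
  - rewrite Rmult_0_r, cosh_0 in E1.
    assert (Ec : cos (2 * x) = cos (2 * (PI / 3))) by (rewrite cos_2PI3; lra).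
    assert (Hc : cos (Rabs (2 * x)) = cos (2 * (PI / 3))).
    { rewrite <- Ec. unfold Rabs. destruct Rcase_abs; auto. apply cos_neg. }
    assert (Hb : 0 <= Rabs (2 * x) <= PI) by (split; [apply Rabs_pos | apply Rabs_le; lra]).
    assert (Hr : Rabs (2 * x) = 2 * (PI / 3)).
    { apply cos_inj; lra. }
    apply Hz. apply C_ext; simpl; auto. unfold Rabs in Hr. destruct Rcase_abs; lra.
  - assert (Hs : sinh (2 * y) <> 0).
    { destruct (Rdichotomy _ _ Hy).
      - assert (0 < sinh (- (2 * y))) by (apply sinh_pos; lra). rewrite sinh_opp in H0. lra.
      - assert (0 < sinh (2 * y)) by (apply sinh_pos; lra). lra. }
    assert (Hsin : sin (2 * x) = 0).
    { assert (E3 : sin (2 * x) * sinh (2 * y) = 0) by lra. apply Rmult_integral in E3. tauto. }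
    assert (Hx' : x = 0 \/ x = PI / 2).
    { destruct (Rtotal_order x 0) as [L|[L|L]]; auto; [exfalso|].
      - assert (0 < sin (- (2 * x))) by (apply sin_gt_0; lra). rewrite sin_neg in H. lra.
      - destruct (proj2 Hx) as [L'|L']; auto. exfalso.
        assert (0 < sin (2 * x)) by (apply sin_gt_0; lra). lra. }
    destruct Hx' as [-> | ->].
    + rewrite Rmult_0_r, cos_0 in E1. lra.
    + replace (2 * (PI / 2)) with PI in E1 by field. rewrite cos_PI in E1. lra.
Qed.

Lemma Cmod_Ccos_bounds x y : Rabs (sinh y) <= Cmod (Ccos (x, y)) <= cosh y.
Proof.
  rewrite Ccos_parts. unfold Cmod; simpl fst; simpl snd.
  assert (E := cosh_sq y). assert (E2 := sin2_cos2 x). unfold Rsqr in E2.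
  assert (H := Rle_0_sqr (cos x)). unfold Rsqr in H.
  assert (H' := Rle_0_sqr (sin x)). unfold Rsqr in H'.
  assert (EM : (cos x * cosh y) ^ 2 + (- (sin x * sinh y)) ^ 2 = cos x * cos x + sinh y ^ 2).
  { replace ((cos x * cosh y) ^ 2 + (- (sin x * sinh y)) ^ 2)
      with (cos x * cos x * cosh y ^ 2 + sin x * sin x * sinh y ^ 2) by ring.
    rewrite E. replace (sin x * sin x) with (1 - cos x * cos x) by lra. ring. }
  rewrite EM. split.
  - rewrite <- sqrt_Rsqr_abs. apply sqrt_le_1_alt. unfold Rsqr. lra.
  - rewrite <- (sqrt_Rsqr (cosh y)) by (generalize (cosh_ge_1 y); lra).
    apply sqrt_le_1_alt. unfold Rsqr. lra.
Qed.

(** The numerator is at most [8 exp y] and the denominator at least [exp (2 y) / 4]. *)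
Lemma Cmod_F_le z : 1 <= Im z -> Cmod (F z) <= 32 * exp (- Im z).
Proof.
  destruct z as [x y]. simpl. intros Hy. rewrite F_quotient.
  assert (B1 := proj2 (Cmod_Ccos_bounds x y)).
  assert (B2 := proj1 (Cmod_Ccos_bounds (2 * x) (2 * y))).
  rewrite Rabs_pos_eq in B2 by (left; apply sinh_pos; lra).
  assert (B3 := sinh_ge_exp (2 * y) ltac:(lra)).
  assert (E2 : exp (2 * y) = exp y * exp y) by (rewrite <- exp_plus; f_equal; ring).
  assert (E1 : exp (- y) * exp y = 1) by (rewrite <- exp_plus, Rplus_opp_l; apply exp_0).
  assert (X2 : 2 <= exp y) by (generalize (exp_ineq1_le y); lra).
  assert (D : exp (2 * y) / 4 <= Cmod (Fden (x, y))).
  { unfold Fden. replace (2 * (x, y))%C with (2 * x, 2 * y) by (apply C_ext; simpl; ring).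
    replace (1 + 2 * Ccos ((2 * x)%R, (2 * y)%R))%C with (2 * Ccos ((2 * x)%R, (2 * y)%R) - (- RtoC 1))%C by ring.
    eapply Rle_trans; [|apply Cmod_sub_ge].
    rewrite Cmod_mult, Cmod_opp, Cmod_1, Cmod_R, Rabs_pos_eq by lra.
    assert (X4 : 4 <= exp (2 * y)) by nra. lra. }
  assert (N : Cmod (Fnum (x, y)) <= 8 * exp y).
  { unfold Fnum. rewrite Cmod_opp, !Cmod_mult, !Cmod_R, (Rabs_pos_eq 4) by lra.
    assert (S : sqrt 3 <= 2).
    { rewrite <- (sqrt_Rsqr 2) by lra. apply sqrt_le_1_alt. unfold Rsqr; lra. }
    assert (S' := sqrt_pos 3). rewrite (Rabs_pos_eq (sqrt 3)) by auto.
    assert (Hc : cosh y <= exp y).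
    { unfold cosh. assert (exp (- y) <= exp y) by (apply exp_le_compat; lra). lra. }
    assert (Hc0 := Cmod_ge_0 (Ccos (x, y))).
    apply Rle_trans with (4 * 2 * exp y); [|lra].
    apply Rmult_le_compat; nra. }
  assert (P2 := exp_pos (2 * y)).
  rewrite Cmod_div by (apply Cmod_gt_0; lra).
  apply Rcomplements.Rle_div_l; [lra|].
  eapply Rle_trans; [exact N|].
  apply Rle_trans with (32 * exp (- y) * (exp (2 * y) / 4)).
  - rewrite E2. right.
    replace (32 * exp (- y) * (exp y * exp y / 4)) with (8 * (exp (- y) * exp y) * exp y) by field.
    rewrite E1. ring.
  - apply Rmult_le_compat_l; [generalize (exp_pos (- y)); lra | lra].
Qed.

(* A holomorphic branch of [log (u z)] on the closed upper half of the strip: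
   [u z = k (pi/3 - z) (2 pi/3 - z)] with both factors turned by [Ci] into
   the right half-plane. *)
Definition ucoef : R := 3 / (2 * PI ^ 2).
Definition fac1 (z : C) : C := (Ci * (RtoC (PI / 3) - z))%C.
Definition fac2 (z : C) : C := (Ci * (RtoC (2 * PI / 3) - z))%C.
Definition Ulog (z : C) : C := (RtoC (ln ucoef) + Clog (fac1 z) + Clog (fac2 z) - (0, PI))%C.

Lemma ucoef_pos : 0 < ucoef.
Proof. unfold ucoef. generalize PI_gt_3. intros. apply Rdiv_lt_0_compat; nra. Qed.

Lemma u_fac z : u z = (RtoC ucoef * fac1 z * fac2 z * (-1))%C.
Proof.
  unfold u, fac1, fac2, ucoef. assert (Pi := PI_gt_3).
  assert (HP : RtoC PI <> 0) by (intros E; apply RtoC_inj in E; lra).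
  rewrite !RtoC_div, !RtoC_mult, RtoC_pow by (try lra; apply Rgt_not_eq; nra).
  replace (Ci * (PI / 3 - z))%C with (Ci * ((PI - 3 * z) / 3))%C by field.
  replace (Ci * (2 * PI / 3 - z))%C with (Ci * ((2 * PI - 3 * z) / 3))%C by field.
  replace (3 / (2 * PI ^ 2) * (Ci * ((PI - 3 * z) / 3)) * (Ci * ((2 * PI - 3 * z) / 3)) * -1)%C
    with (- (Ci * Ci) * ((PI - 3 * z) * (2 * PI - 3 * z) / (6 * PI ^ 2)))%C by (field; auto).
  replace (Ci * Ci)%C with (- RtoC 1)%C by (apply C_ext; simpl; ring). ring.
Qed.

Lemma fac1_parts x y : fac1 (x, y) = (y, PI / 3 - x).
Proof. unfold fac1. apply C_ext; simpl; ring. Qed.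

Lemma fac2_parts x y : fac2 (x, y) = (y, 2 * PI / 3 - x).
Proof. unfold fac2. apply C_ext; simpl; ring. Qed.

Lemma fac1_slit z : 0 <= Im z -> z <> RtoC (PI / 3) -> slit (fac1 z).
Proof.
  destruct z as [x y]. simpl. intros Hy Hz. rewrite fac1_parts. unfold slit; simpl.
  destruct Hy as [Hy|Hy]; [left; auto|right]. intros E. apply Hz. apply C_ext; simpl; lra.
Qed.

Lemma fac2_slit z : Re z <= PI / 2 -> slit (fac2 z).
Proof.
  destruct z as [x y]. simpl. intros Hx. rewrite fac2_parts. right; simpl.
  generalize PI_gt_3. lra.
Qed.

Lemma Cexp_Ulog z : 0 <= Im z -> Re z <= PI / 2 -> z <> RtoC (PI / 3) -> Cexp (Ulog z) = u z.
Proof.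
  intros H1 H2 H3. unfold Ulog, Cminus. rewrite !Cexp_plus, Cexp_RtoC, exp_ln by apply ucoef_pos.
  rewrite !Cexp_Clog by (apply slit_nz; [apply fac1_slit || apply fac2_slit]; auto).
  rewrite u_fac. f_equal. unfold Cexp. simpl. rewrite Ropp_0, exp_0, cos_neg, sin_neg, cos_PI, sin_PI.
  apply C_ext; simpl; ring.
Qed.

Lemma Cdiff_Ulog z : 0 <= Im z -> Re z <= PI / 2 -> z <> RtoC (PI / 3) -> Cdiff Ulog z.
Proof.
  intros H1 H2 H3.
  assert (Hf : forall c : C, Cdiff (fun z => Ci * (c - z))%C z).
  { intros c. apply (Cdiff_mult (fun _ => Ci) (fun z => c - z)%C); [apply Cdiff_const|].
    apply (Cdiff_minus (fun _ => c) (fun z => z)); [apply Cdiff_const | apply Cdiff_id]. }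
  apply (Cdiff_minus (fun z => RtoC (ln ucoef) + Clog (fac1 z) + Clog (fac2 z))%C (fun _ => (0, PI))); [|apply Cdiff_const].
  apply (Cdiff_plus (fun z => RtoC (ln ucoef) + Clog (fac1 z))%C (fun z => Clog (fac2 z))).
  - apply (Cdiff_plus (fun _ => RtoC (ln ucoef)) (fun z => Clog (fac1 z))); [apply Cdiff_const|].
    apply (Cdiff_comp fac1 Clog); [apply Hf | apply Cdiff_Clog, fac1_slit; auto].
  - apply (Cdiff_comp fac2 Clog); [apply Hf | apply Cdiff_Clog, fac2_slit; auto].
Qed.

Lemma Carg_upper z : 0 < Im z -> 0 < Carg z < PI.
Proof.
  intros H. assert (Hn : z <> 0) by (intros ->; simpl in H; lra).
  assert (Hm : 0 < Cmod z) by (apply Cmod_gt_0; auto).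
  destruct (Carg_polar z Hn) as [_ E]. assert (B := Carg_gt z Hn).
  assert (B2 := proj2 (Carg_bound z)).
  assert (S : 0 < sin (Carg z)).
  { apply Rmult_lt_reg_l with (Cmod z); auto. rewrite E. lra. }
  split.
  - apply Rnot_le_lt. intros L. assert (0 <= sin (- Carg z)) by (apply sin_ge_0; lra).
    rewrite sin_neg in H0. lra.
  - destruct B2 as [B2|B2]; auto. rewrite B2, sin_PI in S. lra.
Qed.

Lemma Carg_first_quadrant z : 0 <= Re z -> 0 < Im z -> 0 < Carg z <= PI / 2.
Proof.
  intros H1 H2. assert (B := Carg_upper z H2). split; [lra|].
  assert (Hn : z <> 0) by (intros ->; simpl in H2; lra).
  assert (Hm : 0 < Cmod z) by (apply Cmod_gt_0; auto).
  destruct (Carg_polar z Hn) as [E _].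
  apply Rnot_lt_le. intros L. assert (cos (Carg z) < 0) by (apply cos_lt_0; lra). nra.
Qed.

(* To the left of [pi/3] the branch is the principal one. *)
Lemma Clog_u z : 0 <= Im z -> Re z < PI / 3 -> Clog (u z) = Ulog z.
Proof.
  intros H1 H2. assert (Pi := PI_gt_3).
  apply Clog_unique.
  - destruct z as [x y]. simpl in H1, H2. unfold Ulog. rewrite fac1_parts, fac2_parts.
    (* Both arguments lie in [(0, pi/2]], so their sum minus [pi] lies in [(-pi, 0]], inside the
       principal range. *)
    assert (B1 := Carg_first_quadrant (y, PI / 3 - x) ltac:(simpl; lra) ltac:(simpl; lra)).
    assert (B2 := Carg_first_quadrant (y, 2 * PI / 3 - x) ltac:(simpl; lra) ltac:(simpl; lra)).
    unfold Clog; simpl. lra.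
  - apply Cexp_Ulog; auto; [lra|]. intros ->. simpl in H2. lra.
Qed.

Lemma Cmod_fac1 z : Cmod (fac1 z) = Cmod (z - RtoC (PI / 3)).
Proof. unfold fac1. rewrite Cmod_mult, Cmod_Ci, Rmult_1_l. apply Cmod_sub_sym. Qed.

Lemma Cmod_fac2 z : Cmod (fac2 z) = Cmod (z - RtoC (2 * PI / 3)).
Proof. unfold fac2. rewrite Cmod_mult, Cmod_Ci, Rmult_1_l. apply Cmod_sub_sym. Qed.

Lemma F_conj z : Fden z <> 0 -> F (Cconj z) = Cconj (F z).
Proof.
  intros H. rewrite !F_quotient, Cdiv_conj by auto. destruct z as [x y].
  unfold Cconj at 1 2; simpl. rewrite !Fnum_parts, !Fden_parts.
  replace (2 * - y) with (- (2 * y)) by ring. rewrite !cosh_opp, !sinh_opp.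
  f_equal; [|f_equal]; apply C_ext; simpl; ring.
Qed.

Lemma u_parts x y : u (x, y) =
  ((9 * (x ^ 2 - y ^ 2) - 9 * PI * x + 2 * PI ^ 2) / (6 * PI ^ 2), 9 * y * (2 * x - PI) / (6 * PI ^ 2)).
Proof.
  unfold u. assert (Pi := PI_gt_3).
  rewrite <- RtoC_pow, <- !RtoC_mult. unfold Cdiv. rewrite <- RtoC_inv by (apply Rgt_not_eq; nra).
  apply C_ext; simpl; field; lra.
Qed.

Lemma u_conj z : u (Cconj z) = Cconj (u z).
Proof.
  destruct z as [x y]. unfold Cconj at 1; simpl. rewrite !u_parts.
  apply C_ext; simpl; unfold Rdiv; ring.
Qed.

Lemma u_slit x y : x < PI / 3 -> slit (u (x, y)).
Proof.
  intros Hx. rewrite u_parts. assert (Pi := PI_gt_3).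
  assert (P6 : 0 < / (6 * PI ^ 2)) by (apply Rinv_0_lt_compat; nra).
  destruct (Req_dec y 0) as [->|Hy].
  - left. simpl. apply Rmult_lt_0_compat; [|simpl in P6; auto].
    assert (0 < (PI - 3 * x) * (2 * PI - 3 * x)) by (apply Rmult_lt_0_compat; lra). lra.
  - right. simpl. unfold Rdiv. apply Rmult_integral_contrapositive; split.
    + apply Rmult_integral_contrapositive; split; lra.
    + simpl in P6. lra.
Qed.

(** The two ends move independently, so the integral is split at [0] and each half is brought within
    [eps / 2] of its own limit. *)
Lemma is_RInt_gen_of_halves (h : R -> C) lp lm : (forall t, Pcts h t) ->
  CIlim h lp -> CIlim (fun t => h (- t)) lm ->
  is_RInt_gen (V := C_R_NormedModule) h (Rbar_locally m_infty) (Rbar_locally p_infty) (lm + lp)%C.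
Proof.
  intros Hh Lp Lm P [eps HP].
  assert (I : forall a b, CIex h a b) by (intros; apply CIex_Pcts; auto).
  destruct (Lp (eps / 2)) as [Y1 H1]; [generalize (cond_pos eps); lra|].
  destruct (Lm (eps / 2)) as [Y2 H2]; [generalize (cond_pos eps); lra|].
  apply (Filter_prod _ _ _ (fun x => x < - Rmax 0 Y2) (fun y => Rmax 0 Y1 < y)).
  - exists (- Rmax 0 Y2). auto.
  - exists (Rmax 0 Y1). auto.
  - intros a b Ha Hb. exists (CI h a b). split.
    + apply (is_RInt_fct_extend_pair (U := R_NormedModule) (V := R_NormedModule));
        apply (RInt_correct (V := R_CompleteNormedModule)); apply (I a b).
    + apply HP.
      assert (B : Cmod (CI h a b - (lm + lp)) < eps).
      { rewrite <- (CI_Chasles h a 0 b) by auto.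
        replace a with (- - a) at 1 by ring. rewrite CI_reflect by auto.
        assert (K1 := H1 b ltac:(generalize (Rmax_r 0 Y1); lra)).
        assert (K2 := H2 (- a) ltac:(generalize (Rmax_r 0 Y2); lra)).
        replace (CI (fun t => h (- t)%R) 0 (- a) + CI h 0 b - (lm + lp))%C
          with ((CI (fun t => h (- t)%R) 0 (- a) - lm) + (CI h 0 b - lp))%C by ring.
        eapply Rle_lt_trans; [apply Cmod_triangle | lra]. }
      split.
      * eapply Rle_lt_trans; [|exact B]. apply (re_le_Cmod (CI h a b - (lm + lp))).
      * eapply Rle_lt_trans; [|exact B]. apply (im_le_Cmod (CI h a b - (lm + lp))).
Qed.

Section DstarFormula.
Variables sigma c : R.
Hypothesis Hsigma : 2 <= sigma.
Hypothesis Hc : - (PI / 3) < c < PI / 3.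

Let p3 : C := RtoC (PI / 3).
Let g (z : C) : C := Cexp (RtoC sigma * Ulog z).
(** [F z] times the branch [g] of [u^sigma]. At the branch point [p3], which is also a zero of
    [Fden], the numerator gets its limit [0]. *)
Let f (z : C) : C := ((if Ceq_dec z p3 then 0 else Fnum z * g z) / Fden z)%C.

Lemma branch_nz (z : C) : z <> p3 -> f z = (F z * g z)%C.
Proof.
  intros Hz. unfold f. destruct Ceq_dec; [tauto|]. rewrite F_quotient. unfold Cdiv. ring.
Qed.

Lemma Cmod_g z : Cmod (g z) =
  Rpower ucoef sigma * (Rpower (Cmod (fac1 z)) sigma * Rpower (Cmod (fac2 z)) sigma).
Proof.
  unfold g. rewrite Cmod_Cexp. unfold Rpower. rewrite <- !exp_plus. f_equal.
  unfold Ulog, Clog, Re; simpl. ring.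
Qed.

Lemma Rpower_nonneg x y : 0 <= Rpower x y.
Proof. left; apply exp_pos. Qed.

(** This is why the pole of [F] leaves no residue: as [sigma >= 2], the factor [|fac1|^sigma] is at
    most [|z - pi/3|^2] near [p3], against a simple zero of [Fden]. The [4] bounds the distance to
    the other zero [2 pi / 3] of [u]. *)
Lemma branch_cts_p3 : Ccts f p3.
Proof.
  set (K := (Cmod (Fnum p3) + 1) * (Rpower ucoef sigma * Rpower 4 sigma)).
  assert (Pi := PI_gt_3). assert (Pi4 := PI_4).
  apply (Ccts_quadratic_over_simple _ Fden p3 (- 4 * Csin (2 * p3))%C K).
  - assert (HF := Ccts_near Fnum p3 1 ltac:(lra) (Cdiff_cts _ _ (Cdiff_Fnum p3))).
    assert (H1 : Cnear p3 (fun z => Cmod (z - p3) < 1)) by (exists 1; split; [lra | auto]).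
    apply (Cnear_imp _ _ _) with (2 := Cnear_and _ _ _ HF H1).
    intros z [Z1 Z2]. destruct Ceq_dec as [->|Hn].
    + rewrite Cmod_0. unfold K.
      apply Rmult_le_pos; [|apply pow2_ge_0].
      apply Rmult_le_pos; [generalize (Cmod_ge_0 (Fnum p3)); lra|].
      apply Rmult_le_pos; apply Rpower_nonneg.
    + assert (Hm : 0 < Cmod (z - p3)) by (apply Cmod_gt_0, Cminus_eq_contra; auto).
      rewrite Cmod_mult, Cmod_g, Cmod_fac1, Cmod_fac2. fold p3.
      assert (N1 : Cmod (Fnum z) <= Cmod (Fnum p3) + 1).
      { generalize (Cmod_sub_ge (Fnum z) (Fnum p3)). lra. }
      assert (N2 : Rpower (Cmod (z - p3)) sigma <= Cmod (z - p3) ^ 2) by (apply Rpower_le_sq; lra).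
      assert (Eq : (z - RtoC (2 * PI / 3) = (z - p3) - RtoC (PI / 3))%C).
      { unfold p3. replace (2 * PI / 3) with (PI / 3 + PI / 3) by field. rewrite RtoC_plus. ring. }
      assert (M1 : 0 < Cmod (z - RtoC (2 * PI / 3)) <= 4).
      { rewrite Eq. split.
        - rewrite Cmod_sub_sym. generalize (Cmod_sub_ge (RtoC (PI / 3)) (z - p3)).
          rewrite Cmod_R, Rabs_pos_eq by lra. lra.
        - generalize (Cmod_sub_triangle (z - p3) (RtoC (PI / 3))).
          rewrite Cmod_R, Rabs_pos_eq by lra. lra. }
      assert (N3 : Rpower (Cmod (z - RtoC (2 * PI / 3))) sigma <= Rpower 4 sigma).
      { apply Rle_Rpower_l; lra. }
      unfold K.
      replace ((Cmod (Fnum p3) + 1) * (Rpower ucoef sigma * Rpower 4 sigma) * Cmod (z - p3) ^ 2)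
        with ((Cmod (Fnum p3) + 1) * (Rpower ucoef sigma * (Cmod (z - p3) ^ 2 * Rpower 4 sigma))) by ring.
      apply Rmult_le_compat; auto; [apply Cmod_ge_0| |].
      * repeat apply Rmult_le_pos; apply Rpower_nonneg.
      * apply Rmult_le_compat_l; [apply Rpower_nonneg|].
        apply Rmult_le_compat; auto; apply Rpower_nonneg.
  - apply Cder_Fden.
  - unfold p3. rewrite <- RtoC_mult. unfold RtoC at 2. rewrite Csin_parts, cosh_0, sinh_0.
    intros E. apply (f_equal Re) in E. simpl in E.
    assert (0 < sin (2 * (PI / 3))) by (apply sin_gt_0; lra). lra.
  - apply Fden_zero.
Qed.

Lemma branch_diff (z : C) : c <= Re z <= PI / 2 -> 0 <= Im z -> z <> p3 -> Cdiff f z.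
Proof.
  intros H1 H2 Hz.
  apply (Cdiff_ext_near (fun z => Fnum z * g z / Fden z)%C).
  - assert (N : Cnear z (fun w => (w - p3)%C <> 0)).
    { apply (Ccts_nz_near (fun w => w - p3)%C); [|apply Cminus_eq_contra; auto].
      apply (Ccts_minus (fun w => w) (fun _ => p3)); [apply Ccts_id | apply Ccts_const]. }
    apply (Cnear_imp _ _ _) with (2 := N). intros w Hw. unfold f.
    destruct Ceq_dec as [->|]; auto. exfalso. apply Hw. ring.
  - apply (Cdiff_div (fun z => Fnum z * g z)%C Fden).
    + apply (Cdiff_mult Fnum g); [apply Cdiff_Fnum|].
      apply (Cdiff_comp (fun z => RtoC sigma * Ulog z)%C Cexp); [|apply Cdiff_Cexp].
      apply (Cdiff_mult (fun _ => RtoC sigma) Ulog); [apply Cdiff_const|].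
      apply Cdiff_Ulog; auto; lra.
    + eexists; apply Cder_Fden.
    + apply Fden_nz; auto. lra.
Qed.

(** [ln_scaled_le] is applied to [v / 4] so that each of the two factors of [u^sigma] costs only
    [exp (y / 4)]; half of the decay [exp (- y)] of [F] then survives in [branch_bound]. *)
Lemma Rpower_le_shifted v y : 0 < v <= y + 4 ->
  Rpower v sigma <= exp (sigma * ln 4 + sigma * ln sigma + 1) * exp (y / 4).
Proof.
  intros Hv. unfold Rpower. rewrite <- exp_plus. apply exp_le_compat.
  assert (H := ln_scaled_le sigma (v / 4) ltac:(lra) ltac:(lra)).
  unfold Rdiv in H at 1. rewrite ln_mult, ln_Rinv in H by lra. lra.
Qed.

Lemma branch_bound (z : C) : c <= Re z <= PI / 2 -> 1 <= Im z ->
  Cmod (f z) <= 32 * (Rpower ucoef sigma * exp (sigma * ln 4 + sigma * ln sigma + 1) ^ 2) * exp (- (1 / 2 * Im z)).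
Proof.
  intros H1 H2. assert (Pi := PI_gt_3). assert (Pi4 := PI_4).
  assert (Hn : z <> p3) by (intros ->; simpl in H2; lra).
  rewrite branch_nz, Cmod_mult, Cmod_g by auto.
  assert (B := Cmod_F_le z H2).
  assert (D : forall a : R, 0 <= a <= 2 * PI / 3 -> 0 < Cmod (z - RtoC a) <= Im z + 4).
  { intros a Ha. destruct z as [x y]. simpl in H1, H2. simpl Im.
    replace ((x, y) - RtoC a)%C with (x - a, y) by (apply C_ext; simpl; ring). split.
    - apply Cmod_gt_0. intros E. apply (f_equal Im) in E. simpl in E. lra.
    - eapply Rle_trans; [apply Cmod_le_parts|]. simpl. rewrite (Rabs_pos_eq y) by lra.
      assert (Rabs (x - a) <= 4) by (apply Rabs_le; lra). lra. }
  assert (N1 := Rpower_le_shifted _ _ (D (PI / 3) ltac:(lra))).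
  assert (N2 := Rpower_le_shifted _ _ (D (2 * PI / 3) ltac:(lra))).
  rewrite Cmod_fac1, Cmod_fac2.
  set (E := exp (sigma * ln 4 + sigma * ln sigma + 1)) in *.
  assert (PE : 0 < E) by apply exp_pos.
  set (y := Im z) in *.
  assert (Ee : exp (- y) * (exp (y / 4) * exp (y / 4)) = exp (- (1 / 2 * y))).
  { rewrite <- !exp_plus. f_equal. field. }
  rewrite <- Ee.
  replace (32 * (Rpower ucoef sigma * E ^ 2) * (exp (- y) * (exp (y / 4) * exp (y / 4))))
    with (32 * exp (- y) * (Rpower ucoef sigma * ((E * exp (y / 4)) * (E * exp (y / 4))))) by ring.
  apply Rmult_le_compat; auto; [apply Cmod_ge_0| |].
  - repeat apply Rmult_le_pos; apply Rpower_nonneg.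
  - apply Rmult_le_compat_l; [apply Rpower_nonneg|].
    apply Rmult_le_compat; auto; apply Rpower_nonneg.
Qed.

(** ** The segment from pi/3 to pi/2 *)

(** Both on [(pi/3, pi/2]] and on the upper half of [Re z = pi/2] the value of [u] is a negative
    real, and the branch [Ulog] gives it the argument [-pi]; thus [/ rot] is the phase of [g]
    there. *)
Let rot : C := Cexp (0, PI * sigma).

Lemma g_segment t : PI / 3 < t <= PI / 2 ->
  g (t, 0) = (RtoC (Rpower ucoef sigma * Rpower ((t - PI / 3) * (2 * PI / 3 - t)) sigma) * / rot)%C.
Proof.
  intros Ht. assert (Pi := PI_gt_3).
  assert (E : Ulog (t, 0) = (RtoC (ln ucoef + ln ((t - PI / 3) * (2 * PI / 3 - t))) - (0, PI))%C).
  { unfold Ulog. rewrite fac1_parts, fac2_parts.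
    replace (Clog (0, PI / 3 - t)) with (Cconj (Clog (0, t - PI / 3))).
    2: { rewrite <- Clog_conj by (right; simpl; lra). unfold Cconj; simpl. f_equal.
         apply C_ext; simpl; ring. }
    rewrite !Clog_I, ln_mult by lra. apply C_ext; simpl; ring. }
  unfold g, rot. rewrite E, <- Cexp_opp.
  unfold Rpower. rewrite <- exp_plus, <- Cexp_RtoC, <- Cexp_plus. f_equal.
  apply C_ext; simpl; ring.
Qed.

Lemma F_real t : F (t, 0) = RtoC (- (4 * sqrt 3 * cos t) / (1 + 2 * cos (2 * t))).
Proof.
  rewrite F_quotient, Fnum_parts, Fden_parts, Rmult_0_r, cosh_0, sinh_0.
  destruct (Req_dec (1 + 2 * cos (2 * t)) 0) as [E|E].
  - rewrite E. unfold Rdiv. rewrite Rinv_0, Rmult_0_r.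
    replace (1 + 2 * (cos (2 * t) * 1), - (2 * (sin (2 * t) * 0))) with (RtoC 0).
    + unfold Cdiv. rewrite Cinv_0. rewrite Cmult_0_r. f_equal; ring.
    + apply C_ext; simpl; lra.
  - rewrite RtoC_div by auto.
    f_equal; [|f_equal]; apply C_ext; simpl; ring.
Qed.

(** With [q = t - pi/3], the pole of [F] costs at most [8 / q], and the factor [q] of [u]
    compensates it. Relative to [ucoef^sigma] the segment thus stays bounded in [sigma], whereas the
    integral along the vertical edge grows. *)
Lemma segment_integral : exists B : R, Rabs B <= 32 * Rpower ucoef sigma /\
  CI (fun t => f (t, 0)) (PI / 3) (PI / 2) = (RtoC B * / rot)%C.
Proof.
  assert (Pi := PI_gt_3). assert (Pi4 := PI_4).
  assert (HC : forall t, PI / 3 <= t <= PI / 2 -> Pcts (fun t => f (t, 0)) t).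
  { intros t Ht. apply Pcts_h. destruct (classic ((t, 0) = p3)) as [->|Hn].
    - apply branch_cts_p3.
    - apply Cdiff_cts, branch_diff; auto; simpl; lra. }
  assert (HI : CIex (fun t => f (t, 0)) (PI / 3) (PI / 2)) by (apply CIex_Pcts_le; auto; lra).
  assert (Hnz : forall t, PI / 3 < t -> (t, 0) <> p3).
  { intros t Ht E. apply (f_equal Re) in E. simpl in E. lra. }
  set (b := fun t => - (4 * sqrt 3 * cos t) / (1 + 2 * cos (2 * t)) *
      (Rpower ucoef sigma * Rpower ((t - PI / 3) * (2 * PI / 3 - t)) sigma)).
  assert (Hb : forall t, PI / 3 < t <= PI / 2 -> f (t, 0) = (RtoC (b t) * / rot)%C).
  { intros t Ht. rewrite branch_nz by (apply Hnz; lra). rewrite g_segment, F_real by auto.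
    unfold b. rewrite Cmult_assoc, <- RtoC_mult. reflexivity. }
  assert (Hrot : rot <> 0) by apply Cexp_nz.
  assert (Erot : Cmod rot = 1) by (unfold rot; rewrite Cmod_Cexp; simpl; apply exp_0).
  exists (RInt b (PI / 3) (PI / 2)).
  assert (EX : CI (fun t => f (t, 0)) (PI / 3) (PI / 2) = (RtoC (RInt b (PI / 3) (PI / 2)) * / rot)%C).
  { rewrite <- CI_RtoC.
    rewrite (CI_ext (fun t => RtoC (b t)) (fun t => rot * f (t, 0))%C).
    - rewrite CI_scal by auto. field. auto.
    - rewrite Rmin_left, Rmax_right by lra. intros t Ht. rewrite Hb by lra. field. auto. }
  split; auto.
  replace (Rabs (RInt b (PI / 3) (PI / 2))) with (Cmod (CI (fun t => f (t, 0)) (PI / 3) (PI / 2))).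
  2: { rewrite EX, Cmod_mult, Cmod_inv, Erot, Cmod_R by auto. field. }
  apply Rle_trans with (2 * (PI / 2 - PI / 3) * (16 * Rpower ucoef sigma)).
  2: { assert (P := Rpower_nonneg ucoef sigma). nra. }
  apply CI_bound; auto; [lra|]. intros t Ht.
  assert (P := Rpower_nonneg ucoef sigma).
  destruct (Req_dec t (PI / 3)) as [->|Hn].
  { unfold f. destruct Ceq_dec as [_|H]; [|exfalso; apply H; reflexivity].
    unfold Cdiv. rewrite Cmult_0_l, Cmod_0. lra. }
  rewrite Hb by lra. rewrite Cmod_mult, Cmod_inv, Erot, Cmod_R by auto.
  rewrite Rinv_1, Rmult_1_r. unfold b.
  set (q := t - PI / 3). set (v := 2 * PI / 3 - t).
  assert (Hq : 0 < q <= 1) by (unfold q; lra). assert (Hv : 0 < v <= 2) by (unfold v; lra).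
  assert (Hqv : q * v <= 1).
  { assert (q <= PI / 6) by (unfold q; lra). assert (v = PI / 3 - q) by (unfold v, q; lra). nra. }
  assert (Hcos : 0 <= cos t) by (apply cos_ge_0; lra).
  assert (Hcos2 : cos t <= 1 / 2 - q / 2).
  { destruct (MVT_gen cos (PI / 3) t (fun x => - sin x)) as [x [Hx E]].
    - intros x _. auto_derive; auto. ring.
    - intros x _. apply derivable_continuous_pt, derivable_pt_cos.
    - rewrite Rmin_left, Rmax_right in Hx by lra. rewrite cos_PI3 in E. fold q in E.
      assert (1 / 2 <= sin x).
      { rewrite <- sin_PI6. apply sin_incr_1; lra. }
      nra. }
  assert (Eden : 1 + 2 * cos (2 * t) = - ((1 - 2 * cos t) * (1 + 2 * cos t))).
  { rewrite cos_2a_cos. ring. }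
  assert (HF : Rabs (- (4 * sqrt 3 * cos t) / (1 + 2 * cos (2 * t))) <= 8 / q).
  { assert (S : sqrt 3 <= 2).
    { rewrite <- (sqrt_Rsqr 2) by lra. apply sqrt_le_1_alt. unfold Rsqr; lra. }
    assert (S' := sqrt_pos 3).
    rewrite Eden.
    replace (- (4 * sqrt 3 * cos t) / - ((1 - 2 * cos t) * (1 + 2 * cos t)))
      with (4 * sqrt 3 * cos t / ((1 - 2 * cos t) * (1 + 2 * cos t))) by (field; lra).
    assert (Hd : q <= (1 - 2 * cos t) * (1 + 2 * cos t)) by nra.
    rewrite Rabs_pos_eq by (apply Rdiv_le_0_compat; [repeat apply Rmult_le_pos; lra | lra]).
    unfold Rdiv. apply Rmult_le_compat.
    - repeat apply Rmult_le_pos; lra.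
    - left; apply Rinv_0_lt_compat; lra.
    - nra.
    - apply Rinv_le_contravar; lra. }
  assert (HR : Rpower (q * v) sigma <= q * v).
  { assert (Hqv0 : 0 < q * v) by (apply Rmult_lt_0_compat; lra). revert Hqv Hqv0.
    generalize (q * v). intros w W1 W0.
    apply Rle_trans with (w ^ 2); [apply Rpower_le_sq; lra | nra]. }
  rewrite !Rabs_mult, (Rabs_pos_eq (Rpower _ _)), (Rabs_pos_eq (Rpower (q * v) sigma)) by apply Rpower_nonneg.
  apply Rle_trans with (8 / q * (Rpower ucoef sigma * (q * v))).
  - apply Rmult_le_compat; auto; [apply Rabs_pos | |].
    + apply Rmult_le_pos; apply Rpower_nonneg.
    + apply Rmult_le_compat_l; auto.
  - replace (8 / q * (Rpower ucoef sigma * (q * v))) with (8 * v * Rpower ucoef sigma) by (field; lra).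
    apply Rmult_le_compat_r; lra.
Qed.

(** ** The vertical edge of the cut *)

(** [F (pi/2 + i t) = - i sqrt 3 * cut_density t]; the denominator comes from
    [1 - 2 cosh (2 t) = - (1 + 4 sinh^2 t)]. *)
Definition cut_density (t : R) : R := 4 * sinh t / (1 + 4 * sinh t ^ 2).

Lemma branch_on_cut t : 0 < t ->
  f (PI / 2, t) = (RtoC (sqrt 3 * Rpower ucoef sigma * (cut_density t * Rpower (t ^ 2 + PI ^ 2 / 36) sigma))
                   * - (Ci * / rot))%C.
Proof.
  intros Ht. assert (Pi := PI_gt_3).
  assert (Hn : (PI / 2, t) <> p3) by (intros E; apply (f_equal Im) in E; simpl in E; lra).
  rewrite branch_nz by auto.
  assert (E1 : Ulog (PI / 2, t) = (RtoC (ln ucoef + ln (t ^ 2 + PI ^ 2 / 36)) - (0, PI))%C).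
  { unfold Ulog. rewrite fac1_parts, fac2_parts.
    replace (PI / 3 - PI / 2) with (- (PI / 6)) by field.
    replace (2 * PI / 3 - PI / 2) with (PI / 6) by field.
    (* On the line [Re z = pi/2] the two factors are conjugate, so their arguments cancel and only
       the [-pi] in [Ulog] remains. *)
    change (t, - (PI / 6)) with (Cconj (t, PI / 6)).
    rewrite Clog_conj by (left; simpl; lra).
    assert (E : 2 * ln (Cmod (t, PI / 6)) = ln (t ^ 2 + PI ^ 2 / 36)).
    { unfold Cmod; simpl fst; simpl snd.
      replace (t ^ 2 + (PI / 6) ^ 2) with (t ^ 2 + PI ^ 2 / 36) by field.
      assert (P : 0 < t ^ 2 + PI ^ 2 / 36) by nra.
      assert (Q : 0 < sqrt (t ^ 2 + PI ^ 2 / 36)) by (apply sqrt_lt_R0; auto).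
      rewrite <- (sqrt_sqrt (t ^ 2 + PI ^ 2 / 36)) at 2 by lra. rewrite ln_mult by auto. ring. }
    rewrite <- E. apply C_ext; unfold Clog; simpl; ring. }
  assert (E2 : g (PI / 2, t) = (RtoC (Rpower ucoef sigma * Rpower (t ^ 2 + PI ^ 2 / 36) sigma) * / rot)%C).
  { unfold g, rot. rewrite E1, <- Cexp_opp.
    unfold Rpower. rewrite <- exp_plus, <- Cexp_RtoC, <- Cexp_plus. f_equal.
    apply C_ext; simpl; ring. }
  assert (E3 : F (PI / 2, t) = (RtoC (sqrt 3 * cut_density t) * - Ci)%C).
  { rewrite F_quotient, Fnum_parts, Fden_parts.
    replace (2 * (PI / 2)) with PI by field. rewrite cos_PI, sin_PI, cos_PI2, sin_PI2.
    assert (Ec : cosh (2 * t) = 1 + 2 * sinh t ^ 2).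
    { unfold cosh, sinh. replace (2 * t) with (t + t) by ring. rewrite Ropp_plus_distr, !exp_plus.
      assert (E : exp t * exp (- t) = 1) by (rewrite <- exp_plus, Rplus_opp_r; apply exp_0).
      replace (1 + 2 * ((exp t - exp (- t)) / 2) ^ 2)
        with ((exp t * exp t + exp (- t) * exp (- t)) / 2 + (1 - exp t * exp (- t))) by field.
      rewrite E. ring. }
    rewrite Ec.
    replace (1 + 2 * (-1 * (1 + 2 * sinh t ^ 2)), - (2 * (0 * sinh (2 * t))))
      with (- RtoC (1 + 4 * sinh t ^ 2))%C by (apply C_ext; simpl; ring).
    replace (- (4 * sqrt 3 * (0 * cosh t)), 4 * sqrt 3 * (1 * sinh t))
      with (RtoC (4 * sqrt 3 * sinh t) * Ci)%C by (apply C_ext; simpl; ring).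
    assert (Hd : 1 + 4 * sinh t ^ 2 <> 0) by (apply Rgt_not_eq; generalize (pow2_ge_0 (sinh t)); lra).
    assert (Hd' : RtoC (1 + 4 * sinh t ^ 2) <> 0) by (intros E; apply RtoC_inj in E; auto).
    unfold cut_density.
    replace (sqrt 3 * (4 * sinh t / (1 + 4 * sinh t ^ 2)))
      with (4 * sqrt 3 * sinh t / (1 + 4 * sinh t ^ 2)) by (field; auto).
    rewrite (RtoC_div (4 * sqrt 3 * sinh t)) by auto. field. auto. }
  rewrite E2, E3. rewrite !RtoC_mult. ring.
Qed.

Lemma Dstar_integrand_upper t : 0 <= t -> Dstar_integrand (RtoC (- sigma)) (c, t) = f (c, t).
Proof.
  intros Ht.
  rewrite branch_nz by (intros E; apply (f_equal Re) in E; simpl in E; lra).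
  unfold Dstar_integrand, Cpower, g. rewrite Clog_u by (simpl; lra).
  do 3 f_equal. rewrite RtoC_opp. ring.
Qed.

Lemma c_not_pole y : Fden (c, y) <> 0.
Proof.
  apply Fden_nz; simpl; [generalize PI_gt_3; lra|].
  intros E; apply (f_equal Re) in E; simpl in E; lra.
Qed.

Lemma Dstar_integrand_lower t : 0 <= t -> Dstar_integrand (RtoC (- sigma)) (c, - t) = Cconj (f (c, t)).
Proof.
  intros Ht. rewrite <- Dstar_integrand_upper by auto. unfold Dstar_integrand.
  change (c, - t) with (Cconj (c, t)).
  rewrite F_conj by apply c_not_pole. rewrite u_conj.
  replace (- RtoC (- sigma))%C with (RtoC sigma) by (rewrite RtoC_opp; ring).
  rewrite Cpower_conj by (apply u_slit; lra). symmetry. apply Cmult_conj.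
Qed.

Lemma Dstar_integrand_cts y : Ccts (Dstar_integrand (RtoC (- sigma))) (c, y).
Proof.
  apply (Ccts_mult F (fun z => Cpower (u z) (- RtoC (- sigma)))).
  - apply (Ccts_div Fnum Fden).
    + apply Cdiff_cts, Cdiff_Fnum.
    + eapply Cder_cts; apply Cder_Fden.
    + apply c_not_pole.
  - apply Cdiff_cts. apply (Cdiff_comp u (fun w => Cpower w (- RtoC (- sigma)))).
    + unfold u. unfold Cdiv.
      apply (Cdiff_mult (fun z => (RtoC PI - 3 * z) * (2 * RtoC PI - 3 * z))%C (fun _ => (/ (6 * RtoC PI ^ 2))%C)); [|apply Cdiff_const].
      assert (L : forall k, Cdiff (fun z => k - 3 * z)%C (c, y)).
      { intros k. apply (Cdiff_minus (fun _ => k) (fun z => 3 * z)%C); [apply Cdiff_const|].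
        apply (Cdiff_mult (fun _ => RtoC 3) (fun z => z)); [apply Cdiff_const | apply Cdiff_id]. }
      apply (Cdiff_mult (fun z => RtoC PI - 3 * z)%C (fun z => 2 * RtoC PI - 3 * z)%C); apply L.
    + apply Cdiff_Cpower, u_slit. lra.
Qed.
(** Adding the conjugate lower half gives [Dstar = Re la / pi], and [Re la] is the imaginary part of
    the identity of [half_strip_shift]. There the real segment [[c, pi/3]] drops out, while
    [[pi/3, pi/2]] and the vertical edge both bring the factor [- sin (pi sigma)] from the phase
    [/ rot]. *)
Theorem Dstar_formula : exists A B : R,
  (forall Y, 0 <= Y -> ex_RInt (fun t => cut_density t * Rpower (t ^ 2 + PI ^ 2 / 36) sigma) 0 Y) /\
  is_lim (fun Y => RInt (fun t => cut_density t * Rpower (t ^ 2 + PI ^ 2 / 36) sigma) 0 Y) p_infty A /\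
  Rabs B <= 32 * Rpower ucoef sigma /\
  ex_vertical_integral c (Dstar_integrand (RtoC (- sigma))) /\
  Dstar c (RtoC (- sigma)) =
    RtoC (- (sin (PI * sigma) / PI) * (sqrt 3 * Rpower ucoef sigma * A + B)).
Proof.
  assert (Pi := PI_gt_3).
  destruct (half_strip_shift f p3 c (PI / 2) (1 / 2)
    (32 * (Rpower ucoef sigma * exp (sigma * ln 4 + sigma * ln sigma + 1) ^ 2)) 1)
    as [la [lb [La [Lb E]]]]; [lra | lra | lra | apply branch_cts_p3 | | |].
  { intros z H1 H2 H3. apply branch_diff; auto. }
  { intros z H1 H2. apply branch_bound; auto. }
  assert (HC : forall x y, c <= x <= PI / 2 -> 0 <= y -> Ccts f (x, y)).
  { intros x y Hx Hy. destruct (classic ((x, y) = p3)) as [->|Hn].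
    - apply branch_cts_p3.
    - apply Cdiff_cts, branch_diff; auto. }
  assert (Hhc : forall x, c <= x <= PI / 2 -> half_cts (fun t => f (x, t))).
  { intros x Hx t Ht. apply Pcts_v, HC; auto. }
  assert (Hrot : rot <> 0) by apply Cexp_nz.
  set (K := sqrt 3 * Rpower ucoef sigma).
  assert (HK : 0 < K).
  { apply Rmult_lt_0_compat; [apply sqrt_lt_R0; lra | apply exp_pos]. }
  assert (HKC : RtoC K <> 0) by (intros E0; apply RtoC_inj in E0; lra).
  set (w := fun t => cut_density t * Rpower (t ^ 2 + PI ^ 2 / 36) sigma).
  (* [k] is the inverse of the constant complex factor on the edge, so [k] times the integrand is
     the real weight [w]. *)
  set (k := (rot * Ci / RtoC K)%C).
  assert (Hw : forall t, 0 < t -> (k * f ((PI / 2)%R, t))%C = RtoC (w t)).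
  { intros t Ht. rewrite branch_on_cut by auto. fold K. fold (w t). rewrite RtoC_mult. unfold k.
    replace (rot * Ci / K * (K * w t * - (Ci * / rot)))%C with (- (Ci * Ci) * w t)%C by (field; auto).
    replace (Ci * Ci)%C with (- RtoC 1)%C by (apply C_ext; simpl; ring). ring. }
  assert (Lw : CIlim (fun t => RtoC (w t)) (k * lb)%C).
  { apply (CIlim_ext (fun t => k * f ((PI / 2)%R, t))%C); auto.
    apply CIlim_scal; auto. apply Hhc; lra. }
  destruct (CIlim_RtoC _ _ Lw) as [Em Lm].
  destruct segment_integral as [B [HB EB]].
  exists (Re (k * lb)%C), B. split; [|split; [|split]]; auto.
  { intros Y HY.
    assert (X : CIex (fun t => RtoC (w t)) 0 Y).
    { apply (CIex_ext (fun t => k * f ((PI / 2)%R, t))%C).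
      - rewrite Rmin_left by auto. intros t Ht. apply Hw; lra.
      - apply CIex_scal. apply half_cts_CIex; [apply Hhc; lra | lra]. }
    apply X. }
  set (A := Re (k * lb)%C) in *.
  assert (Erot : (/ rot)%C = (cos (PI * sigma), - sin (PI * sigma))).
  { unfold rot. rewrite <- Cexp_opp. unfold Cexp; simpl. rewrite Ropp_0, exp_0, cos_neg, sin_neg.
    apply C_ext; simpl; ring. }
  assert (Elb : lb = (RtoC (K * A) * - (Ci * / rot))%C).
  { rewrite RtoC_mult, <- Em. unfold k.
    replace (K * (rot * Ci / K * lb) * - (Ci * / rot))%C with (- (Ci * Ci) * lb)%C by (field; auto).
    replace (Ci * Ci)%C with (- RtoC 1)%C by (apply C_ext; simpl; ring). ring. }
  assert (Hre : Re la = - sin (PI * sigma) * (K * A + B)).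
  { assert (S1 : CIex (fun t => f (t, 0)) c (PI / 3)).
    { apply CIex_Pcts_le; [lra|]. intros t Ht. apply Pcts_h, HC; lra. }
    assert (S2 : CIex (fun t => f (t, 0)) (PI / 3) (PI / 2)).
    { apply CIex_Pcts_le; [lra|]. intros t Ht. apply Pcts_h, HC; lra. }
    rewrite <- (CI_Chasles _ _ _ _ S1 S2), EB in E.
    assert (Hreal : Im (CI (fun t => f (t, 0)) c (PI / 3)) = 0).
    { rewrite CI_Im. transitivity (RInt (fun _ => 0) c (PI / 3)).
      - apply RInt_ext. rewrite Rmin_left, Rmax_right by lra. intros t Ht.
        rewrite branch_nz by (intros E0; apply (f_equal Re) in E0; simpl in E0; lra).
        rewrite F_real. unfold g. rewrite <- Clog_u by (simpl; lra).
        rewrite u_parts.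
        replace (9 * 0 * (2 * t - PI) / (6 * PI ^ 2)) with 0 by (unfold Rdiv; ring).
        change ((9 * (t ^ 2 - 0 ^ 2) - 9 * PI * t + 2 * PI ^ 2) / (6 * PI ^ 2), 0)
          with (RtoC ((9 * (t ^ 2 - 0 ^ 2) - 9 * PI * t + 2 * PI ^ 2) / (6 * PI ^ 2))).
        rewrite Clog_RtoC.
        2: { apply Rdiv_lt_0_compat; [|nra].
             assert (0 < (PI - 3 * t) * (2 * PI - 3 * t)) by (apply Rmult_lt_0_compat; lra). lra. }
        rewrite <- RtoC_mult, Cexp_RtoC, <- RtoC_mult. reflexivity.
      - rewrite (RInt_const (V := R_CompleteNormedModule)). apply Rmult_0_r. }
    apply (f_equal Im) in E. rewrite Elb, !im_plus, Hreal, Erot in E.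
    simpl in E. unfold Re. lra. }
  assert (Hcc : c <= c <= PI / 2) by lra.
  set (h := vertical_integrand c (Dstar_integrand (RtoC (- sigma)))).
  assert (Hh : forall t, Pcts h t).
  { intros t. unfold h, vertical_integrand.
    apply (Pcts_v (fun z => Dstar_integrand (RtoC (- sigma)) z * Ci)%C).
    apply (Ccts_mult (Dstar_integrand (RtoC (- sigma))) (fun _ => Ci)); [|apply Ccts_const].
    apply Dstar_integrand_cts. }
  assert (Lp : CIlim h (Ci * la)%C).
  { apply (CIlim_ext (fun t => Ci * f (c, t))%C).
    - intros t Ht. unfold h, vertical_integrand. rewrite Dstar_integrand_upper by lra. ring.
    - apply CIlim_scal; auto. }
  assert (Lmm : CIlim (fun t => h (- t)) (Ci * Cconj la)%C).
  { apply (CIlim_ext (fun t => Ci * Cconj (f (c, t)))%C).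
    - intros t Ht. unfold h, vertical_integrand. rewrite Dstar_integrand_lower by lra. ring.
    - apply CIlim_scal.
      + intros t Ht. destruct (Hhc c Hcc t Ht) as [F1 F2]. split; simpl; auto.
        apply (continuous_opp (V := R_NormedModule) (fun t => Im (f (c, t)))); auto.
      + apply CIlim_conj; auto. }
  assert (G := is_RInt_gen_of_halves h _ _ Hh Lp Lmm).
  split; [exists (Ci * Cconj la + Ci * la)%C; exact G|].
  unfold Dstar, vertical_integral. fold h.
  rewrite (is_RInt_gen_unique (V := C_R_CompleteNormedModule) h _ G).
  assert (HP : RtoC PI <> 0) by (intros E0; apply RtoC_inj in E0; lra).
  replace (Ci * Cconj la + Ci * la)%C with (Ci * (2 * RtoC (Re la)))%C.
  2: { apply C_ext; simpl; unfold Re; ring. }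
  rewrite Hre. fold K.
  replace (- (sin (PI * sigma) / PI) * (K * A + B)) with (- sin (PI * sigma) * (K * A + B) / PI) by (field; lra).
  rewrite RtoC_div by lra. field. split; auto. apply Ci_nz.
Qed.
End DstarFormula.

(** * Comparison of the two integrals for large sigma *)

Lemma is_lim_ub (F : R -> R) (l M Y0 : R) : is_lim F p_infty l -> (forall Y, Y0 <= Y -> F Y <= M) -> l <= M.
Proof.
  intros H K. apply (is_lim_le_loc F (fun _ => M) p_infty l M); auto.
  - exists Y0. intros Y HY. apply K. lra.
  - apply is_lim_const.
Qed.

Lemma is_lim_lb (F : R -> R) (l M Y0 : R) : is_lim F p_infty l -> (forall Y, Y0 <= Y -> M <= F Y) -> M <= l.
Proof.
  intros H K. apply (is_lim_le_loc (fun _ => M) F p_infty M l); auto.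
  - exists Y0. intros Y HY. apply K. lra.
  - apply is_lim_const.
Qed.

Lemma ex_RInt_sub (h : R -> R) a b : (forall Y, 0 <= Y -> ex_RInt h 0 Y) -> 0 <= a <= b -> ex_RInt h a b.
Proof.
  intros H Hab. apply (ex_RInt_Chasles_2 (V := R_CompleteNormedModule) h 0 a b); [lra|]. apply H; lra.
Qed.

Lemma RInt_split (h : R -> R) a b : (forall Y, 0 <= Y -> ex_RInt h 0 Y) -> 0 <= a <= b ->
  RInt h 0 b = RInt h 0 a + RInt h a b.
Proof.
  intros H Hab. symmetry. apply (RInt_Chasles (V := R_CompleteNormedModule)).
  - apply H; lra.
  - apply ex_RInt_sub; auto.
Qed.

Lemma RInt_le_const (h : R -> R) a b M : a <= b -> ex_RInt h a b -> (forall t, a < t < b -> h t <= M) ->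
  RInt h a b <= (b - a) * M.
Proof.
  intros Hab Hh HM.
  apply Rle_trans with (RInt (fun _ => M) a b).
  - apply RInt_le; auto. apply ex_RInt_const.
  - rewrite (RInt_const (V := R_CompleteNormedModule)). apply Rle_refl.
Qed.

Lemma RInt_ge_const (h : R -> R) a b M : a <= b -> ex_RInt h a b -> (forall t, a < t < b -> M <= h t) ->
  (b - a) * M <= RInt h a b.
Proof.
  intros Hab Hh HM.
  apply Rle_trans with (RInt (fun _ => M) a b).
  - rewrite (RInt_const (V := R_CompleteNormedModule)). apply Rle_refl.
  - apply RInt_le; auto. apply ex_RInt_const.
Qed.

Lemma RInt_scal_R (h : R -> R) k a b : ex_RInt h a b -> RInt (fun t => k * h t) a b = k * RInt h a b.
Proof. intros H. apply (RInt_scal (V := R_CompleteNormedModule) h); auto. Qed.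

Lemma ex_RInt_scal_R (h : R -> R) k a b : ex_RInt h a b -> ex_RInt (fun t => k * h t) a b.
Proof. intros H. apply (ex_RInt_scal (V := R_CompleteNormedModule) h); auto. Qed.

Lemma cut_density_pos t : 0 < t -> 0 < cut_density t.
Proof.
  intros Ht. assert (S := sinh_pos t Ht). apply Rdiv_lt_0_compat; [lra|].
  generalize (pow2_ge_0 (sinh t)). lra.
Qed.

Lemma cut_density_le_1 t : cut_density t <= 1.
Proof.
  apply Rcomplements.Rle_div_l; [generalize (pow2_ge_0 (sinh t)); lra|].
  generalize (pow2_ge_0 (2 * sinh t - 1)). nra.
Qed.

Lemma cut_density_le_inv t : 0 < t -> cut_density t <= / sinh t.
Proof.
  intros Ht. assert (S := sinh_pos t Ht). assert (P := pow2_ge_0 (sinh t)).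
  apply Rcomplements.Rle_div_l; [lra|].
  apply Rmult_le_reg_l with (sinh t); auto.
  replace (sinh t * (/ sinh t * (1 + 4 * sinh t ^ 2))) with (1 + 4 * sinh t ^ 2) by (field; lra). nra.
Qed.

(** [cut_density t] is [1 / sinh t] times [1 / (1 + x)] with [x = 1 / (4 sinh^2 t)]; then
    [1 / (1 + x) >= 1 - x] and [sinh t >= t]. *)
Lemma cut_density_ge t : 0 < t -> / sinh t * (1 - / (4 * t ^ 2)) <= cut_density t.
Proof.
  intros Ht. assert (S := sinh_pos t Ht). assert (S2 := sinh_ge t ltac:(lra)).
  assert (I : 1 - / (4 * t ^ 2) <= 1 - / (4 * sinh t ^ 2)).
  { apply Rplus_le_compat_l, Ropp_le_contravar, Rinv_le_contravar; nra. }
  apply Rle_trans with (/ sinh t * (1 - / (4 * sinh t ^ 2))).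
  - apply Rmult_le_compat_l; auto. left; apply Rinv_0_lt_compat; auto.
  - unfold cut_density. set (v := sinh t) in *.
    assert (E : 4 * v / (1 + 4 * v ^ 2) - / v * (1 - / (4 * v ^ 2)) = / (4 * v ^ 3 * (1 + 4 * v ^ 2))).
    { field. split; [nra | lra]. }
    assert (0 < / (4 * v ^ 3 * (1 + 4 * v ^ 2))); [|lra].
    apply Rinv_0_lt_compat. assert (0 < v ^ 2) by nra. assert (0 < v ^ 3) by (apply pow_lt; auto). nra.
Qed.

Lemma Rpower_base_le x y p : 0 <= p -> 0 < x <= y -> Rpower x p <= Rpower y p.
Proof. intros Hp H. apply Rle_Rpower_l; auto. Qed.

(** From [ln (3/4) <= -1/4] and [exp (r / 4) >= (r / 8)^2]. A decay of order [1 / r^2] is what makes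
    the head of the integrals, which carries a factor [y0], of order [1 / sigma]. *)
Lemma three_quarters_pow r : 0 < r -> Rpower (3 / 4) r <= 64 / r ^ 2.
Proof.
  intros Hr.
  assert (L : ln (3 / 4) <= - (1 / 4)).
  { assert (H := exp_ineq1_le (ln (3 / 4))). rewrite exp_ln in H by lra. lra. }
  apply Rle_trans with (exp (- (r / 4))).
  { unfold Rpower. apply exp_le_compat. nra. }
  rewrite exp_Ropp. replace (64 / r ^ 2) with (/ ((r / 8) ^ 2)) by (field; lra).
  apply Rinv_le_contravar; [apply pow_lt; lra|].
  replace (r / 4) with (r / 8 + r / 8) by field. rewrite exp_plus.
  generalize (exp_ineq1_le (r / 8)). nra.
Qed.

Section Asymptotics.
Variable sigma : R.
Hypothesis Hs : 5 <= sigma.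

Let r := 2 * sigma.
(** The cutoff [y0 = r / 4] lies far below the peak of [h] near [t = r], so [[0, y0]] is negligible;
    above it the two integrands agree up to factors [1 + O(1 / sigma)]. *)
Let y0 := sigma / 2.
Let h (t : R) := Rpower t r / sinh t.
Let W (t : R) := cut_density t * Rpower (t ^ 2 + PI ^ 2 / 36) sigma.

Variables A T : R.
Hypothesis Hh : forall Y, 0 <= Y -> ex_RInt h 0 Y.
Hypothesis HW : forall Y, 0 <= Y -> ex_RInt W 0 Y.
Hypothesis LT : is_lim (fun Y => RInt h 0 Y) p_infty T.
Hypothesis LA : is_lim (fun Y => RInt W 0 Y) p_infty A.

Lemma h_pos t : 0 < t -> 0 < h t.
Proof. intros Ht. apply Rdiv_lt_0_compat; [apply exp_pos | apply sinh_pos; auto]. Qed.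

Lemma W_pos t : 0 < t -> 0 < W t.
Proof. intros Ht. apply Rmult_lt_0_compat; [apply cut_density_pos; auto | apply exp_pos]. Qed.

Lemma RInt_h_le_T Y : 0 <= Y -> RInt h 0 Y <= T.
Proof.
  intros HY. apply (is_lim_lb _ _ _ Y LT). intros Z HZ.
  rewrite (RInt_split h Y Z) by (auto; lra).
  assert (0 <= RInt h Y Z).
  { apply RInt_ge_0; [auto | apply ex_RInt_sub; auto |]. intros t Ht. left; apply h_pos; lra. }
  lra.
Qed.

(* The mass of [T] sits near [t = r]. *)
Lemma T_lower : 2 * (Rpower r r * exp (- (r + 1))) <= T.
Proof.
  assert (Hr : 10 <= r) by (unfold r; lra).
  apply Rle_trans with (RInt h 0 (r + 1)); [|apply RInt_h_le_T; lra].
  rewrite (RInt_split h r (r + 1)) by (auto; lra).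
  assert (P : 0 <= RInt h 0 r).
  { apply RInt_ge_0; [lra | apply Hh; lra |]. intros t Ht. left; apply h_pos; lra. }
  assert (Q : (r + 1 - r) * (2 * (Rpower r r * exp (- (r + 1)))) <= RInt h r (r + 1)).
  { apply RInt_ge_const; [lra | apply ex_RInt_sub; auto; lra |].
    intros t Ht. unfold h.
    assert (S := sinh_pos t ltac:(lra)).
    assert (B1 : Rpower r r <= Rpower t r) by (apply Rpower_base_le; lra).
    assert (B2 : 2 * exp (- (r + 1)) <= / sinh t).
    { apply Rle_trans with (2 * exp (- t)).
      - apply Rmult_le_compat_l; [lra|]. apply exp_le_compat. lra.
      - rewrite exp_Ropp. replace (2 * / exp t) with (/ (exp t / 2)).
        + apply Rinv_le_contravar; auto. unfold sinh. generalize (exp_pos (- t)). lra.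
        + field. generalize (exp_pos t). lra. }
    replace (2 * (Rpower r r * exp (- (r + 1)))) with (Rpower r r * (2 * exp (- (r + 1)))) by ring.
    apply Rmult_le_compat; auto.
    - left; apply exp_pos.
    - generalize (exp_pos (- (r + 1))). lra. }
  lra.
Qed.

Lemma ln_ge_2 : 2 <= ln r.
Proof.
  assert (Hr : 10 <= r) by (unfold r; lra).
  rewrite <- (ln_exp 2). apply Rcomplements.ln_le; [apply exp_pos|].
  replace 2 with (1 + 1) by ring. rewrite exp_plus.
  generalize exp_le_3 (exp_pos 1). nra.
Qed.

(** In [T_lower] the exponent [r ln r - r - 1] is at least [r - 1] because [ln r >= 2]. This growth
    makes the bounded contribution of the segment negligible in [ratio_estimate]. *)
Lemma T_ge_sigma : sigma <= T.
Proof.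
  assert (Hr : 10 <= r) by (unfold r; lra).
  eapply Rle_trans; [|apply T_lower].
  unfold Rpower. rewrite <- exp_plus.
  apply Rle_trans with (2 * exp (r - 1)).
  - generalize (exp_ineq1_le (r - 1)). unfold r. lra.
  - apply Rmult_le_compat_l; [lra|]. apply exp_le_compat. generalize ln_ge_2. nra.
Qed.

(** [y0^r = r^r / 4^r], while [T] is at least of order [r^r exp (- r)]: the ratio is of order
    [(e / 4)^r], and [e <= 3]. *)
Lemma y0_pow_le : Rpower y0 r <= 2 * Rpower (3 / 4) r * T.
Proof.
  assert (Hr : 10 <= r) by (unfold r; lra).
  apply Rle_trans with (2 * Rpower (3 / 4) r * (2 * (Rpower r r * exp (- (r + 1))))).
  2: { apply Rmult_le_compat_l; [|apply T_lower]. generalize (exp_pos (r * ln (3 / 4))). unfold Rpower. lra. }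
  assert (E : y0 = r * / 4) by (unfold y0, r; field). rewrite E.
  replace (2 * Rpower (3 / 4) r * (2 * (Rpower r r * exp (- (r + 1)))))
    with (4 * exp (- 1) * (Rpower r r * (Rpower (3 / 4) r * exp (- r)))).
  2: { replace (- (r + 1)) with (- r + - 1) by ring. rewrite exp_plus. ring. }
  rewrite <- Rpower_mult_distr by lra.
  assert (P1 : Rpower (/ 4) r <= Rpower (3 / 4) r * exp (- r)).
  { unfold Rpower. rewrite <- exp_plus. apply exp_le_compat.
    unfold Rdiv. rewrite ln_mult by lra.
    assert (1 <= ln 3); [|nra].
    rewrite <- (ln_exp 1). apply Rcomplements.ln_le; [apply exp_pos | apply exp_le_3]. }
  assert (P2 : 1 <= 4 * exp (- 1)).
  { assert (E1 : exp (- 1) * exp 1 = 1) by (rewrite <- exp_plus; replace (- 1 + 1) with 0 by ring; apply exp_0).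
    generalize exp_le_3 (exp_pos (- 1)). nra. }
  assert (P3 : 0 < Rpower r r) by apply exp_pos. assert (P4 : 0 < Rpower (/ 4) r) by apply exp_pos.
  assert (P5 : Rpower r r * Rpower (/ 4) r <= Rpower r r * (Rpower (3 / 4) r * exp (- r))).
  { apply Rmult_le_compat_l; lra. }
  assert (0 < Rpower r r * Rpower (/ 4) r) by (apply Rmult_lt_0_compat; auto). nra.
Qed.

(** [(1 + x)^sigma <= exp (sigma x)] with [x = (pi^2 / 36) / t^2 <= 1 / y0^2], and
    [sigma / y0^2 = 4 / sigma]. *)
Lemma shifted_pow_le t : y0 <= t ->
  Rpower (t ^ 2 + PI ^ 2 / 36) sigma <= exp (4 / sigma) * Rpower t r.
Proof.
  intros Ht. assert (Pi4 := PI_4). assert (Pi := PI_gt_3).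
  assert (Hy : 0 < y0) by (unfold y0; lra).
  assert (Ht2 : 0 < t ^ 2) by nra.
  assert (E : t ^ 2 + PI ^ 2 / 36 = t ^ 2 * (1 + PI ^ 2 / 36 / t ^ 2)) by (field; lra).
  assert (Q : 0 < PI ^ 2 / 36 / t ^ 2) by (apply Rdiv_lt_0_compat; nra).
  rewrite E, <- Rpower_mult_distr by lra. rewrite Rmult_comm.
  apply Rmult_le_compat; try (left; apply exp_pos).
  - unfold Rpower. apply exp_le_compat.
    assert (L : ln (1 + PI ^ 2 / 36 / t ^ 2) <= PI ^ 2 / 36 / t ^ 2).
    { assert (X := exp_ineq1_le (ln (1 + PI ^ 2 / 36 / t ^ 2))). rewrite exp_ln in X by lra. lra. }
    apply Rle_trans with (sigma * (PI ^ 2 / 36 / t ^ 2)); [apply Rmult_le_compat_l; lra|].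
    apply Rle_trans with (sigma * (1 / y0 ^ 2)).
    + apply Rmult_le_compat_l; [lra|]. unfold Rdiv at 1 2.
      apply Rmult_le_compat; [nra | left; apply Rinv_0_lt_compat; auto | nra |].
      apply Rinv_le_contravar; nra.
    + right. unfold y0. field. lra.
  - right. rewrite <- (Rpower_pow 2 t) by lra. rewrite Rpower_mult. f_equal.
Qed.

Lemma exp_4_sigma : exp (4 / sigma) <= 1 + 12 / sigma.
Proof.
  assert (H : 0 < 4 / sigma <= 1).
  { split; [apply Rdiv_lt_0_compat; lra|]. apply Rcomplements.Rle_div_l; lra. }
  assert (B := exp_sub1_abs (4 / sigma)). rewrite (Rabs_pos_eq (4 / sigma)) in B by lra.
  assert (B' := Rle_abs (exp (4 / sigma) - 1)).
  assert (X : exp (4 / sigma) <= 3).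
  { eapply Rle_trans; [apply exp_le_compat | apply exp_le_3]. lra. }
  replace (12 / sigma) with (4 / sigma * 3) by (field; lra). nra.
Qed.

(** Since [sinh t >= t], the integrand is at most [y0^(r - 1)] on an interval of length [y0]. *)
Lemma RInt_h_head : RInt h 0 y0 <= Rpower y0 r.
Proof.
  assert (Hy : 0 < y0) by (unfold y0; lra).
  apply Rle_trans with ((y0 - 0) * Rpower y0 (r - 1)).
  - apply RInt_le_const; [lra | apply Hh; lra |]. intros t Ht. unfold h.
    assert (S := sinh_ge t ltac:(lra)).
    apply Rle_trans with (Rpower t r / t).
    + apply Rmult_le_compat_l; [left; apply exp_pos|]. apply Rinv_le_contravar; lra.
    + replace r with ((r - 1) + 1) at 1 by ring. rewrite Rpower_plus, Rpower_1 by lra.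
      replace (Rpower t (r - 1) * t / t) with (Rpower t (r - 1)) by (field; lra).
      apply Rpower_base_le; [unfold r; lra | lra].
  - right. replace r with ((r - 1) + 1) at 2 by ring. rewrite Rpower_plus, Rpower_1 by lra. ring.
Qed.

(** The density is at most [1], the power is largest at [y0], and [4] bounds the factor
    [exp (4 / sigma)] for [sigma >= 5]. *)
Lemma RInt_W_head : RInt W 0 y0 <= 4 * y0 * Rpower y0 r.
Proof.
  assert (Hy : 0 < y0) by (unfold y0; lra). assert (Pi := PI_gt_3).
  apply Rle_trans with ((y0 - 0) * Rpower (y0 ^ 2 + PI ^ 2 / 36) sigma).
  - apply RInt_le_const; [lra | apply HW; lra |]. intros t Ht. unfold W.
    assert (D := cut_density_le_1 t). assert (D0 := cut_density_pos t ltac:(lra)).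
    rewrite <- (Rmult_1_l (Rpower (y0 ^ 2 + PI ^ 2 / 36) sigma)).
    apply Rmult_le_compat; auto; [lra | left; apply exp_pos |].
    apply Rpower_base_le; [lra|]. nra.
  - rewrite Rminus_0_r. rewrite (Rmult_comm 4), Rmult_assoc. apply Rmult_le_compat_l; [lra|].
    eapply Rle_trans; [apply shifted_pow_le; lra|].
    apply Rmult_le_compat_r; [left; apply exp_pos|].
    eapply Rle_trans; [apply exp_4_sigma|].
    assert (12 / sigma <= 3) by (apply Rcomplements.Rle_div_l; lra). lra.
Qed.

Lemma W_tail_upper Y : y0 <= Y -> RInt W y0 Y <= exp (4 / sigma) * T.
Proof.
  intros HY. assert (Hy : 0 < y0) by (unfold y0; lra).
  apply Rle_trans with (RInt (fun t => exp (4 / sigma) * h t) y0 Y).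
  - apply RInt_le; auto.
    + apply ex_RInt_sub; auto; lra.
    + apply ex_RInt_scal_R, ex_RInt_sub; auto; lra.
    + intros t Ht. unfold W, h.
      replace (exp (4 / sigma) * (Rpower t r / sinh t)) with (/ sinh t * (exp (4 / sigma) * Rpower t r))
        by (unfold Rdiv; ring).
      apply Rmult_le_compat.
      * left; apply cut_density_pos; lra.
      * left; apply exp_pos.
      * apply cut_density_le_inv; lra.
      * apply shifted_pow_le; lra.
  - rewrite RInt_scal_R by (apply ex_RInt_sub; auto; lra).
    apply Rmult_le_compat_l; [left; apply exp_pos|].
    assert (B := RInt_h_le_T Y ltac:(lra)). rewrite (RInt_split h y0 Y) in B by (auto; lra).
    assert (0 <= RInt h 0 y0).
    { apply RInt_ge_0; [lra | apply Hh; lra |]. intros t Ht. left; apply h_pos; lra. }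
    lra.
Qed.

Lemma W_tail_lower Y : y0 <= Y -> (1 - 1 / sigma) * RInt h y0 Y <= RInt W y0 Y.
Proof.
  intros HY. assert (Hy : 0 < y0) by (unfold y0; lra).
  rewrite <- RInt_scal_R by (apply ex_RInt_sub; auto; lra).
  apply RInt_le; auto.
  - apply ex_RInt_scal_R, ex_RInt_sub; auto; lra.
  - apply ex_RInt_sub; auto; lra.
  - intros t Ht. unfold W, h. assert (S := sinh_pos t ltac:(lra)).
    (* [t > sigma / 2] gives [4 t^2 > sigma^2 >= sigma]. *)
    assert (I : / (4 * t ^ 2) <= 1 / sigma).
    { unfold Rdiv. rewrite Rmult_1_l. apply Rinv_le_contravar; [lra|].
      assert (sigma / 2 < t) by (fold y0; lra). nra. }
    assert (I2 : 1 / sigma <= 1) by (apply Rcomplements.Rle_div_l; lra).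
    replace ((1 - 1 / sigma) * (Rpower t r / sinh t)) with (/ sinh t * (1 - 1 / sigma) * Rpower t r)
      by (unfold Rdiv; ring).
    assert (Is : 0 < / sinh t) by (apply Rinv_0_lt_compat; auto).
    apply Rmult_le_compat.
    + apply Rmult_le_pos; lra.
    + left; apply exp_pos.
    + eapply Rle_trans; [|apply cut_density_ge; lra]. apply Rmult_le_compat_l; lra.
    + replace (Rpower t r) with (Rpower (t ^ 2) sigma).
      * apply Rpower_base_le; [lra|]. generalize PI_gt_3. nra.
      * rewrite <- (Rpower_pow 2 t) by lra. rewrite Rpower_mult. reflexivity.
Qed.

(** From above, the head costs [64 / sigma] and the factor [exp (4 / sigma)] costs [12 / sigma];
    from below, the density costs [1 / sigma] and the missing head of [T] costs [7 / sigma]. The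
    constant [80] covers both sides. *)
Lemma ratio_bound : Rabs (A / T - 1) <= 80 / sigma.
Proof.
  assert (Hy : 0 < y0) by (unfold y0; lra). assert (Hr : 10 <= r) by (unfold r; lra).
  assert (HT := T_ge_sigma). assert (Hq := three_quarters_pow r ltac:(lra)).
  assert (Hy0 := y0_pow_le).
  set (q := Rpower (3 / 4) r) in *. assert (Pq : 0 < q) by apply exp_pos.
  assert (Hq1 : y0 * q <= 8 / sigma).
  { apply Rle_trans with (y0 * (64 / r ^ 2)); [apply Rmult_le_compat_l; lra|].
    right. unfold y0, r. field. lra. }
  assert (Is : 0 < / sigma) by (apply Rinv_0_lt_compat; lra).
  assert (Hq2 : 2 * q <= 7 / sigma).
  { assert (5 / 2 * q <= y0 * q) by (apply Rmult_le_compat_r; [lra | unfold y0; lra]).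
    unfold Rdiv in *. lra. }
  assert (U : A <= 4 * y0 * Rpower y0 r + exp (4 / sigma) * T).
  { apply (is_lim_ub _ _ _ y0 LA). intros Y HY. rewrite (RInt_split W y0 Y) by (auto; lra).
    apply Rplus_le_compat; [apply RInt_W_head | apply W_tail_upper; auto]. }
  assert (L : (1 - 1 / sigma) * (T - Rpower y0 r) <= A).
  { assert (LL : is_lim (fun Y => (1 - 1 / sigma) * (RInt h 0 Y - Rpower y0 r)) p_infty
        ((1 - 1 / sigma) * (T - Rpower y0 r))).
    { apply (is_lim_scal_l (fun Y => RInt h 0 Y - Rpower y0 r) (1 - 1 / sigma) p_infty (T - Rpower y0 r)).
      apply (is_lim_minus' (fun Y => RInt h 0 Y) (fun _ => Rpower y0 r)); [exact LT | apply is_lim_const]. }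
    refine (is_lim_le_loc _ _ _ _ _ _ LL LA). exists y0. intros Y HY.
    rewrite (RInt_split W y0 Y) by (auto; lra). rewrite (RInt_split h y0 Y) by (auto; lra).
    assert (B1 := RInt_h_head). assert (B2 := W_tail_lower Y ltac:(lra)).
    assert (B3 : 0 <= RInt W 0 y0).
    { apply RInt_ge_0; [lra | apply HW; lra |]. intros t Ht. left; apply W_pos; lra. }
    assert (1 / sigma <= 1) by (apply Rcomplements.Rle_div_l; lra).
    assert (0 <= (1 - 1 / sigma) * (Rpower y0 r - RInt h 0 y0)) by (apply Rmult_le_pos; lra). lra. }
  assert (X := exp_4_sigma).
  assert (HT0 : 0 < T) by lra.
  apply Rabs_le. split.
  - assert (B : 1 - 80 / sigma <= A / T); [|lra].
    apply Rcomplements.Rle_div_r; auto. eapply Rle_trans; [|exact L].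
    assert (Z : (1 - 7 / sigma) * T <= T - Rpower y0 r) by nra.
    assert (Z2 : 1 / sigma <= 1) by (apply Rcomplements.Rle_div_l; lra).
    apply Rle_trans with ((1 - 1 / sigma) * ((1 - 7 / sigma) * T)); [|apply Rmult_le_compat_l; lra].
    rewrite <- Rmult_assoc. apply Rmult_le_compat_r; [lra|]. unfold Rdiv in *. nra.
  - assert (B : A / T <= 1 + 80 / sigma); [|lra].
    apply Rcomplements.Rle_div_l; auto. eapply Rle_trans; [exact U|].
    assert (Z : 4 * y0 * Rpower y0 r <= 4 * y0 * (2 * q * T)) by (apply Rmult_le_compat_l; lra).
    assert (Z2 : 4 * y0 * (2 * q * T) <= 64 / sigma * T).
    { replace (4 * y0 * (2 * q * T)) with (8 * (y0 * q) * T) by ring.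
      apply Rmult_le_compat_r; [lra|]. unfold Rdiv in *. lra. }
    assert (Z3 : exp (4 / sigma) * T <= (1 + 12 / sigma) * T) by (apply Rmult_le_compat_r; lra).
    unfold Rdiv in *. nra.
Qed.
End Asymptotics.

(** * Matching the constants and estimating the relative error *)

Lemma is_lim_rescale (F : R -> R) (l u : R) : 0 < u -> is_lim F p_infty l ->
  is_lim (fun Z => F (u * Z + 0)) p_infty l.
Proof.
  intros Hu H. apply is_lim_spec. apply is_lim_spec in H. intros e.
  destruct (H e) as [M HM]. exists (M / u). intros Z HZ. apply HM.
  apply Rcomplements.Rlt_div_l in HZ; lra.
Qed.

(** The substitution [t = s / pi] brings the eta integral to the kernel [1 / sinh s], the one to
    which [cut_density] is comparable. *)
Lemma rescaled_integral (r T0 : R) :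
  (forall Y, 0 <= Y -> ex_RInt (fun t => Rpower t r / sinh (PI * t)) 0 Y) ->
  is_lim (fun Y => RInt (fun t => Rpower t r / sinh (PI * t)) 0 Y) p_infty T0 ->
  (forall Y, 0 <= Y -> ex_RInt (fun t => Rpower t r / sinh t) 0 Y) /\
  is_lim (fun Y => RInt (fun t => Rpower t r / sinh t) 0 Y) p_infty (PI * Rpower PI r * T0).
Proof.
  intros Hex Hlim. assert (Pi := PI_gt_3).
  set (H0 := fun t => Rpower t r / sinh (PI * t)) in *.
  (* This local [u] is the scale [1 / pi], not the quadratic polynomial; the [+ 0] below fits the
     affine substitution rule. *)
  set (u := / PI). assert (Hu : 0 < u) by (apply Rinv_0_lt_compat; lra).
  assert (Hpt : forall s, 0 < s -> PI * Rpower PI r * scal u (H0 (u * s + 0)) = Rpower s r / sinh s).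
  { intros s Hs. unfold H0. change (scal u (Rpower (u * s + 0) r / sinh (PI * (u * s + 0))))
      with (u * (Rpower (u * s + 0) r / sinh (PI * (u * s + 0)))).
    rewrite Rplus_0_r. replace (PI * (u * s)) with s by (unfold u; field; lra).
    assert (E : Rpower PI r * Rpower (u * s) r = Rpower s r).
    { rewrite Rpower_mult_distr; [|lra|apply Rmult_lt_0_compat; auto]. f_equal. unfold u; field; lra. }
    rewrite <- E. unfold u. assert (S := sinh_pos s Hs). field. split; lra. }
  assert (Hex' : forall Y, 0 <= Y -> ex_RInt (fun s => scal u (H0 (u * s + 0))) 0 Y).
  { intros Y HY. apply (ex_RInt_comp_lin (V := R_CompleteNormedModule) H0 u 0 0 Y).
    rewrite Rmult_0_r, !Rplus_0_r. apply Hex. apply Rmult_le_pos; lra. }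
  split.
  - intros Y HY. apply (ex_RInt_ext (fun s => PI * Rpower PI r * scal u (H0 (u * s + 0)))).
    + rewrite Rmin_left by auto. intros s Hs. apply Hpt; lra.
    + apply ex_RInt_scal_R; auto.
  - apply (is_lim_ext_loc (fun Y => PI * Rpower PI r * RInt H0 0 (u * Y + 0))).
    + exists 0. intros Y HY.
      transitivity (RInt (fun s => PI * Rpower PI r * scal u (H0 (u * s + 0))) 0 Y).
      * rewrite RInt_scal_R by (apply Hex'; lra). f_equal.
        assert (E := RInt_comp_lin (V := R_CompleteNormedModule) H0 u 0 0 Y).
        rewrite Rmult_0_r, Rplus_0_r in E. symmetry. apply E.
        rewrite Rplus_0_r. apply Hex. apply Rmult_le_pos; lra.
      * apply RInt_ext. rewrite Rmin_left by lra. intros s Hs. apply Hpt; lra.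
    + apply (is_lim_scal_l (fun Y => RInt H0 0 (u * Y + 0)) (PI * Rpower PI r) p_infty T0).
      apply is_lim_rescale; auto.
Qed.

Lemma Cpower_2_R r : Cpower 2 (RtoC r) = RtoC (Rpower 2 r).
Proof. unfold Cpower. rewrite Clog_RtoC, <- RtoC_mult, Cexp_RtoC by lra. reflexivity. Qed.

Lemma ucoef_power sigma :
  Rpower ucoef sigma * (Rpower PI (2 * sigma) * Rpower 2 (2 * sigma)) = Rpower 6 sigma.
Proof.
  assert (Pi := PI_gt_3).
  rewrite (Rmult_comm 2 sigma).
  replace (sigma * 2) with (INR 2 * sigma) by (simpl; ring).
  rewrite <- !Rpower_mult, !Rpower_pow by lra.
  rewrite !Rpower_mult_distr; try apply ucoef_pos; try nra.
  f_equal. unfold ucoef. field. lra.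
Qed.

(** [delta] will be [1 / (2 * 4^sigma)], the relative error of replacing [2 * 4^sigma - 1] by
    [2 * 4^sigma]. The three errors add up to [(80 + 32 + 1) / sigma]. *)
Lemma ratio_estimate sigma A B T delta :
  5 <= sigma -> sigma <= T -> Rabs (A / T - 1) <= 80 / sigma -> Rabs B <= 32 ->
  0 < delta <= 1 / sigma -> Rabs ((A + B) / T * (1 - delta) - 1) <= 120 / sigma.
Proof.
  intros Hs HT HA HB Hd.
  assert (Is : 0 < / sigma) by (apply Rinv_0_lt_compat; lra).
  assert (Is1 : 1 / sigma <= 1) by (apply Rcomplements.Rle_div_l; lra).
  assert (HBT : Rabs (B / T) <= 32 / sigma).
  { unfold Rdiv. rewrite Rabs_mult. rewrite (Rabs_pos_eq (/ T)) by (left; apply Rinv_0_lt_compat; lra).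
    apply Rmult_le_compat; auto; [apply Rabs_pos | left; apply Rinv_0_lt_compat; lra |].
    apply Rinv_le_contravar; lra. }
  replace ((A + B) / T * (1 - delta) - 1) with ((A / T - 1 + B / T) * (1 - delta) + - delta) by (field; lra).
  eapply Rle_trans; [apply Rabs_triang|]. rewrite Rabs_Ropp, (Rabs_pos_eq delta) by lra.
  rewrite Rabs_mult, (Rabs_pos_eq (1 - delta)) by lra.
  assert (X := Rabs_triang (A / T - 1) (B / T)).
  assert (X0 := Rabs_pos (A / T - 1 + B / T)).
  unfold Rdiv in *. nra.
Qed.

Section Comparison.
Variables (zeta : C -> C) (c : R).
Hypothesis Hz : is_Riemann_zeta zeta.
Hypothesis Hc : - PI / 3 < c < PI / 3.

Let main (s : R) : C := (2 * RtoC (sqrt 3) * RtoC (Rpower 6 (- s)) * zeta (RtoC (2 * s)))%C.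

(** For [s <= -5] the main term vanishes exactly at the integers, where [2 s] is a trivial zero of
    zeta. [Dstar] vanishes there as well, so the value [0] keeps both the identity and the limit. *)
Definition relative_error (s : R) : C :=
  if Ceq_dec (main s) 0 then 0 else (Dstar c (RtoC s) / main s - 1)%C.

Lemma relative_error_estimate sigma : 5 <= sigma ->
  ex_vertical_integral c (Dstar_integrand (RtoC (- sigma))) /\
  Dstar c (RtoC (- sigma)) = ((1 + relative_error (- sigma)) * main (- sigma))%C /\
  Cmod (relative_error (- sigma)) <= 120 / sigma.
Proof.
  intros Hs. assert (Pi := PI_gt_3).
  destruct (Dstar_formula sigma c ltac:(lra) ltac:(lra)) as [A [B [HW [LA [HB [Hex HD]]]]]].
  split; auto.
  destruct (eta_neg (2 * sigma) ltac:(lra)) as [T0 [Hex0 [L0 He]]].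
  destruct (rescaled_integral _ _ Hex0 L0) as [Hh LT].
  set (T := PI * Rpower PI (2 * sigma) * T0) in *.
  assert (HT := T_ge_sigma sigma Hs T Hh LT).
  assert (HR := ratio_bound sigma Hs A T Hh HW LT LA).
  assert (Ez := eta_zeta zeta (- (2 * sigma)) Hz ltac:(lra)).
  rewrite He in Ez.
  replace (- RtoC (- (2 * sigma)))%C with (RtoC (2 * sigma)) in Ez by (rewrite (RtoC_opp (2 * sigma)); ring).
  rewrite Cpower_2_R in Ez.
  replace (2 * sigma * (PI / 2)) with (PI * sigma) in Ez by field.
  set (S := sin (PI * sigma)) in *. set (P := Rpower 2 (2 * sigma)) in *.
  assert (HP : sigma <= P).
  { unfold P, Rpower. generalize (exp_ineq1_le (2 * sigma * ln 2)) ln_lt_2. nra. }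
  assert (Hden : 1 - 2 * P <> 0) by lra.
  assert (HdenC : RtoC (1 - 2 * P) <> 0) by (intros E; apply RtoC_inj in E; auto).
  assert (Ezeta : zeta (RtoC (- (2 * sigma))) = RtoC (S * T0 / (1 - 2 * P))).
  { rewrite RtoC_div, <- Ez, RtoC_minus, RtoC_mult by auto. field.
    rewrite RtoC_minus, RtoC_mult in HdenC. exact HdenC. }
  assert (Emain : main (- sigma) = RtoC (2 * sqrt 3 * Rpower 6 sigma * (S * T0 / (1 - 2 * P)))).
  { unfold main. rewrite Ropp_involutive.
    replace (2 * - sigma) with (- (2 * sigma)) by ring. rewrite Ezeta, !RtoC_mult. reflexivity. }
  assert (Hpi : 0 < Rpower PI (2 * sigma)) by apply exp_pos.
  assert (HT0 : 0 < T0).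
  { apply Rmult_lt_reg_l with (PI * Rpower PI (2 * sigma)); [nra|]. fold T. lra. }
  assert (HS3 : 0 < sqrt 3) by (apply sqrt_lt_R0; lra).
  assert (HS3' : 1 <= sqrt 3).
  { rewrite <- sqrt_1. apply sqrt_le_1_alt. lra. }
  assert (H6 : 0 < Rpower 6 sigma) by apply exp_pos.
  assert (Hk : 0 < Rpower ucoef sigma) by apply exp_pos.
  unfold relative_error. destruct (Req_dec S 0) as [HS|HS].
  - assert (E0 : main (- sigma) = 0).
    { rewrite Emain, HS. f_equal. field. auto. }
    destruct Ceq_dec as [_|N]; [|tauto]. split.
    + rewrite HD, E0, HS. unfold Rdiv. rewrite Rmult_0_l, Ropp_0, Rmult_0_l. ring.
    + rewrite Cmod_0. apply Rdiv_le_0_compat; lra.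
  - assert (Hmr : 2 * sqrt 3 * Rpower 6 sigma * (S * T0 / (1 - 2 * P)) <> 0).
    { repeat apply Rmult_integral_contrapositive_currified; try lra. apply Rinv_neq_0_compat; auto. }
    assert (Hm : main (- sigma) <> 0).
    { rewrite Emain. intros E. apply RtoC_inj in E. auto. }
    destruct Ceq_dec as [E|_]; [tauto|]. split; [field; auto|].
    rewrite HD, Emain, <- RtoC_div, <- RtoC_minus, Cmod_R by auto.
    set (B' := B / (sqrt 3 * Rpower ucoef sigma)).
    (* The sine [S] cancels, and the minus sign joins the negative factor [1 - 2 P]:
       [- (1 - 2 P) / (2 P) = 1 - 1 / (2 P)]. *)
    replace (- (S / PI) * (sqrt 3 * Rpower ucoef sigma * A + B) /
        (2 * sqrt 3 * Rpower 6 sigma * (S * T0 / (1 - 2 * P))) - 1)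
      with ((A + B') / T * (1 - 1 / (2 * P)) - 1).
    + apply ratio_estimate; auto.
      * unfold B'. unfold Rdiv. rewrite Rabs_mult, Rabs_inv.
        rewrite (Rabs_pos_eq (sqrt 3 * Rpower ucoef sigma)) by nra.
        apply Rcomplements.Rle_div_l; nra.
      * split; [apply Rdiv_lt_0_compat; lra|]. unfold Rdiv. rewrite !Rmult_1_l.
        apply Rinv_le_contravar; lra.
    + rewrite <- ucoef_power. fold P. unfold B', T. field. repeat split; lra.
Qed.
End Comparison.

Theorem theorem2p3 :
  forall (zeta : C -> C), is_Riemann_zeta zeta ->
  forall c : R, - PI / 3 < c < PI / 3 ->
  exists eps : R -> C,
    filterlim eps (Rbar_locally m_infty) (@locally C_UniformSpace (RtoC 0)) /\
    Rbar_locally m_infty (fun s : R =>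
      ex_vertical_integral c (Dstar_integrand (RtoC s)) /\
      Dstar c (RtoC s) =
        ((1 + eps s) *
         (2 * RtoC (sqrt 3) * RtoC (Rpower 6 (- s)) * zeta (RtoC (2 * s))))%C).
Proof.
  intros zeta Hz c Hc. exists (relative_error zeta c).
  assert (K : forall s, s <= -5 ->
    ex_vertical_integral c (Dstar_integrand (RtoC s)) /\
    Dstar c (RtoC s) = ((1 + relative_error zeta c s) *
      (2 * RtoC (sqrt 3) * RtoC (Rpower 6 (- s)) * zeta (RtoC (2 * s))))%C /\
    Cmod (relative_error zeta c s) <= 120 / - s).
  { intros s Hs. rewrite <- (Ropp_involutive s) at 1 2 3 4 5.
    rewrite <- (Ropp_involutive s) at 6.
    apply (relative_error_estimate zeta c Hz Hc (- s)). lra. }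
  split.
  - intros P [e HP].
    exists (- (5 + 120 / e)). intros s Hs. apply HP.
    assert (He := cond_pos e). assert (Hq : 0 < 120 / e) by (apply Rdiv_lt_0_compat; lra).
    destruct (K s ltac:(lra)) as [_ [_ B]].
    assert (B' : Cmod (relative_error zeta c s) < e).
    { eapply Rle_lt_trans; [exact B|]. apply Rcomplements.Rlt_div_l; [lra|].
      assert (X : 120 / e < - s) by lra. apply Rcomplements.Rlt_div_l in X; lra. }
    replace (relative_error zeta c s) with (relative_error zeta c s - RtoC 0)%C in B' by ring.
    split.
    + eapply Rle_lt_trans; [|exact B']. apply (re_le_Cmod (relative_error zeta c s - RtoC 0)).
    + eapply Rle_lt_trans; [|exact B']. apply (im_le_Cmod (relative_error zeta c s - RtoC 0)).
  - exists (-5). intros s Hs. destruct (K s ltac:(lra)) as [K1 [K2 _]]. auto.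
Qed.
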